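(* Let $x_0\in\mathcal U$ be a non-singular point of the system $\frac{dy}{dx}=A(x)y$, and let $\mathcal V$ be a simply-connected neighbourhood of $x_0$ in $\mathcal U$. Then for each polynomial vector field $Y^{(0)}\in\mathfrak X[\mathbb C^n]^{<\infty}$ there is a unique polynomial vertical symmetry $Y\in\mathbf{sym}_X(\mathcal V)^{<\infty}$ such that $Y(x_0)=Y^{(0)}$. Moreover, $\mathbf{sym}_X(\mathcal V)^{<\infty}$ and $\mathfrak X[\mathbb C^n]^{<\infty}$ are isomorphic Lie algebras.
   Context: Let $\mathcal U$ be an open subset of the complex projective line $\mathbb{CP}_1$, with affine coordinate $x$. A function field $\mathcal K$ is a subfield of the field of meromorphic functions on $\mathcal U$ that contains the constants $\mathbb C$ and is closed under the derivation $\frac{d}{dx}$; fix one. Let $A(x)=(a_{ij}(x))\in\mathfrak{gl}(n,\mathcal K)$, and consider the linear system $\frac{dy}{dx}=A(x)y$, $y=(y_1,\ldots,y_n)$, with associated meromorphic vector field on $\mathcal U\times\mathbb C^n$ $$X=\frac{\partial}{\partial x}+\sum_{i,j=1}^n a_{ij}(x)y_j\frac{\partial}{\partial y_i}.$$ The singularities of the system are the poles of $A(x)$; the point at infinity may be considered as a singularity depending on its behaviour after a suitable change of coordinates. For $\mathcal V\subseteq\mathcal U$ open, a vertical symmetry of $X$ on $\mathcal V\times\mathbb C^n$ is an analytic vector field $Y$ on $\mathcal V\times\mathbb C^n$ with $[Y,X]=0$ and $Yx=0$. $\mathbf{sym}_X(\mathcal V)^{<\infty}$ is the Lie algebra of those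 vertical symmetries $Y=\sum_{i=1}^n f_i(x,y)\frac{\partial}{\partial y_i}$ on $\mathcal V\times\mathbb C^n$ whose components $f_i$ are polynomials in the variables $y_1,\ldots,y_n$ (polynomial vertical symmetries). $\mathfrak X[\mathbb C^n]^{<\infty}$ is the Lie algebra of polynomial vector fields $\sum_{i=1}^n P_i(y)\frac{\partial}{\partial y_i}$, $P_i\in\mathbb C[y_1,\ldots,y_n]$, on $\mathbb C^n$. $Y(x_0)$ denotes the polynomial vector field on $\mathbb C^n$ obtained by restricting $Y$ to the fibre $\{x_0\}\times\mathbb C^n$.
   Formalization: The neighbourhood V is assumed to contain no singular point of the system, not only x_0 non-singular; otherwise the claim fails, e.g. y'=y/x, x_0=1, V a disc containing 0, Y^(0)=y^2 d/dy forces Y=(y^2/x) d/dy, which is not analytic at 0. *)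

(* Defs.v *)
From HB Require Import structures.
From mathcomp Require Import all_boot all_order all_algebra.
From mathcomp Require Import finmap complex.
From mathcomp Require Import all_classical all_reals all_analysis.
From mathcomp Require Import summability.
From mathcomp Require Import -(notations) mpoly.

Set Implicit Arguments.
Unset Strict Implicit.
Unset Printing Implicit Defensive.
Import Order.TTheory GRing.Theory Num.Theory.
Import numFieldNormedType.Exports.
Local Open Scope classical_set_scope.
Local Open Scope ring_scope.

(* Typed as a numFieldType so that the topology of the complex modulus is
   inferred. *)
Definition Cplx (R : realType) : numFieldType := R[i].

(** * The complex projective line *)

(* [Some z] is the point of affine coordinate x = z, [None] is the point at
   infinity. *)
Definition CP1 (R : realType) : topologicalType :=
  one_point_compactification (Cplx R).

(* Holomorphic chart centred at [p]: t = x - a at the finite point a, and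
   t = 1 / x at infinity. *)
Definition chart (R : realType) (p : CP1 R) (t : Cplx R) : CP1 R :=
  match p with
  | Some a => Some (a + t)
  | None => if t == 0 then None else Some t^-1
  end.

(* dx/dt for the coordinate t of [chart p], as a function on CP1 (meaningful
   at finite points): dx = - x ^ 2 dt when t = 1 / x. *)
Definition jac (R : realType) (p q : CP1 R) : Cplx R :=
  match p, q with
  | Some _, _ => 1
  | None, Some z => - z ^+ 2
  | None, None => 0
  end.

Definition simply_connected (R : realType) (T : topologicalType) (V : set T) :=
  [/\ V !=set0,
      forall a b, V a -> V b -> exists g : R -> T,
        [/\ {within `[0, 1], continuous g},
            (forall t : R, 0 <= t <= 1 -> V (g t)), g 0 = a & g 1 = b]
    & forall g : R -> T,
        {within `[0, 1], continuous g} ->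
        (forall t : R, 0 <= t <= 1 -> V (g t)) -> g 0 = g 1 ->
        exists H : R * R -> T,
          [/\ {within [set u : R * R | 0 <= u.1 <= 1 /\ 0 <= u.2 <= 1], continuous H},
              (forall s t : R, 0 <= s <= 1 -> 0 <= t <= 1 -> V (H (s, t))),
              (forall t : R, 0 <= t <= 1 -> H (0, t) = g t),
              (forall t : R, 0 <= t <= 1 -> H (1, t) = g 0)
            & forall s : R, 0 <= s <= 1 -> H (s, 0) = g 0 /\ H (s, 1) = g 0]].

(** * Analytic and meromorphic functions on open sets of CP1 *)

Section Meromorphic.
Variable R : realType.
Local Notation C := (Cplx R).
Implicit Types (U : set (CP1 R)) (f g h : CP1 R -> C) (p : CP1 R).

Definition analytic_at0 (u : C -> C) :=
  exists c : nat -> C,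
    \forall t \near (0 : C), [series c k * t ^+ k]_k @ \oo --> u t.

Definition analytic_at f p := analytic_at0 (f \o chart p).

(* The value of [f] at the pole itself is irrelevant. *)
Definition pole_at f p :=
  exists (k : nat) (u : C -> C),
    [/\ analytic_at0 u, u 0 != 0
      & \forall t \near (0 : C)^', f (chart p t) = t ^- k.+1 * u t].

Definition meromorphic_on U f :=
  forall p, U p -> analytic_at f p \/ pole_at f p.

(* Equality as meromorphic functions on [U], i.e. off a discrete subset, where
   the functions may take junk values. *)
Definition mero_eq U f g :=
  forall p, U p -> \forall t \near (0 : C)^', f (chart p t) = g (chart p t).

(* d/dx, with a junk value at infinity *)
Definition ddx f : CP1 R -> C :=
  fun p => if p is Some a then derive1 (fun z : C => f (Some z)) a else 0.

(* [K] is a set of representatives, modulo [mero_eq U], of a subfield of the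
   meromorphic functions on [U] containing C and stable under d/dx.  [U] is not
   required to be connected: the condition is that the classes of [K] form a
   field. *)
Record function_field U (K : set (CP1 R -> C)) : Prop := FunctionField {
  ff_mero : forall f, K f -> meromorphic_on U f;
  ff_const : forall c : C, exists2 h, K h & mero_eq U h (cst c);
  ff_sub : forall f g, K f -> K g ->
    exists2 h, K h & mero_eq U h (fun p => f p - g p);
  ff_mul : forall f g, K f -> K g ->
    exists2 h, K h & mero_eq U h (fun p => f p * g p);
  ff_inv : forall f, K f -> ~ mero_eq U f (cst 0) ->
    exists2 h, K h & mero_eq U (fun p => f p * h p) (cst 1);
  ff_ddx : forall f, K f -> exists2 h, K h & mero_eq U h (ddx f)
}.

End Meromorphic.

(** * Lie algebras *)

(* Subspace [L] of [E], with a bracket which only matters on [L]. *)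
Record lie_algebra (K : fieldType) (E : lmodType K) (L : set E)
    (br : E -> E -> E) : Prop := LieAlgebra {
  lie0 : L 0;
  lie_lin : forall a u v, L u -> L v -> L (a *: u + v);
  lie_br : forall u v, L u -> L v -> L (br u v);
  lie_brl : forall a u v w, L u -> L v -> L w ->
    br (a *: u + v) w = a *: br u w + br v w;
  lie_brr : forall a u v w, L u -> L v -> L w ->
    br w (a *: u + v) = a *: br w u + br w v;
  lie_alt : forall u, L u -> br u u = 0;
  lie_jacobi : forall u v w, L u -> L v -> L w ->
    br u (br v w) + br v (br w u) + br w (br u v) = 0
}.

Definition lie_isomorphic (K : fieldType)
    (E1 : lmodType K) (L1 : set E1) (br1 : E1 -> E1 -> E1)
    (E2 : lmodType K) (L2 : set E2) (br2 : E2 -> E2 -> E2) : Prop :=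
  [/\ lie_algebra L1 br1, lie_algebra L2 br2
    & exists phi : E1 -> E2,
      [/\ set_bij L1 L2 phi,
          forall a u v, L1 u -> L1 v -> phi (a *: u + v) = a *: phi u + phi v
        & forall u v, L1 u -> L1 v -> phi (br1 u v) = br2 (phi u) (phi v)]].

(** * Vector fields *)

(* As derivations, the k-th component of [W1, W2] is W1(W2^k) - W2(W1^k). *)
Definition lie_bracket (K : numFieldType) (E : normedModType K)
    (W1 W2 : E -> E) : E -> E :=
  fun w => 'D_(W1 w) W2 w - 'D_(W2 w) W1 w.

Section VectorFields.
Variables (R : realType) (n : nat).
Local Notation C := (Cplx R).
Implicit Types (V : set (CP1 R)) (A : 'M[CP1 R -> C]_n) (p : CP1 R).

(* Coordinates (t, y) on CP1 x C^n, with t given by some [chart p]. *)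
Definition tot : normedModType C := (C * 'cV[C]_n)%type.

(* A field sum_i f_i(x, y) d/dy_i is given by its components (f_i)_i. *)
Definition vfield : lmodType C := CP1 R -> 'cV[C]_n -> 'cV[C]_n.

Implicit Types Y Z : vfield.

(* The components f_i do not depend on the coordinate chosen on CP1. *)
Definition vert_loc Y p : tot -> tot :=
  fun w => (0, Y (chart p w.1) w.2).

(* X = d/dx + sum_ij a_ij y_j d/dy_i in the coordinates (t, y); d/dx is d/dt
   near a finite point and - t ^ 2 d/dt near infinity. *)
Definition X_loc A p : tot -> tot :=
  fun w => (if p is Some _ then 1 else - w.1 ^+ 2,
            (\matrix_(i, j) A i j (chart p w.1)) *m w.2).

(* In the coordinate t of [chart p] the system reads dy/dt = (dx/dt) A y; at
   a finite point [p] this just says that A has a pole at [p]. *)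
Definition singular A p :=
  exists i j, pole_at (fun q => jac p q * A i j q) p.

(* t ^ k * prod_j (y_j - b_j) ^ m_j, at the point (t, y) *)
Definition monomial (b : 'cV[C]_n) (km : nat * multinom n) (w : tot) : C :=
  w.1 ^+ km.1 * \prod_(j < n) (w.2 j 0 - b j 0) ^+ km.2 j.

(* Joint analyticity on V x C^n: locally the (unconditional) sum of a power
   series in t and the y_j - b_j. *)
Definition analytic_vfield V Y :=
  forall p (b : 'cV[C]_n) (i : 'I_n), V p ->
  exists c : nat * multinom n -> C,
    \forall w \near ((0, b) : tot),
      partial_sum (fun km => c km * monomial b km w) @ totally
        --> Y (chart p w.1) w.2 i 0.

(* Polynomial vector fields sum_i P_i d/dy_i on C^n. *)
Definition pvfield : lmodType C := {ffun 'I_n -> mpoly n C}.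

Definition pvbracket (P Q : pvfield) : pvfield :=
  [ffun i => \sum_(j < n) (P j * mderiv j (Q i) - Q j * mderiv j (P i))].

(* The field [F] on C^n is the polynomial field [P]. *)
Definition is_pvfield (F : 'cV[C]_n -> 'cV[C]_n) (P : pvfield) :=
  forall y i, F y i 0 = meval (fun j => y j 0) (P i).

(* The components are polynomials in y, of degree bounded independently of x,
   with coefficients depending on x. *)
Definition polynomial_vfield V Y :=
  exists d : nat, forall p, V p ->
    exists2 P : pvfield, is_pvfield (Y p) P & forall i, (msize (P i) <= d)%N.

(* Vertical symmetries of X on V x C^n.  A field on V x C^n is encoded as a
   total function vanishing off V, so that equality of such fields is [=]. *)
Definition vertical_symmetry A V Y :=
  [/\ forall p, ~ V p -> Y p = 0,
      analytic_vfield V Y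
    & forall p y, V p -> lie_bracket (vert_loc Y p) (X_loc A p) (0, y) = 0].

Definition sym A V : set vfield :=
  [set Y | vertical_symmetry A V Y /\ polynomial_vfield V Y].

Definition vbracket Y Z : vfield :=
  fun p y => (lie_bracket (vert_loc Y p) (vert_loc Z p) (0, y)).2.

End VectorFields.

(* Main.v *)
Require Import Defs.
From mathcomp Require Import all_boot all_order all_algebra.
From mathcomp Require Import finmap complex.
From mathcomp Require Import all_classical all_reals all_analysis.
From mathcomp Require Import summability.
From mathcomp Require Import -(notations) mpoly.
From mathcomp Require Import ring lra.
Set Implicit Arguments.
Unset Strict Implicit.
Unset Printing Implicit Defensive.
Import Order.TTheory GRing.Theory Num.Theory.
Import numFieldNormedType.Exports.
Local Open Scope classical_set_scope.
Local Open Scope ring_scope.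

(** Let [Phi] be the fundamental matrix of the system on [V] with
    [Phi x0 = 1], and [Psi] its inverse: [Phi' = A Phi] and [Psi' = - Psi A].
    The integral curves of [X] are the [x |-> (x, Phi(x) c)], so a vertical
    field commutes with [X] exactly when it is carried along by the flow.
    Explicitly, if [Y] is a vertical symmetry then, for [c] fixed,
    [Psi(x) Y(x, Phi(x) c)] has derivative zero, hence is equal to [Y(x0, c)]
    on the connected set [V].  Thus [Y] is determined by [Y(x0) = P], as
    [Y(x, y) = Phi(x) P(Psi(x) y)].  Conversely this formula (the operation
    [push] below) defines a polynomial vertical symmetry for every polynomial
    field [P], whose degree is that of [P] and does not depend on [x].  Since
    [push] is a linear change of coordinates in each fibre, it respects
    brackets; it is the inverse of the isomorphism [Y |-> Y(x0)].

    Three points take work.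

    The matrix [Phi] is global.  Near a non-singular point a normalised
    solution is a power series whose coefficients satisfy a recursion; they
    are bounded by a geometric sequence ([sol_bound]) and the series may be
    differentiated termwise ([local_solution]).  These local solutions form a
    local system on [V], and the local system has a global frame because [V]
    is simply connected: transport along paths exists, and a homotopy
    contracting a loop shows that the monodromy is trivial
    ([horizontal_loop], [global_section], [fundamental_matrix]).

    The set [V] may contain the point at infinity.  There the coordinate is
    [t = 1 / x], and [d/dx] is [- t ^ 2 d/dt].  Non-singularity forces [A] to
    vanish to the second order ([regular_at_infinity]), so the system is an
    ordinary linear system in [t], while [X] itself and [A] vanish on the
    fibre over infinity.  Identities are proved at finite points, and
    extended to infinity by continuity ([flat_near_const]).

    Symmetries are analytic in the sense of unconditionally convergent power
    series in all the variables.  Such series converge absolutely, which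
    gives first order expansions ([joint_series_expands]) and from there the
    chain rule and continuity needed to differentiate [Y] along the integral
    curves ([expands_chain], [derive_along_flow], [pull_constant]).  In the
    other direction, polynomials in [y] whose coefficients are analytic in
    [t] are shown to be sums of such series ([polyan_joint]). *)

(** * The complex modulus as a real number *)

Section ComplexNorm.
Variable R : realType.
Local Notation C := (Cplx R).

(** The norm over [C] takes its values in [C], on the non-negative real axis;
    [cn] reads it in [R], where estimates are carried out in an ordered field. *)
Definition cn (V : normedModType C) (x : V) : R := complex.Re `|x|.

Section NormedModule.
Variable V : normedModType C.
Implicit Types x y : V.

Lemma cnE x : `|x| = (cn x)%:C%C :> C.
Proof.
have := normr_ge0 x; rewrite /cn; case: `|x| => a b /=.
by move=> /andP[/eqP /= -> _].
Qed.

Lemma cn_ge0 x : 0 <= cn x.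
Proof. by rewrite -ler0c -cnE normr_ge0. Qed.

Lemma cn_le x r : (`|x| <= r%:C%C :> C) = (cn x <= r).
Proof. by rewrite cnE lecR. Qed.

Lemma cn_lt x r : (`|x| < r%:C%C :> C) = (cn x < r).
Proof. by rewrite cnE ltcR. Qed.

Lemma cnD x y : cn (x + y) <= cn x + cn y.
Proof. by rewrite -lecR rmorphD /= -!cnE ler_normD. Qed.

Lemma cnN x : cn (- x) = cn x.
Proof. by rewrite /cn normrN. Qed.

Lemma cnB x y : cn (x - y) = cn (y - x).
Proof. by rewrite -cnN opprB. Qed.

Lemma cn0 : cn (0 : V) = 0.
Proof. by rewrite /cn normr0. Qed.

Lemma cn_eq0 x : (cn x == 0) = (x == 0).
Proof. by rewrite -(normr_eq0 x) cnE -(inj_eq (@complexI R)). Qed.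

Lemma cn_gt0 x : (0 < cn x) = (x != 0).
Proof. by rewrite lt_neqAle cn_ge0 andbT eq_sym cn_eq0. Qed.

Lemma cn_sum (I : Type) (s : seq I) (P : pred I) (F : I -> V) :
  cn (\sum_(i <- s | P i) F i) <= \sum_(i <- s | P i) cn (F i).
Proof.
elim/big_rec2: _ => [|i y x _ h]; first by rewrite cn0.
by apply: (le_trans (cnD _ _)); rewrite lerD2l.
Qed.

Lemma nbhs_cnP x (A : set V) :
  nbhs x A <-> exists2 r : R, 0 < r & forall y, cn (y - x) < r -> A y.
Proof.
split.
  move=> /nbhs_ballP[e /= e0 h]; exists (complex.Re e).
    by move: e0; rewrite ltcE => /andP[].
  move=> y yx; apply: h; rewrite -ball_normE /= distrC cnE ltcE /= yx andbT.
  by move: e0; rewrite ltcE => /andP[].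
move=> [r r0 h]; apply/nbhs_ballP; exists r%:C%C; first by rewrite /= ltcR.
by move=> y; rewrite -ball_normE /= distrC cn_lt; exact: h.
Qed.

Lemma cvg_cnP (T : Type) (F : set_system T) (FF : Filter F) (f : T -> V) x :
  f @ F --> x <-> forall e : R, 0 < e -> \forall t \near F, cn (f t - x) < e.
Proof.
split=> [/cvgrPdist_lt h e e0|h].
  have e0' : 0 < e%:C%C :> C by rewrite ltcR.
  by near do rewrite -cn_lt distrC; exact: h.
apply/cvgrPdist_lt => e; rewrite ltcE => /andP[/eqP /= ie re].
have := h _ re; apply: filterS => t.
by rewrite distrC cnE ltcE /= ie eqxx.
Unshelve. all: by end_near. Qed.

End NormedModule.

Lemma cnZ (V : normedModType C) (a : C) (x : V) : cn (a *: x) = cn a * cn x.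
Proof.
by apply: (@complexI R); rewrite rmorphM /= -!cnE normrZ.
Qed.

Implicit Types x y : C.

Lemma cnM x y : cn (x * y) = cn x * cn y.
Proof. exact: cnZ. Qed.

Lemma cn1 : cn (1 : C) = 1.
Proof. by rewrite /cn normr1. Qed.

Lemma cnX x n : cn (x ^+ n) = cn x ^+ n.
Proof. by elim: n => [|n IH]; rewrite ?expr0 ?cn1// !exprS cnM IH. Qed.

Lemma cnV x : cn (x^-1) = (cn x)^-1.
Proof.
by apply: (@complexI R); rewrite fmorphV /= -!cnE normfV.
Qed.

Lemma cn_nat n : cn (n%:R : C) = n%:R.
Proof. by rewrite /cn normr_nat -raddfMn. Qed.

Lemma cn_real (r : R) : cn (r%:C%C : C) = `|r|.
Proof. by rewrite /cn normc_def /= expr0n /= addr0 sqrtr_sqr. Qed.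

Lemma cn_ReIm x : cn x <= `|complex.Re x| + `|complex.Im x|.
Proof.
rewrite /cn normc_def /= -(@ler_pXn2r _ 2) ?nnegrE ?addr_ge0 ?sqrtr_ge0//.
rewrite sqr_sqrtr ?addr_ge0 ?sqr_ge0// sqrrD !real_normK ?num_real//.
by rewrite lerD2r lerDl mulrn_wge0// mulr_ge0.
Qed.

Lemma cn_Re x : `|complex.Re x| <= cn x.
Proof.
rewrite /cn normc_def /= -sqrtr_sqr ler_wsqrtr// lerDl sqr_ge0//.
Qed.

Lemma cn_Im x : `|complex.Im x| <= cn x.
Proof.
rewrite /cn normc_def /= -sqrtr_sqr ler_wsqrtr// lerDr sqr_ge0//.
Qed.

Lemma cvg_ReIm (T : Type) (F : set_system T) (FF : Filter F) (f : T -> C) (a b : R) :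
  complex.Re (f t) @[t --> F] --> a -> complex.Im (f t) @[t --> F] --> b ->
  f @ F --> ((a +i* b)%C : C).
Proof.
move=> /cvgrPdist_lt ha /cvgrPdist_lt hb; apply/(@cvg_cnP C) => e e0.
have e20 : 0 < e / 2 by lra.
have := ha _ e20; have := hb _ e20.
apply: filterS2 => t h1 h2; apply: (le_lt_trans (cn_ReIm _)).
rewrite distrC in h1; rewrite distrC in h2.
case: (f t) h1 h2 => c d /= h1 h2; rewrite [e]splitr; exact: ltrD.
Qed.

Lemma ReD x y : complex.Re (x + y) = complex.Re x + complex.Re y.
Proof. by case: x; case: y. Qed.

Lemma ImD x y : complex.Im (x + y) = complex.Im x + complex.Im y.
Proof. by case: x; case: y. Qed.

Lemma ReB x y : complex.Re (x - y) = complex.Re x - complex.Re y.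
Proof. by case: x; case: y. Qed.

Lemma ImB x y : complex.Im (x - y) = complex.Im x - complex.Im y.
Proof. by case: x; case: y. Qed.

Lemma cn_lim_le (V : normedModType C) (T : Type) (F : set_system T)
    (FF : ProperFilter F) (f : T -> V) (l : V) (M : R) :
  f @ F --> l -> (\forall t \near F, cn (f t) <= M) -> cn l <= M.
Proof.
move=> /cvg_cnP h hM; apply/ler_addgt0Pr => e e0.
have [t [h1 h2]] := filter_ex (filterI (h _ e0) hM).
have -> : l = (f t) - (f t - l) by rewrite opprB addrC subrK.
by apply: (le_trans (cnD _ _)); rewrite cnN lerD// ltW.
Qed.

End ComplexNorm.

(** * Convergent power series in one variable *)

Section PowerSeries.
Variable R : realType.
Local Notation C := (Cplx R).
Implicit Types (a b c : nat -> C) (t h : C) (M r : R).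

(** The decay to which every convergence argument on power series is
    reduced: a geometric bound of ratio 1/2 has explicit tails. *)
Definition half_geo a M := forall k, cn (a k) <= M * (2^-1) ^+ k.

Lemma half_geo_ge0 a M : half_geo a M -> 0 <= M.
Proof. by move=> /(_ 0%N); rewrite expr0 mulr1; apply: le_trans (cn_ge0 _). Qed.

Lemma half_geo_tail a M K N : half_geo a M -> (K <= N)%N ->
  cn (series a N - series a K) <= 2 * M * (2^-1) ^+ K.
Proof.
move=> aM KN; have M0 := half_geo_ge0 aM.
suff : cn (series a N - series a K) <= 2 * M * (2^-1) ^+ K - 2 * M * (2^-1) ^+ N.
  move/le_trans; apply; rewrite gerBl mulr_ge0 ?exprn_ge0 ?mulr_ge0//; lra.
elim: N KN => [|N IH]; first by rewrite leqn0 => /eqP ->; rewrite !subrr cn0.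
rewrite leq_eqVlt => /orP[/eqP <-|]; first by rewrite !subrr cn0.
rewrite ltnS => KN; rewrite seriesSr addrAC.
apply: (le_trans (cnD _ _)).
have := IH KN; have := aM N; rewrite exprS; lra.
Qed.

Lemma half_geo_cvg a M : half_geo a M ->
  exists2 l : C, series a @ \oo --> l & cn l <= 2 * M.
Proof.
move=> aM; have M0 := half_geo_ge0 aM.
have gcv : cvgn (series (fun k => M * (2^-1) ^+ k) : R^nat).
  by apply: is_cvg_geometric_series; rewrite ger0_norm; [lra|lra].
have rcv (f : C -> R) : (forall z, `|f z| <= cn z) -> (forall x y, f (x + y) = f x + f y) ->
    f 0 = 0 -> cvgn (fun n => f (series a n)).
  move=> fle fD f0.
  have -> : (fun n => f (series a n)) = series (f \o a).
    apply/funext => n; rewrite /series /=; exact: (big_morph f fD f0).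
  apply: normed_cvg; apply: (series_le_cvg _ _ _ gcv) => k /=.
  - exact: normr_ge0.
  - by rewrite mulr_ge0// exprn_ge0//; lra.
  - exact: le_trans (fle _) (aM _).
have /cvg_ex[/= x xcv] := rcv (@complex.Re R) (@cn_Re R) (@ReD R) erefl.
have /cvg_ex[/= y ycv] := rcv (@complex.Im R) (@cn_Im R) (@ImD R) erefl.
exists ((x +i* y)%C : C); first exact: cvg_ReIm.
apply: (@cn_lim_le R C _ \oo _ (series a)); first exact: cvg_ReIm.
near=> n; have := half_geo_tail aM (leq0n n).
by rewrite {2}/series /= big_geq// subr0 expr0 mulr1.
Unshelve. all: by end_near. Qed.

Definition pterm c t : nat -> C := fun k => c k * t ^+ k.

Definition psum c t : C := limn (series (pterm c t)).

(** A Cauchy estimate.  The number [r] is the inverse of a radius, so that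
    estimates are brought to a common [r] by enlarging it. *)
Definition pbound c M r := forall k, cn (c k) <= M * r ^+ k.

Lemma pbound_ge0 c M r : pbound c M r -> 0 <= M.
Proof. by move=> /(_ 0%N); rewrite expr0 mulr1; apply: le_trans (cn_ge0 _). Qed.

Lemma pbound_le c M r M' r' : 0 <= r -> M <= M' -> r <= r' ->
  pbound c M r -> pbound c M' r'.
Proof.
move=> r0 MM rr cM k; apply: (le_trans (cM k)).
have M0 := pbound_ge0 cM.
by apply: ler_pM; rewrite ?exprn_ge0// lerXn2r// ?nnegrE// (le_trans r0).
Qed.

Lemma pterm_half c M r t : 0 <= r -> pbound c M r -> r * cn t <= 2^-1 ->
  half_geo (pterm c t) M.
Proof.
move=> r0 cM rt k; rewrite /pterm cnM cnX.
have M0 := pbound_ge0 cM.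
apply: (@le_trans _ _ (M * r ^+ k * cn t ^+ k)).
  by rewrite ler_wpM2r// exprn_ge0// cn_ge0.
rewrite -mulrA ler_wpM2l// -exprMn lerXn2r ?nnegrE ?mulr_ge0 ?cn_ge0//; lra.
Qed.

Lemma cvg_psum c M r t : 0 <= r -> pbound c M r -> r * cn t <= 2^-1 ->
  series (pterm c t) @ \oo --> psum c t.
Proof.
move=> r0 cM rt; have [l lc _] := half_geo_cvg (pterm_half r0 cM rt).
by rewrite /psum (cvg_lim _ lc).
Qed.

Lemma psumE c t (l : C) : series (pterm c t) @ \oo --> l -> psum c t = l.
Proof. by move=> h; rewrite /psum (cvg_lim _ h). Qed.

Lemma psum0 c : psum c 0 = c 0%N.
Proof.
apply: psumE; apply: cvg_near_cst; near=> n.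
have n0 : (0 < n)%N by near: n; exact: nbhs_infty_gt.
rewrite /series /= big_ltn// big_nat big1 ?addr0 /pterm ?expr0 ?mulr1//.
by move=> i /andP[i0 _]; rewrite expr0n eqn0Ngt i0 mulr0.
Unshelve. all: by end_near. Qed.

(** Convergence at a single point [t != 0] makes the terms [c k * t ^ k] tend
    to 0, hence bounded: a Cauchy estimate with [r = 1 / |t|]. *)
Lemma pbound_cvg c t (l : C) : t != 0 -> series (pterm c t) @ \oo --> l ->
  exists M, pbound c M (cn t)^-1.
Proof.
move=> t0 scv.
have t0' : 0 < cn t by rewrite lt_neqAle cn_ge0 andbT eq_sym cn_eq0.
have cv1 : pterm c t @ \oo --> (0 : C).
  by apply: cvg_series_cvg_0; apply/cvg_ex; exists l.
move/(@cvg_cnP R C) : cv1 => /(_ _ ltr01)[N _ hN].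
(* The terms of rank at least [N] are below 1, the others below their sum. *)
exists (\sum_(k < N) cn (pterm c t k) + 1) => k.
rewrite exprVn -(ler_pM2r (exprn_gt0 k t0')) -[leRHS]mulrA mulVf ?mulr1; last first.
  by rewrite expf_neq0 ?gt_eqF.
rewrite -cnX -cnM -/(pterm c t k).
have s0 : 0 <= \sum_(k < N) cn (pterm c t k) by apply: sumr_ge0 => *; exact: cn_ge0.
have [kN|kN] := ltnP k N.
  rewrite (bigD1 (Ordinal kN))//= -addrA lerDl addr_ge0//.
  by apply: sumr_ge0 => *; exact: cn_ge0.
by apply: ler_wpDl => //; have := hN _ kN; rewrite /= subr0 => /ltW.
Qed.

Lemma pboundD c c' M M' r : pbound c M r -> pbound c' M' r ->
  pbound (c \+ c') (M + M') r.
Proof.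
move=> h h' k /=; apply: (le_trans (cnD _ _)); rewrite mulrDl; exact: lerD.
Qed.

Lemma psumD c c' M M' r t : 0 <= r -> pbound c M r -> pbound c' M' r ->
  r * cn t <= 2^-1 -> psum (c \+ c') t = psum c t + psum c' t.
Proof.
move=> r0 h h' rt; apply: psumE.
have -> : series (pterm (c \+ c') t) = series (pterm c t) \+ series (pterm c' t).
  apply/funext => n /=; rewrite /series /= -big_split /=.
  by apply: eq_bigr => k _; rewrite /pterm /= mulrDl.
apply: cvgD; exact: cvg_psum rt.
Qed.

Lemma pbound_sum (I : Type) (s : seq I) (c : I -> nat -> C) (M : I -> R) r :
  (forall i, pbound (c i) (M i) r) ->
  pbound (fun k => \sum_(i <- s) c i k) (\sum_(i <- s) M i) r.
Proof.
move=> h k; rewrite mulr_suml; apply: (le_trans (cn_sum _ _ _)).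
by apply: ler_sum => i _; exact: h.
Qed.

Lemma psum_sum (I : Type) (s : seq I) (c : I -> nat -> C) (M : I -> R) r t :
  0 <= r -> (forall i, pbound (c i) (M i) r) -> r * cn t <= 2^-1 ->
  psum (fun k => \sum_(i <- s) c i k) t = \sum_(i <- s) psum (c i) t.
Proof.
move=> r0 h rt; elim: s => [|i s IH].
  rewrite big_nil; apply: psumE; apply: cvg_near_cst; near=> n.
  by rewrite /series /= big1// => k _; rewrite /pterm big_nil mul0r.
rewrite big_cons -IH -(@psumD _ _ (M i) (\sum_(i <- s) M i) r)//.
  suff -> : (c i \+ fun k => \sum_(i <- s) c i k) = fun k => \sum_(j <- i :: s) c j k by [].
  by apply/funext => k; rewrite big_cons.
exact: pbound_sum.
Unshelve. all: by end_near. Qed.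

Definition cauchy_prod c c' : nat -> C := fun k => \sum_(i < k.+1) c i * c' (k - i)%N.

Lemma natr_le_exp2 k : k.+1%:R <= 2 ^+ k :> R.
Proof. by rewrite -natrX ler_nat ltn_expl. Qed.

(** The coefficient of order [k] is a sum of [k + 1] products, each at most
    [M * M' * r ^ k]; doubling [r] absorbs the factor [k + 1 <= 2 ^ k]. *)
Lemma pbound_cauchy c c' M M' r : 0 <= r -> pbound c M r -> pbound c' M' r ->
  pbound (cauchy_prod c c') (M * M') (2 * r).
Proof.
move=> r0 h h' k; rewrite /cauchy_prod; apply: (le_trans (cn_sum _ _ _)).
have M0 := pbound_ge0 h; have M'0 := pbound_ge0 h'.
apply: (@le_trans _ _ (\sum_(i < k.+1) M * M' * r ^+ k)).
  apply: ler_sum => i _; rewrite cnM.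
  have -> : r ^+ k = r ^+ i * r ^+ (k - i) by rewrite -exprD subnKC// -ltnS.
  by rewrite mulrACA; apply: ler_pM; rewrite ?cn_ge0.
rewrite sumr_const card_ord exprMn -[leLHS]mulr_natl mulrCA [leLHS]mulrC -mulrA.
rewrite mulrC -!mulrA ler_wpM2l// ler_wpM2l// ler_wpM2r ?exprn_ge0//.
exact: natr_le_exp2.
Qed.

Lemma series_cauchy a b N :
  series (cauchy_prod a b) N = \sum_(i < N) a i * series b (N - i)%N.
Proof.
elim: N => [|N IH]; first by rewrite /series /= big_geq// big_ord0.
rewrite seriesSr IH /cauchy_prod big_ord_recr [in RHS]big_ord_recr /= subnn.
rewrite subSnn addrA -big_split /=; congr (_ + _); last first.
  by rewrite /series /= big_nat1.
apply: eq_bigr => i _; rewrite subSn ?seriesSr; last exact: ltnW.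
by rewrite mulrDr addrC.
Qed.

Lemma cauchy_pterm c c' t : pterm (cauchy_prod c c') t = cauchy_prod (pterm c t) (pterm c' t).
Proof.
apply/funext => k; rewrite /pterm /cauchy_prod mulr_suml; apply: eq_bigr => i _.
have -> : t ^+ k = t ^+ i * t ^+ (k - i) by rewrite -exprD subnKC// -ltnS.
by rewrite mulrACA.
Qed.

(** By [series_cauchy], the product of the partial sums differs from the
    partial sum of the product by [\sum_(i < N) a i * (tail of b from N - i)].
    For [r * |t| <= 1/4] the factor [a i] decays like [4 ^ - i] and the tail like
    [2 ^ (i - N)], so the difference is [O(N / 2 ^ N)]. *)
Lemma psumM c c' M M' r t : 0 <= r -> pbound c M r -> pbound c' M' r ->
  r * cn t <= 4^-1 -> psum (cauchy_prod c c') t = psum c t * psum c' t.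
Proof.
move=> r0 h h' rt; apply: psumE; rewrite cauchy_pterm.
have rt2 : r * cn t <= 2^-1 by lra.
have M0 := pbound_ge0 h; have M'0 := pbound_ge0 h'.
set a := pterm c t; set b := pterm c' t.
have cvb := cvg_psum r0 h' rt2.
have bM : half_geo b M' by exact: pterm_half rt2.
have aM k : cn (a k) <= M * (4^-1) ^+ k.
  rewrite /a /pterm cnM cnX (le_trans (ler_wpM2r _ (h k))) ?exprn_ge0 ?cn_ge0//.
  rewrite -mulrA ler_wpM2l// -exprMn lerXn2r ?nnegrE ?mulr_ge0 ?cn_ge0//; lra.
have tailb m : cn (series b m - psum c' t) <= 2 * M' * (2^-1) ^+ m.
  rewrite cnB; apply: (@cn_lim_le R C _ \oo _ (fun n => series b n - series b m)).
    exact: (@cvgB C C nat \oo _ (series b) (cst (series b m)) _ _ cvb (@cvg_cst C _ _ _ _)).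
  by near=> n; apply: half_geo_tail bM _; near: n; exact: nbhs_infty_ge.
have err N : cn (series (cauchy_prod a b) N - series a N * psum c' t)
    <= 2 * M * M' * (N%:R * (2^-1) ^+ N).
  rewrite series_cauchy {2}/series /= big_mkord mulr_suml -sumrB.
  apply: (le_trans (cn_sum _ _ _)).
  apply: (@le_trans _ _ (\sum_(i < N) 2 * M * M' * (2^-1) ^+ N)); last first.
    by rewrite sumr_const card_ord -[leLHS]mulr_natr -!mulrA [(2^-1) ^+ N * _]mulrC.
  apply: ler_sum => i _; rewrite -mulrBr cnM.
  apply: (le_trans (ler_pM (cn_ge0 _) (cn_ge0 _) (aM i) (tailb (N - i)%N))).
  have -> : (2^-1 : R) ^+ N = 2^-1 ^+ i * 2^-1 ^+ (N - i).
    by rewrite -exprD subnKC// ltnW.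
  have -> : M * 4^-1 ^+ i * (2 * M' * 2^-1 ^+ (N - i)) = 2 * M * M' * (4^-1 ^+ i * 2^-1 ^+ (N - i)) by ring.
  rewrite ler_wpM2l ?mulr_ge0// ler_wpM2r ?exprn_ge0// ?invr_ge0//.
  by rewrite lerXn2r ?nnegrE//; lra.
have cva := cvg_psum r0 h rt2.
have cv0 : (series (cauchy_prod a b) N - series a N * psum c' t) @[N --> \oo] --> (0 : C).
  apply/(@cvg_cnP R C) => e e0.
  have cvz : 2 * M * M' * (N%:R * (2^-1) ^+ N) @[N --> \oo] --> (0 : R).
    rewrite -[X in _ --> X](mulr0 (2 * M * M')); apply: cvgMr.
    apply: (@squeeze_cvgr _ _ _ _ (fun=> 0) (fun N => 1 * (3 / 4) ^+ N)); last 2 first.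
    - exact: cvg_cst.
    - by apply: cvg_geometric; rewrite ger0_norm; lra.
    (* [N / 2 ^ N <= (3 / 4) ^ N], by induction; the step from [k] to [k + 1] needs
       [k >= 2], and the first two cases are checked directly. *)
    near=> N; have w0 : 0 <= (2^-1 : R) ^+ N by rewrite exprn_ge0.
    rewrite mulr_ge0//= mul1r; elim: (N) => [|k IH]; first by rewrite mul0r expr0.
    rewrite !exprS -natr1.
    have [k2|k2] := leqP 2 k.
      have k2' : 2 <= k%:R :> R by rewrite ler_nat.
      have p0 : 0 <= (2^-1 : R) ^+ k by rewrite exprn_ge0.
      by have := ler_wpM2r p0 k2'; lra.
    by case: k k2 {IH} => [|[|]]// _; rewrite ?expr0 ?expr1; lra.
  move/cvgrPdist_lt : cvz => /(_ _ e0); apply: filterS => N.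
  rewrite subr0 sub0r normrN => /(le_lt_trans (ler_norm _)); apply: le_lt_trans.
  exact: err.
rewrite -[X in _ --> X]add0r.
have -> : series (cauchy_prod a b) = (fun N => (series (cauchy_prod a b) N - series a N * psum c' t) + series a N * psum c' t).
  by apply/funext => N; rewrite subrK.
exact: (@cvgD C C nat \oo _ _ _ _ _ cv0 (@cvgM C nat \oo _ _ _ _ _ cva (@cvg_cst C _ _ _ _))).
Unshelve. all: by end_near. Qed.

Definition dcoef c : nat -> C := fun k => k.+1%:R * c k.+1.

Lemma pbound_dcoef c M r : 0 <= r -> pbound c M r -> pbound (dcoef c) (M * r) (2 * r).
Proof.
move=> r0 h k; rewrite /dcoef cnM cn_nat.
apply: (@le_trans _ _ (k.+1%:R * (M * r ^+ k.+1))); first by rewrite ler_wpM2l.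
have M0 := pbound_ge0 h.
have -> : M * r * (2 * r) ^+ k = 2 ^+ k * (M * r ^+ k.+1) by rewrite exprMn exprS; ring.
by rewrite ler_wpM2r ?mulr_ge0 ?exprn_ge0//; exact: natr_le_exp2.
Qed.

(** The remainder of order two of ['X^k], with a constant that is geometric
    in [k]: summed against a Cauchy estimate it still converges.  Induction
    on [k], multiplying the expansion of order [k] by [t + h]. *)
Lemma expr_quad_remainder (rho : R) t h k : 0 < rho -> cn t <= rho -> cn h <= rho ->
  cn ((t + h) ^+ k - t ^+ k - h * (k%:R * t ^+ k.-1)) <=
  cn h ^+ 2 / rho ^+ 2 * (4 * rho) ^+ k.
Proof.
move=> rho0 ht hh; elim: k => [|k IH].
  by rewrite !expr0 subrr mul0r mulr0 subr0 cn0 mulr1 divr_ge0 ?exprn_ge0 ?cn_ge0// ltW.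
have -> : (t + h) ^+ k.+1 - t ^+ k.+1 - h * (k.+1%:R * t ^+ k.+1.-1) =
   (t + h) * ((t + h) ^+ k - t ^+ k - h * (k%:R * t ^+ k.-1)) + h ^+ 2 * (k%:R * t ^+ k.-1).
  case: k {IH} => [|k] /=; first by rewrite !expr0 !expr1; ring.
  by rewrite -[k.+2%:R]natr1 !exprS; ring.
apply: (le_trans (cnD _ _)); rewrite 3!cnM ?cnX cn_nat.
have hh0 := cn_ge0 h; have ht0 := cn_ge0 t.
have e1 : cn (t + h) <= 2 * rho by apply: (le_trans (cnD _ _)); lra.
have e2 := ler_pM (cn_ge0 _) (cn_ge0 _) e1 IH.
(* The weight [4 ^ k] is there to absorb the factor [k]. *)
have e3 : k%:R * cn t ^+ k.-1 <= 2 * (4 * rho) ^+ k.+1 / (4 * rho ^+ 2).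
  case: k {IH e2} => [|k] /=.
    by rewrite mul0r divr_ge0 ?mulr_ge0 ?exprn_ge0//; lra.
  have -> : 2 * (4 * rho) ^+ k.+2 / (4 * rho ^+ 2) = 8 * (4 ^+ k * rho ^+ k).
    rewrite [(4 * rho) ^+ k.+2]exprS [(4 * rho) ^+ k.+1]exprS exprMn.
    by move: (4 ^+ k) (rho ^+ k) => u v; field; rewrite gt_eqF.
  have := natr_le_exp2 k; have : (2 : R) ^+ k <= 4 ^+ k by rewrite lerXn2r ?nnegrE//; lra.
  move=> q1 q2; rewrite mulrA; apply: ler_pM; rewrite ?exprn_ge0//; last first.
    by rewrite lerXn2r ?nnegrE// ltW.
  by have := exprn_ge0 k (ler0n R 4); lra.
have e4 := ler_wpM2l (exprn_ge0 2 hh0) e3.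
apply: (le_trans (lerD e2 e4)).
rewrite le_eqVlt; apply/orP; left; apply/eqP.
rewrite [(4 * rho) ^+ k.+1]exprS; move: ((4 * rho) ^+ k) => u.
by field; rewrite gt_eqF.
Qed.

(** Termwise differentiation.  With [rho = 1 / (16 * r)], the remainders of the
    monomials against the bound [M * r ^ k] of the coefficients leave a
    geometric series of ratio 1/4, whose sum is a multiple of [|h| ^ 2]. *)
Lemma psum_quad_remainder c M r t h : 0 < r -> pbound c M r ->
  16 * (r * cn t) <= 1 -> 16 * (r * cn h) <= 1 ->
  cn (psum c (t + h) - psum c t - h * psum (dcoef c) t) <=
    2 * M * (16 * r) ^+ 2 * cn h ^+ 2.
Proof.
move=> r0 cM rt rh; have r0' := ltW r0; have M0 := pbound_ge0 cM.
pose rho := (16 * r)^-1.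
have rho0 : 0 < rho by rewrite invr_gt0; lra.
have ht : cn t <= rho by rewrite -[rho]mul1r ler_pdivlMr; lra.
have hh : cn h <= rho by rewrite -[rho]mul1r ler_pdivlMr; lra.
have rth : r * cn (t + h) <= 2^-1.
  by have := ler_wpM2l r0' (cnD t h); rewrite mulrDr; lra.
apply: (@cn_lim_le R C _ \oo _ (fun N => series (pterm c (t + h)) N.+1 -
   series (pterm c t) N.+1 - h * series (pterm (dcoef c) t) N)).
  have cvS c' x l : series (pterm c' x) @ \oo --> (l : C) ->
      (series (pterm c' x) N.+1) @[N --> \oo] --> (l : C).
    by move=> /(@cvg_cnP R C) cl; apply/(@cvg_cnP R C) => e e0;
      have [N _ hN] := cl _ e0; exists N => // k /= kN; apply: hN; exact: leqW.
  have cv1 := cvS _ _ _ (cvg_psum r0' cM rth).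
  have rt' : r * cn t <= 2^-1 by lra.
  have cv2 := cvS _ _ _ (cvg_psum r0' cM rt').
  have cv3 : series (pterm (dcoef c) t) @ \oo --> psum (dcoef c) t.
    by apply: (cvg_psum _ (pbound_dcoef r0' cM)); lra.
  exact: (@cvgB C C nat \oo _ _ _ _ _ (@cvgB C C nat \oo _ _ _ _ _ cv1 cv2)
    (@cvgM C nat \oo _ _ _ _ _ (cvg_cst h) cv3)).
apply: nearW => N.
have -> : series (pterm c (t + h)) N.+1 - series (pterm c t) N.+1 - h * series (pterm (dcoef c) t) N =
  \sum_(0 <= k < N.+1) c k * ((t + h) ^+ k - t ^+ k - h * (k%:R * t ^+ k.-1)).
  rewrite /series /=.
  have -> : \sum_(0 <= k < N) pterm (dcoef c) t k = \sum_(0 <= k < N.+1) c k * (k%:R * t ^+ k.-1).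
    rewrite big_nat_recl// mul0r mulr0 add0r; apply: eq_bigr => k _.
    by rewrite /pterm /dcoef /=; ring.
  rewrite mulr_sumr -!sumrB; apply: eq_bigr => k _; rewrite /pterm; ring.
apply: (le_trans (cn_sum _ _ _)).
have q0 : 0 <= M * (16 * r) ^+ 2 * cn h ^+ 2 by rewrite !mulr_ge0 ?exprn_ge0 ?cn_ge0//; lra.
have key k : cn (c k * ((t + h) ^+ k - t ^+ k - h * (k%:R * t ^+ k.-1))) <=
    (M * (16 * r) ^+ 2 * cn h ^+ 2) * (2^-1) ^+ k.
  rewrite cnM; have := expr_quad_remainder k rho0 ht hh.
  move=> /(ler_pM (cn_ge0 _) (cn_ge0 _) (cM k)) /le_trans; apply.
  have -> : M * r ^+ k * (cn h ^+ 2 / rho ^+ 2 * (4 * rho) ^+ k) =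
     (M * (16 * r) ^+ 2 * cn h ^+ 2) * (4^-1) ^+ k.
    (* [r * (4 * rho) = 1/4] is what the choice of [rho] is for. *)
    have -> : (4^-1 : R) ^+ k = r ^+ k * (4 * rho) ^+ k.
      by rewrite -exprMn; congr (_ ^+ k); rewrite /rho; field; rewrite gt_eqF.
    move: (r ^+ k) ((4 * rho) ^+ k) => u v.
    by rewrite /rho; field; rewrite gt_eqF.
  apply: ler_wpM2l => //.
  by rewrite lerXn2r ?nnegrE//; lra.
apply: (le_trans (ler_sum _ (fun k _ => key k))).
rewrite -mulr_sumr.
have g : \sum_(0 <= k < N.+1) (2^-1 : R) ^+ k <= 2.
  suff -> : \sum_(0 <= k < N.+1) (2^-1 : R) ^+ k = 2 - 2 * 2^-1 ^+ N.+1.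
    by rewrite gerBl mulr_ge0 ?exprn_ge0//; lra.
  elim: {key} N => [|N IH]; first by rewrite big_nat1 expr0 expr1; lra.
  by rewrite big_nat_recr// IH /= [in RHS]exprS; lra.
by have := ler_wpM2l q0 g; lra.
Qed.

End PowerSeries.

(** * Analytic functions and complex derivatives *)

Section Analytic.
Variable R : realType.
Local Notation C := (Cplx R).

(** Differentiability as [f (x + h) = f x + h * l + o(h)].  This form
    includes [h = 0] and has no quotient, and it suits remainder estimates. *)
Lemma cn_is_derive (f : C -> C) (x l : C) :
  (forall e : R, 0 < e -> exists2 d : R, 0 < d &
     forall h, cn h < d -> cn (f (x + h) - f x - h * l) <= e * cn h) ->
  is_derive x (1 : C) f l.
Proof.
move=> hf.
have cvl : (fun h : C => h^-1 *: (f (h *: (1 : C) + x) - f x)) @ 0^' --> l.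
  apply/(@cvg_cnP R C) => e e0.
  have e20 : 0 < e / 2 by lra.
  have [d d0 hd] := hf _ e20.
  apply/(@nbhs_cnP R C); exists d => // h; rewrite subr0 => hd' /= h0.
  have h0' : 0 < cn (h : C) by rewrite cn_gt0.
  have -> : h^-1 *: (f (h *: (1 : C) + x) - f x) - l = h^-1 * (f (x + h) - f x - h * l).
    by rewrite [h *: _]mulr1 [h + x]addrC mulrBr mulrA mulVf ?mul1r.
  rewrite cnM cnV mulrC; apply: (@le_lt_trans _ _ (e / 2)); last lra.
  by rewrite ler_pdivrMr//; exact: hd.
apply: DeriveDef; first by apply/cvg_ex; exists l.
exact: (cvg_lim (@norm_hausdorff C C) cvl).
Qed.

Lemma is_derive_cn (g : C -> C) (x l : C) : is_derive x (1 : C) g l ->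
  forall e : R, 0 < e -> exists2 d : R, 0 < d &
    forall h, cn h < d -> cn (g (x + h) - g x - h * l) <= e * cn h.
Proof.
move=> [/cvg_ex[/= l' cl'] dg] e e0.
have ll' : l' = l by rewrite -dg; apply: esym; exact: (cvg_lim (@norm_hausdorff C C) cl').
rewrite {}ll' in cl'.
have nn : \forall h \near (0 : C), h != 0 -> cn (h^-1 *: (g (h *: (1 : C) + x) - g x) - l) < e.
  exact: (@cvg_cnP R C _ _ _ _ _).1 cl' _ e0.
have /(@nbhs_cnP R C)[d d0 hd] := nn.
exists d; first exact: d0.
move=> h hd'; have [->|h0] := eqVneq h 0.
  by rewrite addr0 subrr mul0r subrr cn0 mulr0.
rewrite -(subr0 h) in hd'.
have := hd _ hd' h0; rewrite /= => /ltW.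
have h0' : 0 < cn (h : C) by rewrite cn_gt0.
have -> : (h : C)^-1 *: (g ((h : C) *: (1 : C) + x) - g x) - l = h^-1 * (g (x + h) - g x - h * l).
  by rewrite [h *: _]mulr1 [h + x]addrC mulrBr mulrA mulVf ?mul1r.
by rewrite cnM cnV mulrC ler_pdivrMr.
Qed.

Lemma quad_is_derive (f : C -> C) (x l : C) (K r : R) : 0 < r ->
  (forall h, cn h < r -> cn (f (x + h) - f x - h * l) <= K * cn h ^+ 2) ->
  is_derive x (1 : C) f l.
Proof.
move=> r0 hf; apply: cn_is_derive => e e0.
have K0 : 0 < `|K| + 1 by rewrite ltr_wpDl.
exists (Num.min r (e / (`|K| + 1))); first by rewrite lt_min r0 divr_gt0.
move=> h; rewrite lt_min => /andP[hr he]; apply: (le_trans (hf _ hr)).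
rewrite expr2 mulrA ler_wpM2r ?cn_ge0//.
rewrite ltr_pdivlMr// mulrC in he; apply: le_trans (ltW he).
by rewrite ler_wpM2r ?cn_ge0// (le_trans (ler_norm _))// lerDl.
Qed.

Lemma is_derive_near (u : C -> C) (x : C) (e : R) : is_derive (0 : C) (1 : C) u x -> 0 < e ->
  \forall h \near (0 : C), cn (u h - u 0 - h * x) <= e * cn h.
Proof.
move=> du e0; have [d d0 hd] := is_derive_cn du e0.
apply/(@nbhs_cnP R C); exists d => // h; rewrite subr0 => /hd.
by rewrite add0r.
Qed.

Lemma psum_is_derive c M (r : R) (t : C) : 0 < r -> pbound c M r ->
  32 * (r * cn t) <= 1 -> is_derive t (1 : C) (psum c) (psum (dcoef c) t).
Proof.
move=> r0 cM rt.
(* For [|h| < 1 / (32 * r)], both [t] and [h] are in the disc of radius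
   [1 / (16 * r)] where the quadratic remainder is bounded. *)
apply: (@quad_is_derive _ _ _ (2 * M * (16 * r) ^+ 2) (32 * r)^-1).
  by rewrite invr_gt0; lra.
move=> h hr; apply: psum_quad_remainder => //; first lra.
move: hr; rewrite -[(32 * r)^-1]mul1r ltr_pdivlMr; last lra.
by move=> ?; lra.
Qed.

(** Convergence of the Taylor series near 0 is traded for a Cauchy estimate
    on its coefficients, which is stable under sums, products and
    differentiation. *)
Lemma analytic_at0P (u : C -> C) : analytic_at0 u <->
  exists c M, exists2 r : R, 0 < r & pbound c M r /\ \forall t \near (0 : C), u t = psum c t.
Proof.
split; last first.
  move=> [c [M [r r0 [cM hu]]]]; exists c.
  have h2 : \forall t \near (0 : C), r * cn t <= 2^-1.
    apply/(@nbhs_cnP R C); exists ((2 * r)^-1); first by rewrite invr_gt0; lra.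
    by move=> t; rewrite subr0 -[(2 * r)^-1]mul1r ltr_pdivlMr; lra.
  move: hu h2; apply: filterS2 => t -> h; apply: (cvg_psum _ cM h); exact: ltW.
move=> [c hc].
have /(@nbhs_cnP R C)[e e0 he] := hc.
(* Any non-zero point of the disc of convergence would do. *)
pose t0 : C := (e / 2)%:C%C.
have ct0 : cn t0 = e / 2 by rewrite cn_real ger0_norm//; lra.
have t0e : cn (t0 - 0) < e by rewrite subr0 ct0; lra.
have t00 : t0 != 0 by rewrite -cn_eq0 ct0 gt_eqF//; lra.
have [M cM] := pbound_cvg t00 (he _ t0e).
exists c, M, (cn t0)^-1; first by rewrite ct0 invr_gt0; lra.
split=> //; move: hc; apply: filterS => t ht.
by rewrite (psumE ht).
Qed.

Lemma near0_small (K : R) : \forall t \near (0 : C), K * cn t <= 1.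
Proof.
apply/(@nbhs_cnP R C); exists (`|K| + 1)^-1; first by rewrite invr_gt0 ltr_wpDl.
move=> t; rewrite subr0 -[(_ + _)^-1]mul1r ltr_pdivlMr ?ltr_wpDl// => h.
have := ler_wpM2r (cn_ge0 t) (ler_norm K); have := cn_ge0 t; nra.
Qed.

Lemma analytic_at0_eq (u v : C -> C) :
  (\forall t \near (0 : C), u t = v t) -> analytic_at0 u -> analytic_at0 v.
Proof.
by move=> uv [c hc]; exists c; move: uv hc; apply: filterS2 => t ->.
Qed.

Lemma analytic_at0_cst (a : C) : analytic_at0 (fun=> a).
Proof.
apply/analytic_at0P; exists (fun k => if k is 0%N then a else 0), (cn a), 1 => //.
split.
  by case=> [|k]; rewrite expr1n mulr1// cn0 cn_ge0.
near=> t; apply/esym; apply: psumE; apply: cvg_near_cst; near=> n.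
have n0 : (0 < n)%N by near: n; exact: nbhs_infty_gt.
rewrite /series /= big_ltn// big_nat big1 ?addr0 /pterm ?expr0 ?mulr1//.
by case=> [|i]//= _; rewrite mul0r.
Unshelve. all: by end_near. Qed.

Lemma analytic_at0D (u v : C -> C) :
  analytic_at0 u -> analytic_at0 v -> analytic_at0 (fun t => u t + v t).
Proof.
move=> /analytic_at0P[c [M [r r0 [cM hu]]]] /analytic_at0P[c' [M' [r' r'0 [cM' hv]]]].
apply/analytic_at0P; exists (c \+ c'), (M + M'), (r + r'); first exact: addr_gt0.
have h1 : pbound c M (r + r') by apply: pbound_le cM => //; lra.
have h2 : pbound c' M' (r + r') by apply: pbound_le cM' => //; lra.
split; first exact: pboundD.
near=> t; rewrite (psumD _ h1 h2); last 2 first.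
- by lra.
- have : 2 * (r + r') * cn t <= 1 by near: t; exact: near0_small.
  lra.
by congr (_ + _); near: t.
Unshelve. all: by end_near. Qed.

Lemma analytic_at0M (u v : C -> C) :
  analytic_at0 u -> analytic_at0 v -> analytic_at0 (fun t => u t * v t).
Proof.
move=> /analytic_at0P[c [M [r r0 [cM hu]]]] /analytic_at0P[c' [M' [r' r'0 [cM' hv]]]].
apply/analytic_at0P; exists (cauchy_prod c c'), (M * M'), (2 * (r + r')); first lra.
have h1 : pbound c M (r + r') by apply: pbound_le cM => //; lra.
have h2 : pbound c' M' (r + r') by apply: pbound_le cM' => //; lra.
split; first by apply: pbound_cauchy => //; lra.
near=> t; rewrite (psumM _ h1 h2); last 2 first.
- by lra.
- have : 4 * (r + r') * cn t <= 1 by near: t; exact: near0_small.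
  lra.
by congr (_ * _); near: t.
Unshelve. all: by end_near. Qed.

Lemma analytic_at0_sum (I : Type) (s : seq I) (u : I -> C -> C) :
  (forall i, analytic_at0 (u i)) -> analytic_at0 (fun t => \sum_(i <- s) u i t).
Proof.
move=> hu; elim: s => [|i s IH].
  by under eq_fun do rewrite big_nil; exact: analytic_at0_cst.
have -> : (fun t => \sum_(j <- i :: s) u j t) = (fun t => u i t + \sum_(j <- s) u j t).
  by apply/funext => t; rewrite big_cons.
exact: (analytic_at0D (hu i) IH).
Qed.

Definition mderive (p q : nat) (M : C -> 'M[C]_(p, q)) (z : C) (D : 'M[C]_(p, q)) :=
  forall i j, is_derive z (1 : C) (fun z => M z i j) (D i j).

Lemma mderiveM (p q s : nat) (M : C -> 'M[C]_(p, q)) (N : C -> 'M[C]_(q, s)) z D E :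
  mderive M z D -> mderive N z E ->
  mderive (fun z => M z *m N z) z (D *m N z + M z *m E).
Proof.
move=> hM hN i j.
have -> : (fun z0 => (M z0 *m N z0) i j) = \sum_(k < q) ((fun z => M z i k) \* (fun z => N z k j)).
  by apply/funext => y; rewrite mxE fct_sumE.
have -> : (D *m N z + M z *m E) i j = \sum_(k < q) (M z i k *: E k j + N z k j *: D i k).
  rewrite !mxE -big_split; apply: eq_bigr => k _ /=; rewrite addrC; congr (_ + _).
  exact: mulrC.
apply: is_derive_sum => k.
exact: is_deriveM.
Qed.

Lemma mderive_tr (p q : nat) (M : C -> 'M[C]_(p, q)) z D :
  mderive M z D -> mderive (fun z => (M z)^T) z D^T.
Proof. by move=> h i j; rewrite mxE; under eq_fun do rewrite mxE; exact: h. Qed.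

Lemma mderive_cst (p q : nat) (M : 'M[C]_(p, q)) z : mderive (fun=> M) z 0.
Proof. by move=> i j; rewrite mxE; exact: is_derive_cst. Qed.

End Analytic.

(** * Local solutions of linear differential systems *)

Section FormalSolution.
Variables (R : realType) (n : nat).
Local Notation C := (Cplx R).
Variable b : nat -> 'M[C]_n.

(** The power series solution of [S' = B S] with [S 0 = 1] satisfies
    [(k + 1) S_(k + 1) = \sum_(i <= k) B_i S_(k - i)].  As the recursion refers to
    all the previous coefficients, [sol_upto k] holds those of order up to [k]. *)
Fixpoint sol_upto (k : nat) : nat -> 'M[C]_n :=
  if k is k'.+1 then
    fun m => if (m <= k')%N then sol_upto k' m
             else k'.+1%:R^-1 *: \sum_(i < k'.+1) b i *m sol_upto k' (k' - i)%N
  else fun=> 1%:M.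

Definition sol k := sol_upto k k.

Lemma sol_uptoE k m : (m <= k)%N -> sol_upto k m = sol m.
Proof.
elim: k => [|k IH]; first by rewrite leqn0 => /eqP ->.
rewrite leq_eqVlt => /orP[/eqP ->//|]; rewrite ltnS => mk /=.
by rewrite mk IH.
Qed.

Lemma solS k : sol k.+1 = k.+1%:R^-1 *: \sum_(i < k.+1) b i *m sol (k - i)%N.
Proof.
rewrite [LHS]/sol [LHS]/= ltnn; congr (_ *: _).
by apply: eq_bigr => i _; rewrite sol_uptoE// leq_subr.
Qed.

(** In the recursion for the order [k + 1] there are [k + 1] terms, each at most
    [n * M * s ^ k <= s ^ k.+1], and their sum is divided by [k + 1]. *)
Lemma sol_bound (M r s : R) : 0 <= r -> r <= s -> n%:R * M <= s ->
  (forall i j, pbound (fun k => b k i j) M r) ->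
  forall i j, pbound (fun k => sol k i j) 1 s.
Proof.
move=> r0 rs ns bM i j k; rewrite mul1r.
elim/ltn_ind: k i j => -[|k] IH i j.
  rewrite /sol /= mxE expr0; case: eqP => _; last by rewrite mulr0n cn0.
  by rewrite mulr1n cn1.
have M0 : 0 <= M := pbound_ge0 (bM i j).
have s0 : 0 <= s by lra.
rewrite solS mxE summxE cnM cnV cn_nat.
rewrite mulrC ler_pdivrMr ?ltr0n//.
apply: (le_trans (cn_sum _ _ _)).
apply: (@le_trans _ _ (\sum_(l < k.+1) s ^+ k.+1)); last first.
  by rewrite sumr_const card_ord mulr_natr.
apply: ler_sum => l _; rewrite mxE; apply: (le_trans (cn_sum _ _ _)).
apply: (@le_trans _ _ (\sum_(m < n) M * s ^+ k)); last first.
  rewrite sumr_const card_ord -mulr_natl mulrA exprS ler_wpM2r ?exprn_ge0//.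
apply: ler_sum => m _; rewrite cnM.
have lk : (l <= k)%N by rewrite -ltnS.
have -> : s ^+ k = s ^+ l * s ^+ (k - l) by rewrite -exprD subnKC.
rewrite mulrA; apply: ler_pM; rewrite ?cn_ge0//.
  apply: (le_trans (bM _ _ _)); rewrite ler_wpM2l// lerXn2r ?nnegrE//.
by apply: IH; rewrite ltnS leq_subr.
Qed.

End FormalSolution.

Section LocalSolution.
Variables (R : realType) (n : nat).
Local Notation C := (Cplx R).

Lemma analytic_mx_bound (B : C -> 'M[C]_n) :
  (forall i j, analytic_at0 (fun t => B t i j)) ->
  exists b : nat -> 'M[C]_n, exists M, exists2 r : R, 0 < r &
   (forall i j, pbound (fun k => b k i j) M r) /\
   forall i j, \forall t \near (0 : C), B t i j = psum (fun k => b k i j) t.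
Proof.
move=> aB.
have /choice[f hf] : forall ij : 'I_n * 'I_n, exists f : (nat -> C) * R * R,
    [/\ 0 < f.2, pbound f.1.1 f.1.2 f.2 &
     \forall t \near (0 : C), B t ij.1 ij.2 = psum f.1.1 t].
  move=> [i j]; have /analytic_at0P[c [M [r r0 [h1 h2]]]] := aB i j.
  by exists (c, M, r).
have M0 ij : 0 <= (f ij).1.2 by have [_ h _] := hf ij; exact: pbound_ge0 h.
have r0 ij : 0 <= (f ij).2 by have [/ltW] := hf ij.
exists (fun k => \matrix_(i, j) (f (i, j)).1.1 k).
(* Summing the constants of the entries gives constants valid for all. *)
exists (\sum_ij (f ij).1.2), (1 + \sum_ij (f ij).2).
  by rewrite ltr_wpDr// sumr_ge0.
split=> i j.
  have [h1 h2 _] := hf (i, j).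
  under eq_fun do rewrite mxE; apply: pbound_le h2 => //.
    by rewrite (bigD1 (i, j))//= lerDl sumr_ge0.
  by rewrite (bigD1 (i, j))//= addrCA lerDl addr_ge0// sumr_ge0.
have [_ _ h3] := hf (i, j); move: h3; apply: filterS => t -> /=.
suff -> : (fun k => (\matrix_(i, j) (f (i, j)).1.1 k) i j) = (f (i, j)).1.1 by [].
by apply/funext => k; rewrite mxE.
Qed.

(** The formal solution converges by [sol_bound]; differentiating it termwise,
    the recursion becomes the differential equation, read through the
    Cauchy product of [B] and [S]. *)
Lemma local_solution (B : C -> 'M[C]_n) :
  (forall i j, analytic_at0 (fun t => B t i j)) ->
  exists S : C -> 'M[C]_n,
   [/\ forall i j, analytic_at0 (fun t => S t i j), S 0 = 1%:M &
     \forall t \near (0 : C), mderive S t (B t *m S t)].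
Proof.
move=> /analytic_mx_bound[b [M [r r0 [bM hB]]]].
(* Large enough for [sol_bound]: [r <= s] and [n * M <= s]. *)
pose s := r + n%:R * `|M|.
have nM0 : 0 <= n%:R * `|M| by rewrite mulr_ge0.
have s0 : 0 < s by rewrite /s; lra.
have rs : r <= s by rewrite /s; lra.
have ns : n%:R * M <= s.
  by have := ler_wpM2l (ler0n R n) (ler_norm M); rewrite /s; lra.
have sM := sol_bound (ltW r0) rs ns bM.
have bM' i j : pbound (fun k => b k i j) M s by apply: pbound_le (bM i j) => //; lra.
exists (fun t => \matrix_(i, j) psum (fun k => sol b k i j) t); split.
- move=> i j; under eq_fun do rewrite mxE.
  apply/analytic_at0P; exists (fun k => sol b k i j), 1, s => //.
  by split=> //; near=> t.
- by apply/matrixP => i j; rewrite mxE psum0 /sol /= !mxE.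
have small : \forall t \near (0 : C), 32 * s * cn t <= 1 by exact: near0_small.
have allB := @filter_forall C _ (fun ij t => B t ij.1 ij.2 = psum (fun k => b k ij.1 ij.2) t)
  (nbhs (0 : C)) _ (fun ij : 'I_n * 'I_n => hB ij.1 ij.2).
near=> t => i j.
have st : 32 * s * cn t <= 1 by near: t.
have Bt : forall ij : 'I_n * 'I_n, B t ij.1 ij.2 = psum (fun k => b k ij.1 ij.2) t.
  by near: t; exact: allB.
have st0 := cn_ge0 t.
under eq_fun do rewrite mxE.
apply: is_derive_eq; first by apply: (psum_is_derive s0 (sM i j)); rewrite mulrA.
rewrite mxE.
have -> : dcoef (fun k => sol b k i j) =
    (fun k => \sum_(l <- index_enum 'I_n) cauchy_prod (fun k => b k i l) (fun k => sol b k l j) k).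
  apply/funext => k; rewrite /dcoef solS mxE mulrA mulfV ?mul1r ?pnatr_eq0//.
  rewrite summxE /cauchy_prod exchange_big; apply: eq_bigr => m _.
  by rewrite mxE.
rewrite (@psum_sum _ _ _ _ (fun=> M * 1) (2 * s)); last 3 first.
- by lra.
- by move=> l; apply: pbound_cauchy => //; lra.
- by lra.
apply: eq_bigr => l _; rewrite mxE.
rewrite (@psumM _ _ _ M 1 s)//; last 2 first.
- by lra.
- by lra.
by congr (_ * _); rewrite (Bt (i, l)).
Unshelve. all: by end_near. Qed.

End LocalSolution.

(** * Local systems and monodromy *)

Section IntervalChain.
Variable R : realType.

(** Compactness of the segment as a principle of induction for relations
    that may be concatenated: the supremum of the [b] such that [P u b] is
    attained, and it cannot be smaller than [v]. *)
Lemma interval_chain (P : R -> R -> Prop) (u v : R) : u <= v ->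
  (forall a b c, u <= a -> a <= b -> b <= c -> c <= v -> P a b -> P b c -> P a c) ->
  (forall x, u <= x -> x <= v -> exists2 e, 0 < e & forall a b,
     u <= a -> a <= x -> x <= b -> b <= v -> x - e < a -> b < x + e -> P a b) ->
  P u v.
Proof.
move=> uv Ptr Ploc.
pose E := [set b | [/\ u <= b, b <= v & P u b]].
have Eu : E u.
  split=> //; have [e e0 h] := Ploc u (lexx _) uv.
  by apply: h => //; lra.
have ubE : ubound E v by move=> b [].
have supE : has_sup E by split; [exists u | exists v].
have leE x : E x -> x <= sup E by move=> Ex; have := ub_le_sup supE.2; exact.
have us : u <= sup E := leE _ Eu.
have sv : sup E <= v by apply: ge_sup ubE; exists u.
have [e e0 h] := Ploc _ us sv.
have [b Eb hb] := sup_adherent e0 supE.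
have bs : b <= sup E := leE _ Eb.
have [ub bv Pb] := Eb.
have Ps : P u (sup E).
  by apply: (Ptr u b (sup E)) => //; apply: h => //; lra.
have [sv1|sv1] := leP v (sup E).
  by have -> : v = sup E by apply/le_anti; rewrite sv sv1.
(* A point beyond the supremum which is still in its small neighbourhood. *)
pose b' := Num.min v (sup E + e / 2).
have b'1 : sup E < b' by rewrite lt_min sv1 /=; lra.
have b'2 : b' <= v by rewrite ge_min lexx.
have b'3 : b' <= sup E + e / 2 by rewrite ge_min lexx orbT.
have : b' <= sup E.
  apply: leE; split=> //; first lra.
  by apply: (Ptr u (sup E) b') => //; try lra; apply: h => //; lra.
by move=> ?; lra.
Qed.

End IntervalChain.

Section LocalSystem.
Variables (R : realType) (K : fieldType) (n : nat) (X : topologicalType).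
(* [F p q] is the transport from [p] to a nearby point [q], as given by
   a fundamental matrix normalised at [p]. *)
Variables (V : set X) (F : X -> X -> 'M[K]_n).
Hypothesis Fid : forall p, V p -> F p p = 1%:M.
Hypothesis Funit : forall p, V p -> \forall q \near p, F p q \in unitmx.
Hypothesis Fcomp : forall p, V p ->
  \forall q \near p, \forall r \near q, F p r = F q r *m F p q.

(** Sections of the local system pulled back by [h], written as matrices.
    The condition involves [S] only, so that sections over closed pieces can
    be glued. *)
Definition horizontal (T : topologicalType) (h : T -> X) (S : set T) (G : T -> 'M[K]_n) :=
  forall x, S x -> \forall y \near x, S y -> G y = F (h x) (h y) *m G x.

Lemma horizontal_pull (T T' : topologicalType) (k : T' -> T) (h : T -> X) h' S S' G :
  continuous k -> (forall x, S' x -> S (k x)) -> (forall x, S' x -> h' x = h (k x)) ->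
  horizontal h S G -> horizontal h' S' (G \o k).
Proof.
move=> ck kS hh' hG x S'x.
have near_k : \forall y \near x, S (k y) -> G (k y) = F (h (k x)) (h (k y)) *m G (k x).
  exact: ck x _ (hG _ (kS _ S'x)).
move: near_k; apply: filterS => y Gy S'y /=.
by rewrite !hh'//; apply: Gy; exact: kS.
Qed.

Lemma horizontalMr (T : topologicalType) (h : T -> X) S G M :
  horizontal h S G -> horizontal h S (fun x => G x *m M).
Proof.
by move=> hG x Sx; have := hG _ Sx; apply: filterS => y Gy Sy; rewrite Gy// mulmxA.
Qed.

Lemma horizontal_cst (T : topologicalType) (h : T -> X) S M p : V p ->
  (forall x, S x -> h x = p) -> horizontal h S (fun=> M).
Proof.
move=> Vp hS x Sx; near=> y => Sy.
by rewrite !hS// Fid// mul1mx.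
Unshelve. all: by end_near. Qed.

(** This is why the pulled back local system has a frame near [x], namely
    [F (h x) \o h]. *)
Lemma horizontal_local (T : topologicalType) (h : T -> X) (x : T) :
  continuous h -> V (h x) ->
  \forall y \near x, F (h x) (h y) \in unitmx /\
    \forall z \near y, F (h x) (h z) = F (h y) (h z) *m F (h x) (h y).
Proof.
move=> ch Vx.
have h1 : \forall y \near x, F (h x) (h y) \in unitmx := ch x _ (Funit Vx).
have h2 : \forall y \near x, \forall r \near h y, F (h x) r = F (h y) r *m F (h x) (h y).
  exact: ch x _ (Fcomp Vx).
by move: h1 h2; apply: filterS2 => y h1 h2; split=> //; exact: (ch y _ h2).
Qed.

Definition trivial_on (T : topologicalType) (h : T -> X) (S : set T) :=
  exists2 G, horizontal h S G & forall x, S x -> G x \in unitmx.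

Lemma trivial_on_small (T : topologicalType) (h : T -> X) (x : T) :
  continuous h -> V (h x) -> exists2 N, nbhs x N & forall S, S `<=` N -> trivial_on h S.
Proof.
move=> ch Vx; exists (fun y => F (h x) (h y) \in unitmx /\
    \forall z \near y, F (h x) (h z) = F (h y) (h z) *m F (h x) (h y)).
  exact: horizontal_local ch Vx.
move=> S SN; exists (fun y => F (h x) (h y)); last by move=> y /SN[].
by move=> y /SN[_]; apply: filterS.
Qed.

(** Closedness of the pieces matters: near a point that lies in one piece
    only, the other piece is absent. *)
Lemma horizontal_glue (T : topologicalType) (h : T -> X) S1 S2 G1 G2 :
  closed S1 -> closed S2 -> horizontal h S1 G1 -> horizontal h S2 G2 ->
  (forall x, S1 x -> S2 x -> G1 x = G2 x) ->
  horizontal h (S1 `|` S2) (fun x => if `[< S1 x >] then G1 x else G2 x).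
Proof.
move=> c1 c2 h1 h2 h12 x Sx.
have near1 : S1 x -> \forall y \near x, S1 y -> G1 y = F (h x) (h y) *m G1 x by exact: h1.
have near2 : S2 x -> \forall y \near x, S2 y -> G2 y = F (h x) (h y) *m G2 x by exact: h2.
have [S1x|nS1x] := pselect (S1 x).
  rewrite (asboolT S1x).
  have [S2x|nS2x] := pselect (S2 x).
    move: (near1 S1x) (near2 S2x); apply: filterS2 => y e1 e2 Sy.
    case: asboolP => [S1y|nS1y]; first exact: e1.
    by rewrite h12//; apply: e2; case: Sy.
  have := closed_openC c2; rewrite openE => /(_ _ nS2x) /= nn.
  move: (near1 S1x) nn; apply: filterS2 => y e1 nS2y [S1y|//].
  by rewrite (asboolT S1y); exact: e1.
have S2x : S2 x by case: Sx.
rewrite (asboolF nS1x).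
have := closed_openC c1; rewrite openE => /(_ _ nS1x) /= nn.
move: (near2 S2x) nn; apply: filterS2 => y e2 nS1y [//|S2y].
by rewrite (asboolF nS1y); exact: e2.
Qed.

(** Two frames differ by a constant matrix [M] on the overlap, as soon as
    sections over it are determined by one value; multiplying the second
    frame by [M] makes them agree. *)
Lemma trivial_on_glue (T : topologicalType) (h : T -> X) S1 S2 x :
  closed S1 -> closed S2 -> S1 x -> S2 x ->
  (forall G G', horizontal h (S1 `&` S2) G -> horizontal h (S1 `&` S2) G' ->
     G x = G' x -> forall y, (S1 `&` S2) y -> G y = G' y) ->
  trivial_on h S1 -> trivial_on h S2 -> trivial_on h (S1 `|` S2).
Proof.
move=> c1 c2 S1x S2x uniq [G1 h1 u1] [G2 h2 u2].
pose M := invmx (G2 x) *m G1 x.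
have hsub S S' G : S' `<=` S -> horizontal h S G -> horizontal h S' G.
  by move=> sub hG y S'y; have := hG _ (sub _ S'y); apply: filterS => z Gz S'z; exact/Gz/sub.
exists (fun x => if `[< S1 x >] then G1 x else G2 x *m M).
  apply: horizontal_glue => //; first exact: horizontalMr.
  move=> y S1y S2y.
  apply: (uniq G1 (fun x => G2 x *m M)) => //.
  - by apply: hsub h1 => z [].
  - by apply: horizontalMr; apply: hsub h2 => z [].
  - by rewrite /M mulKVmx// u2.
move=> y Sy; case: asboolP => [S1y|nS1y]; first exact: u1.
have S2y : S2 y by case: Sy.
by rewrite unitmx_mul u2//= unitmx_mul unitmx_inv u2// u1.
Qed.

(** Near each point both sections are obtained from their value there by the
    same invertible matrix, so that agreement propagates in both directions. *)
Lemma horizontal_uniq (h : R -> X) (u v : R) G G' : u <= v ->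
  continuous h -> (forall t, u <= t <= v -> V (h t)) ->
  horizontal h [set t | u <= t <= v] G -> horizontal h [set t | u <= t <= v] G' ->
  G u = G' u <-> G v = G' v.
Proof.
move=> uv ch hV hG hG'.
apply: (@interval_chain R (fun a b => G a = G' a <-> G b = G' b)) => //.
  by move=> a b c _ _ _ _ -> ->.
move=> x ux xv; have x01 : u <= x <= v by rewrite ux.
have key : \forall y \near x, u <= y <= v -> (G x = G' x <-> G y = G' y).
  have := hG x x01; have := hG' x x01.
  have := horizontal_local ch (hV _ x01).
  apply: filterS3 => y [Fu _] e e' y01; rewrite e// e'//; split=> [->//|].
  by move/(congr1 (mulmx (invmx (F (h x) (h y))))); rewrite !mulKmx.
have /nbhs_ballP[e /= e0 he] := key.
exists e => // a b ua ax xb bv xea bxe.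
have xa : G x = G' x <-> G a = G' a.
  apply: he; rewrite /ball /=; first by rewrite ltr_norml; lra.
  by rewrite ua (le_trans ax).
have xb' : G x = G' x <-> G b = G' b.
  apply: he; rewrite /ball /=; first by rewrite ltr_norml; lra.
  by rewrite bv (le_trans ux).
by rewrite -xa -xb'.
Qed.

Lemma horizontal_uniq_path (T : topologicalType) (h : T -> X) S G G' (k : R -> T) :
  continuous h -> continuous k -> (forall t, 0 <= t <= 1 -> S (k t)) ->
  (forall x, S x -> V (h x)) ->
  horizontal h S G -> horizontal h S G' ->
  G (k 0) = G' (k 0) -> G (k 1) = G' (k 1).
Proof.
move=> ch ck kS hV hG hG'.
have hk : continuous (h \o k) by move=> t; apply: continuous_comp; [exact: ck|exact: ch].
apply: (@horizontal_uniq (h \o k) 0 1 (G \o k) (G' \o k) ler01 hk _ _ _).1.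
- by move=> t /kS /hV.
- exact: (horizontal_pull ck kS _ hG).
- exact: (horizontal_pull ck kS _ hG').
Qed.

Lemma closed_segment (a b : R) : closed [set t | a <= t <= b].
Proof.
have -> : [set t | a <= t <= b] = `[a, b]%classic.
  by apply/seteqP; split=> t /=; rewrite in_itv.
exact: itv_closed.
Qed.

Lemma trivial_on_path (h : R -> X) : continuous h ->
  (forall t, 0 <= t <= 1 -> V (h t)) -> trivial_on h [set t | 0 <= t <= 1].
Proof.
move=> ch hV.
apply: (@interval_chain R (fun a b => trivial_on h [set t | a <= t <= b])) => //.
  move=> a b c a0 ab bc c1 tab tbc.
  have -> : [set t | a <= t <= c] = [set t | a <= t <= b] `|` [set t | b <= t <= c].
    apply/seteqP; split=> t /=; last by move=> []/andP[]; lra.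
    by move=> /andP[? ?]; case: (leP t b) => ?; [left|right]; lra.
  apply: (@trivial_on_glue _ _ _ _ b) => //=; try lra.
  - exact: closed_segment.
  - exact: closed_segment.
  - move=> G G' _ _ e y [/andP[_ yb] /andP[by' _]].
    by have -> : y = b by apply/le_anti; rewrite yb.
move=> x x0 x1; have x01 : 0 <= x <= 1 by rewrite x0.
have [N /nbhs_ballP[e /= e0 he] hN] := trivial_on_small ch (hV _ x01).
exists e => // a b a0 ax xb b1 xea bxe; apply: hN => t /= /andP[at' tb].
by apply: he; rewrite /ball /= ltr_norml; lra.
Qed.

Definition box (a b c d : R) : set (R * R) := [set u | a <= u.1 <= b /\ c <= u.2 <= d].

Lemma closed_box a b c d : closed (box a b c d).
Proof.
have -> : box a b c d = (fst @^-1` [set t | a <= t <= b]) `&` (snd @^-1` [set t | c <= t <= d]) by [].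
by apply: closedI; apply: closed_comp => //; [move=> x _; exact: cvg_fst|exact: closed_segment
  |move=> x _; exact: cvg_snd|exact: closed_segment].
Qed.

Lemma continuous_affine (a b : R) : continuous (fun t : R => a + t * b).
Proof.
move=> t; exact: (cvgD (cvg_cst a) (cvgM (@cvg_id _ (nbhs t)) (cvg_cst b))).
Qed.

(** Two points of a box are joined by a segment. *)
Lemma horizontal_uniq_box (h : R * R -> X) a b c d G G' x : continuous h ->
  (forall u, box a b c d u -> V (h u)) -> box a b c d x ->
  horizontal h (box a b c d) G -> horizontal h (box a b c d) G' ->
  G x = G' x -> forall y, box a b c d y -> G y = G' y.
Proof.
move=> ch hV bx hG hG' Gx y bY.
pose k (t : R) : R * R := (x.1 + t * (y.1 - x.1), x.2 + t * (y.2 - x.2)).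
have ck : continuous k.
  by move=> t; exact: (cvg_pair (@continuous_affine x.1 (y.1 - x.1) t) (@continuous_affine x.2 (y.2 - x.2) t)).
have k0 : k 0 = x by rewrite /k !mul0r !addr0 -surjective_pairing.
have k1 : k 1 = y by rewrite /k !mul1r ![_ + (_ - _)]addrC !subrK -surjective_pairing.
have kb t : 0 <= t <= 1 -> box a b c d (k t).
  have cvx (a' b' x' y' : R) : a' <= x' <= b' -> a' <= y' <= b' -> 0 <= t <= 1 ->
      a' <= x' + t * (y' - x') <= b'.
    move=> /andP[q1 q2] /andP[q3 q4] /andP[t0 t1].
    have t1' : 0 <= 1 - t by lra.
    have := ler_wpM2l t0 q3; have := ler_wpM2l t0 q4.
    have := ler_wpM2l t1' q1; have := ler_wpM2l t1' q2.
    by move=> *; apply/andP; split; lra.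
  by case: bx bY => [? ?] [? ?] t01; split; exact: cvx.
have := horizontal_uniq_path ch ck kb hV hG hG'.
by rewrite k0 k1; apply.
Qed.

(** The square is cut into vertical strips, glued along segments.  A strip
    around a given abscissa is trivial if it is thin enough, which is obtained
    by cutting it in turn into small boxes. *)
Lemma trivial_on_square (h : R * R -> X) : continuous h ->
  (forall u, box 0 1 0 1 u -> V (h u)) -> trivial_on h (box 0 1 0 1).
Proof.
move=> ch hV.
apply: (@interval_chain R (fun a b => trivial_on h (box a b 0 1))) => //.
  move=> a b c a0 ab bc c1 tab tbc.
  have -> : box a c 0 1 = box a b 0 1 `|` box b c 0 1.
    apply/seteqP; split=> t /=; last by move=> [] [/andP[? ?] ?]; split=> //; lra.
    move=> [/andP[? ?] ?]; case: (leP t.1 b) => ?; [left|right]; split=> //; lra.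
  have bI : box a b 0 1 `&` box b c 0 1 = box b b 0 1.
    apply/seteqP; split=> t /=.
      by move=> [[/andP[? ?] ?] [/andP[? ?] ?]]; split=> //; lra.
    by move=> [/andP[? ?] ?]; split; split=> //; lra.
  apply: (@trivial_on_glue _ _ _ _ (b, 0)) => //=; try exact: closed_box.
  - by split=> /=; lra.
  - by split=> /=; lra.
  rewrite bI => G G' hG hG' e.
  have hV' u : box b b 0 1 u -> V (h u).
    by move=> [/andP[? ?] ?]; apply: hV; split=> //; lra.
  have b0 : box b b 0 1 (b, 0) by split=> /=; lra.
  move=> y yI; apply: (horizontal_uniq_box ch hV' b0 hG hG' e).
  by rewrite -bI.
move=> x x0 x1.
(* A box of height [c, d] around [x] is trivial if it is thin enough. *)
pose Q c d := exists2 e, 0 < e & forall a b, 0 <= a -> a <= x -> x <= b -> b <= 1 ->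
   x - e < a -> b < x + e -> trivial_on h (box a b c d).
suff : Q 0 1 by [].
apply: (@interval_chain R Q) => //.
  move=> c d f c0 cd df f1 [e e0 he] [e' e'0 he'].
  exists (Num.min e e'); first by rewrite lt_min e0.
  have m1 : Num.min e e' <= e by rewrite ge_min lexx.
  have m2 : Num.min e e' <= e' by rewrite ge_min lexx orbT.
  move=> a b a0 ax xb b1 q1 q2.
  have -> : box a b c f = box a b c d `|` box a b d f.
    apply/seteqP; split=> t /=; last by move=> [] [? /andP[? ?]]; split=> //; lra.
    move=> [? /andP[? ?]]; case: (leP t.2 d) => ?; [left|right]; split=> //; lra.
  have bI : box a b c d `&` box a b d f = box a b d d.
    apply/seteqP; split=> t /=.
      by move=> [[? /andP[? ?]] [? /andP[? ?]]]; split=> //; lra.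
    by move=> [? /andP[? ?]]; split; split=> //; lra.
  apply: (@trivial_on_glue _ _ _ _ (x, d)) => //=; try exact: closed_box.
  - by split=> /=; lra.
  - by split=> /=; lra.
  - rewrite bI => G G' hG hG' e1.
    have hV' u : box a b d d u -> V (h u).
      by move=> [/andP[? ?] /andP[? ?]]; apply: hV; split; lra.
    have bd : box a b d d (x, d) by split=> /=; lra.
    move=> y yI; apply: (horizontal_uniq_box ch hV' bd hG hG' e1).
    by rewrite -bI.
  - by apply: he => //; lra.
  - by apply: he' => //; lra.
move=> y y0 y1; have b01 : box 0 1 0 1 (x, y) by split=> /=; lra.
have [N /nbhs_ballP[e /= e0 hbe] hN] := trivial_on_small ch (hV _ b01).
exists e => // c d c0 cy yd d1 yec dye.
exists e => // a b a0 ax xb b1 xea bxe; apply: hN => -[u1 u2] [/= /andP[? ?] /andP[? ?]].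
by apply: hbe; split=> /=; rewrite /ball /= ltr_norml; lra.
Qed.

Hypothesis openV : open V.
Hypothesis scV : simply_connected R V.
Hypothesis arcs : forall p N, V p -> nbhs p N -> \forall q \near p,
  exists g : R -> X, [/\ continuous g, g 0 = p, g 1 = q & forall t, 0 <= t <= 1 -> N (g t)].

(** Paths and homotopies are given over [[0, 1]].  Composed with this
    retraction they are continuous on the whole line, or plane. *)
Definition clamp (t : R) : R := Num.max 0 (Num.min t 1).

Lemma clamp01 t : 0 <= clamp t <= 1.
Proof. by rewrite /clamp le_max lexx /= ge_max ler01 ge_min lexx orbT. Qed.

Lemma clampE t : 0 <= t <= 1 -> clamp t = t.
Proof. by move=> /andP[t0 t1]; rewrite /clamp min_l// max_r. Qed.

Lemma continuous_clamp : continuous clamp.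
Proof.
move=> t; apply/cvgrPdist_lt => e e0; near=> s.
have ts : `|t - s| < e by near: s; exact: cvgr_dist_lt.
apply: le_lt_trans ts; rewrite /clamp ler_norml.
have := ler_norm (t - s); have := ler_norm (- (t - s)); rewrite normrN.
by have [t1|t1] := leP t 1; have [s1|s1] := leP s 1; rewrite /Num.max ?ltr01;
  try case: (ltP 0 t) => ?; try case: (ltP 0 s) => ?; lra.
Unshelve. all: by end_near. Qed.

Lemma continuous_clamp_path (g : R -> X) :
  {within `[0, 1], continuous g} -> continuous (g \o clamp).
Proof.
move=> /subspace_continuousP cg t N Ngt.
have c01 : `[0, 1]%classic (clamp t) by rewrite /= in_itv; exact: clamp01.
have nn : \forall s \near clamp t, `[0, 1]%classic s -> N (g s) := cg _ c01 _ Ngt.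
have nn' : \forall s \near t, `[0, 1]%classic (clamp s) -> N (g (clamp s)).
  exact: continuous_clamp nn.
move: nn'; apply: filterS => s /= h; apply: h; rewrite in_itv; exact: clamp01.
Qed.

Lemma continuous_clamp_square (H : R * R -> X) :
  {within [set u : R * R | 0 <= u.1 <= 1 /\ 0 <= u.2 <= 1], continuous H} ->
  continuous (fun u => H (clamp u.1, clamp u.2)).
Proof.
move=> /subspace_continuousP cH [s t] N Ngt.
have c01 : [set u : R * R | 0 <= u.1 <= 1 /\ 0 <= u.2 <= 1] (clamp s, clamp t).
  by split; exact: clamp01.
have c1 : continuous (fun u : R * R => clamp u.1).
  by move=> u; apply: (@continuous_comp _ _ _ (fun u : R * R => u.1) clamp);
    [exact: cvg_fst | exact: continuous_clamp].
have c2 : continuous (fun u : R * R => clamp u.2).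
  by move=> u; apply: (@continuous_comp _ _ _ (fun u : R * R => u.2) clamp);
    [exact: cvg_snd | exact: continuous_clamp].
have cc := cvg_pair (c1 (s, t)) (c2 (s, t)).
have nn : \forall u \near (s, t), 0 <= clamp u.1 <= 1 /\ 0 <= clamp u.2 <= 1 ->
    N (H (clamp u.1, clamp u.2)).
  exact: cc _ (cH _ c01 _ Ngt).
by move: nn; apply: filterS => u /= h; apply: h; split; exact: clamp01.
Qed.

(** The monodromy of a contractible loop is trivial: a frame over the
    contracting homotopy is constant along the three sides of the square that
    are sent to the base point, hence takes the same value at both ends of
    the fourth side, which is the loop. *)
Lemma horizontal_loop (g : R -> X) G : continuous g ->
  (forall t, 0 <= t <= 1 -> V (g t)) -> g 0 = g 1 ->
  horizontal g [set t | 0 <= t <= 1] G -> G 0 = G 1.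
Proof.
move=> cg gV g01 hG.
have [_ _ nullh] := scV.
have [H0 [cH0 H0V H00 H01 H0s]] := nullh g (continuous_subspaceT cg) gV g01.
pose H (u : R * R) := H0 (clamp u.1, clamp u.2).
have cH : continuous H by exact: continuous_clamp_square.
have HV u : box 0 1 0 1 u -> V (H u) by move=> _; apply: H0V; exact: clamp01.
have [L hL uL] := trivial_on_square cH HV.
have x01 : 0 <= (0 : R) <= 1 by rewrite lexx ler01.
have y01 : 0 <= (1 : R) <= 1 by rewrite lexx ler01.
have Vg0 : V (g 0) by exact: gV.
(* On a side sent to the point [g 0], [L] is horizontal over a constant path. *)
have side (k : R -> R * R) : continuous k -> (forall t, 0 <= t <= 1 -> box 0 1 0 1 (k t)) ->
    (forall t, 0 <= t <= 1 -> H (k t) = g 0) -> L (k 0) = L (k 1).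
  move=> ck kb Hk.
  have hk := @horizontal_pull _ _ k H (fun=> g 0) _ [set t | 0 <= t <= 1] L ck kb (fun t t01 => esym (Hk t t01)) hL.
  have hc := @horizontal_cst _ (fun=> g 0) [set t : R | 0 <= t <= 1] (L (k 0)) _ Vg0 (fun _ _ => erefl).
  have ccst : continuous (fun _ : R => g 0) by move=> t; exact: cvg_cst.
  exact: (horizontal_uniq ler01 ccst (fun t _ => Vg0) hc hk).1 erefl.
have c1 (a : R) : continuous (fun t : R => (t, a) : R * R).
  by move=> t; exact: (cvg_pair (@cvg_id _ (nbhs t)) (cvg_cst a)).
have c2 (a : R) : continuous (fun t : R => (a, t) : R * R).
  by move=> t; exact: (cvg_pair (cvg_cst a) (@cvg_id _ (nbhs t))).
have e1 : L (0, 0) = L (1, 0).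
  apply: (side (fun t => (t, 0))) => // t t01.
  by rewrite /H /= !clampE//; have [] := H0s _ t01.
have e2 : L (1, 0) = L (1, 1).
  apply: (side (fun t => (1, t))) => // t t01.
  by rewrite /H /= !clampE// H01.
have e3 : L (0, 1) = L (1, 1).
  apply: (side (fun t => (t, 1))) => // t t01.
  by rewrite /H /= !clampE//; have [] := H0s _ t01.
have hk := @horizontal_pull _ _ (fun t => (0, t)) H g _ [set t | 0 <= t <= 1] L (c2 0)
  (fun t t01 => conj x01 t01) (fun t t01 => esym (etrans (congr1 H0 (f_equal2 pair (clampE x01) (clampE t01))) (H00 t t01))) hL.
have hk' := horizontalMr (invmx (L (0, 0)) *m G 0) hk.
have u0 : L (0, 0) \in unitmx by apply: uL; split.
have [h _] := horizontal_uniq ler01 cg gV hG hk'.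
by rewrite h /= ?mulKVmx// e3 -e2 -e1 mulKVmx.
Qed.

Definition concat (f g : R -> X) (t : R) : X := if t <= 2^-1 then f (2 * t) else g (2 * t - 1).

Lemma continuous_concat (f g : R -> X) : continuous f -> continuous g -> f 1 = g 0 ->
  continuous (concat f g).
Proof.
move=> cf cg fg t.
have cf' : continuous (fun t : R => f (2 * t)).
  move=> s; apply: (@continuous_comp _ _ _ (fun t : R => 2 * t) f); last exact: cf.
  exact: (cvgM (cvg_cst (2 : R)) (@cvg_id _ (nbhs s))).
have cg' : continuous (fun t : R => g (2 * t - 1)).
  move=> s; apply: (@continuous_comp _ _ _ (fun t : R => 2 * t - 1) g); last exact: cg.
  exact: (cvgB (cvgM (cvg_cst (2 : R)) (@cvg_id _ (nbhs s))) (cvg_cst (1 : R))).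
have mid : f (2 * 2^-1) = g (2 * 2^-1 - 1) by rewrite mulfV// subrr.
rewrite /continuous_at /concat; case: (ltgtP t 2^-1) => t2.
- move=> N Nt; have nf : \forall s \near t, N (f (2 * s)) := cf' t _ Nt.
  have nn : \forall s \near t, s < 2^-1 by exact: lt_nbhsl.
  change (\forall s \near t, N (if s <= 2^-1 then f (2 * s) else g (2 * s - 1))).
  by near=> s; rewrite ifT; [near: s|apply: ltW; near: s].
- move=> N Nt; have ng : \forall s \near t, N (g (2 * s - 1)) := cg' t _ Nt.
  have nn : \forall s \near t, 2^-1 < s by apply: open_nbhs_nbhs; split=> //; exact: open_gt.
  change (\forall s \near t, N (if s <= 2^-1 then f (2 * s) else g (2 * s - 1))).
  near=> s; rewrite leNgt ifF; first by near: s.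
  by apply/negbTE; rewrite negbK; near: s.
- move=> N; rewrite t2 => Nt.
  have nf : \forall s \near (2^-1 : R), N (f (2 * s)) := cf' 2^-1 _ Nt.
  rewrite mid in Nt.
  have ng : \forall s \near (2^-1 : R), N (g (2 * s - 1)) := cg' 2^-1 _ Nt.
  change (\forall s \near (2^-1 : R), N (if s <= 2^-1 then f (2 * s) else g (2 * s - 1))).
  by near=> s; case: ifP => _; near: s.
Unshelve. all: by end_near. Qed.

Variables (x0 : X) (Vx0 : V x0).

Definition transport (p : X) (M : 'M[K]_n) := exists g : R -> X, exists G,
  [/\ continuous g, (forall t, 0 <= t <= 1 -> V (g t)), g 0 = x0, g 1 = p &
   [/\ horizontal g [set t | 0 <= t <= 1] G, G 0 = 1%:M & G 1 = M]].

(** Existence of the transport along a path, starting from the identity. *)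
Lemma lift_path (g : R -> X) : continuous g -> (forall t, 0 <= t <= 1 -> V (g t)) ->
  exists G, [/\ horizontal g [set t | 0 <= t <= 1] G, G 0 = 1%:M &
    forall t, 0 <= t <= 1 -> G t \in unitmx].
Proof.
move=> cg gV; have [G hG uG] := trivial_on_path cg gV.
have u0 : G 0 \in unitmx by apply: uG; rewrite /= lexx ler01.
exists (fun t => G t *m invmx (G 0)); split; first exact: horizontalMr.
  by rewrite mulmxV.
by move=> t t01; rewrite unitmx_mul uG//= unitmx_inv.
Qed.

Lemma transport_unit p M : transport p M -> M \in unitmx.
Proof.
move=> [g [G [cg gV g0 g1 [hG G0 <-]]]].
have [L [hL L0 uL]] := lift_path cg gV.
have [h _] := horizontal_uniq ler01 cg gV hG hL.
by rewrite h ?G0// uL// lexx ler01.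
Qed.

Lemma transport_ex p : V p -> exists M, transport p M.
Proof.
move=> Vp; have [_ /(_ _ _ Vx0 Vp)[g [/continuous_clamp_path cg gV g0 g1]] _] := scV.
have gV' t : 0 <= t <= 1 -> V ((g \o clamp) t) by move=> _; apply: gV; exact: clamp01.
have [L [hL L0 _]] := lift_path cg gV'.
exists (L 1), (g \o clamp), L; split => //=; rewrite clampE ?lexx ?ler01//.
Qed.

Lemma concat_half (f g : R -> X) t : 0 <= t <= 1 -> concat f g (t / 2) = f t.
Proof.
move=> t01; rewrite /concat ifT; last lra.
by congr f; field.
Qed.

Lemma concat_half2 (f g : R -> X) t : f 1 = g 0 -> 0 <= t <= 1 ->
  concat f g ((1 + t) / 2) = g t.
Proof.
move=> fg t01; rewrite /concat; case: ifP => h.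
  have -> : t = 0 by lra.
  by rewrite -fg; congr f; field.
by congr g; field.
Qed.

(** Going along the first path and back along the second is a loop, around
    which the monodromy is trivial. *)
Lemma transport_uniq p M N : transport p M -> transport p N -> M = N.
Proof.
move=> [g [G [cg gV g0 g1 [hG G0 <-]]]] [g' [G' [cg' gV' g'0 g'1 [hG' G'0 <-]]]].
(* The second path, run backwards. *)
pose r (t : R) := g' (1 - t).
have cr : continuous r.
  move=> s; apply: (@continuous_comp _ _ _ (fun t : R => 1 - t) g'); last exact: cg'.
  exact: (cvgB (cvg_cst (1 : R)) (@cvg_id _ (nbhs s))).
have gr : g 1 = r 0 by rewrite /r subr0 g'1.
pose l := concat g r.
have cl : continuous l by exact: continuous_concat.
have lV t : 0 <= t <= 1 -> V (l t).
  move=> t01; rewrite /l /concat; case: ifP => h; first by apply: gV; lra.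
  by apply: gV'; move/negbT: h; rewrite -ltNge => h; lra.
have [L [hL L0 _]] := lift_path cl lV.
have i0 : 0 <= (0 : R) <= 1 by rewrite lexx ler01.
have i1 : 0 <= (1 : R) <= 1 by rewrite lexx ler01.
have l0 : l 0 = x0 by rewrite /l -[X in concat _ _ X](mul0r (2^-1)) concat_half.
have l1 : l 1 = x0.
  have e : (1 : R) = (1 + 1) / 2 by field.
  by rewrite /l [X in concat _ _ X]e concat_half2// /r subrr.
have L1 : L 0 = L 1 by apply: (horizontal_loop cl lV) => //; rewrite l0 l1.
have half_cont : continuous (fun t : R => t / 2).
  by move=> t; exact: (cvgM (@cvg_id _ (nbhs t)) (cvg_cst (2^-1 : R))).
have half2_cont : continuous (fun t : R => 1 - t / 2).
  by move=> t; exact: (cvgB (cvg_cst (1 : R)) (half_cont t)).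
have in1 (t : R) : 0 <= t <= 1 -> 0 <= t / 2 <= 1 by move=> /andP[? ?]; apply/andP; split; lra.
have h1 := @horizontal_pull _ _ (fun t : R => t / 2) l g _ [set t | 0 <= t <= 1] L half_cont
  in1 (fun t t01 => esym (concat_half _ _ t01)) hL.
have e1 t : 0 <= t <= 1 -> g' t = l (1 - t / 2).
  move=> t01; have -> : 1 - t / 2 = (1 + (1 - t)) / 2 by field.
  rewrite /l concat_half2//; last lra.
  by rewrite /r; congr g'; ring.
have in2 (t : R) : 0 <= t <= 1 -> 0 <= 1 - t / 2 <= 1 by move=> /andP[? ?]; apply/andP; split; lra.
have h2 := @horizontal_pull _ _ (fun t : R => 1 - t / 2) l g' _ [set t | 0 <= t <= 1] L half2_cont
  in2 e1 hL.
(* [g] is the first half of [l], and [g'] its second half reversed; as [L 0 = L 1],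
   the sections [G] and [G'] both follow [L] up to the middle point. *)
have q1 : G 1 = L (1 / 2).
  by apply: (horizontal_uniq ler01 cg gV hG h1).1; rewrite /= mul0r L0.
have q2 : G' 1 = L (1 - 1 / 2).
  by apply: (horizontal_uniq ler01 cg' gV' hG' h2).1; rewrite /= mul0r subr0 -L1 L0.
by rewrite q1 q2; congr L; field.
Qed.

(** A path from [x0] to [p] is extended by a short arc from [p] to [q], on
    which the section is explicitly given by [F p]. *)
Lemma transport_local p M : transport p M ->
  \forall q \near p, transport q (F p q *m M).
Proof.
move=> [g [G [cg gV g0 g1 [hG G0 G1]]]].
have i0 : 0 <= (0 : R) <= 1 by rewrite lexx ler01.
have i1 : 0 <= (1 : R) <= 1 by rewrite lexx ler01.
have Vp : V p by rewrite -g1; exact: gV.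
have Vn : \forall q \near p, V q by exact: open_nbhs_nbhs.
have N : \forall q \near p, V q /\ \forall r \near q, F p r = F q r *m F p q.
  by move: Vn (Fcomp Vp); apply: filterS2.
have := arcs Vp N; apply: filterS => q [k [ck k0 k1 kN]].
have gk : g 1 = k 0 by rewrite g1 k0.
pose l := concat g k.
have cl : continuous l by exact: continuous_concat.
have lV t : 0 <= t <= 1 -> V (l t).
  move=> t01; rewrite /l /concat; case: ifP => h; first by apply: gV; lra.
  by apply: (kN _ _).1; move/negbT: h; rewrite -ltNge => h; lra.
have [L [hL L0 _]] := lift_path cl lV.
have half_cont : continuous (fun t : R => t / 2).
  by move=> t; exact: (cvgM (@cvg_id _ (nbhs t)) (cvg_cst (2^-1 : R))).
have half2_cont : continuous (fun t : R => (1 + t) / 2).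
  by move=> t; exact: (cvgM (cvgD (cvg_cst (1 : R)) (@cvg_id _ (nbhs t))) (cvg_cst (2^-1 : R))).
have in1 (t : R) : 0 <= t <= 1 -> 0 <= t / 2 <= 1 by move=> /andP[? ?]; apply/andP; split; lra.
have h1 := @horizontal_pull _ _ (fun t : R => t / 2) l g _ [set t | 0 <= t <= 1] L half_cont
  in1 (fun t t01 => esym (concat_half _ _ t01)) hL.
have in2 (t : R) : 0 <= t <= 1 -> 0 <= (1 + t) / 2 <= 1 by move=> /andP[? ?]; apply/andP; split; lra.
have h2 := @horizontal_pull _ _ (fun t : R => (1 + t) / 2) l k _ [set t | 0 <= t <= 1] L half2_cont
  in2 (fun t t01 => esym (concat_half2 gk t01)) hL.
have Lhalf : L (2^-1) = M.
  rewrite -G1 -[2^-1]mul1r; apply/esym.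
  by apply: (horizontal_uniq ler01 cg gV hG h1).1; rewrite /= mul0r L0.
have hk : horizontal k [set t | 0 <= t <= 1] (fun t => F p (k t) *m M).
  apply: horizontalMr => t t01.
  have nk : \forall r \near k t, F p r = F (k t) r *m F p (k t) by exact: (kN _ t01).2.
  by have nk' : \forall s \near t, F p (k s) = F (k t) (k s) *m F p (k t) := ck t _ nk;
    move: nk'; apply: filterS.
have kV t : 0 <= t <= 1 -> V (k t) by move=> /kN[].
have [h _] := horizontal_uniq ler01 ck kV h2 hk.
exists l, L; split=> //.
- by rewrite /l -[X in concat _ _ X](mul0r (2^-1)) concat_half.
- have e : (1 : R) = (1 + 1) / 2 by field.
  by rewrite /l [X in concat _ _ X]e concat_half2.
split=> //.
have e : (1 : R) = (1 + 1) / 2 by field.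
rewrite [X in L X]e; move: h; rewrite /= k1 => ->//.
by rewrite addr0 mul1r Lhalf k0 Fid// mul1mx.
Qed.

(** The transport of the identity from [x0] to [p] depends on [p] only, and so
    defines a global frame. *)
Lemma global_section : exists S : X -> 'M[K]_n,
  [/\ S x0 = 1%:M, forall p, V p -> S p \in unitmx &
    forall p, V p -> \forall q \near p, S q = F p q *m S p].
Proof.
have /choice[S hS] : forall p, exists M, V p -> transport p M.
  move=> p; case: (pselect (V p)) => [Vp|nVp]; last by exists 0.
  by have [M hM] := transport_ex Vp; exists M.
exists S; split.
- apply: (transport_uniq (hS _ Vx0)).
  exists (fun=> x0), (fun=> 1%:M); split=> //; first by move=> t; exact: cvg_cst.
  by split=> //; exact: horizontal_cst Vx0 _.
- by move=> p Vp; exact: transport_unit (hS _ Vp).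
move=> p Vp.
have Vn : \forall q \near p, V q by exact: open_nbhs_nbhs.
move: Vn (transport_local (hS _ Vp)); apply: filterS2 => q Vq tq.
exact: transport_uniq (hS _ Vq) tq.
Qed.

End LocalSystem.

(** * The Riemann sphere *)

Section ComplexDerivative.
Variable R : realType.
Local Notation C := (Cplx R).

Lemma is_derive_chain (f g : C -> C) (x df dg : C) :
  is_derive x (1 : C) g dg -> is_derive (g x) (1 : C) f df ->
  is_derive x (1 : C) (f \o g) (dg * df).
Proof.
move=> [dg1 dg2] [df1 df2].
have Dg : differentiable g x := (@derivable1_diffP C C g x).1 dg1.
have Df : differentiable f (g x) := (@derivable1_diffP C C f (g x)).1 df1.
have Dfg := @differentiable_comp C C C C g f x Dg Df.
apply: DeriveDef; first exact: (@derivable1_diffP C C (f \o g) x).2 Dfg.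
have e0 : 'D_1 (f \o g) x = 'd (f \o g) x 1 := @deriveE C C C (f \o g) x 1 Dfg.
have e1 : 'd g x 1 = dg := etrans (esym (@deriveE C C C g x 1 Dg)) dg2.
have e2 := congr1 (fun F : C -> C => F (1 : C)) (@diff_comp C C C C g f x Dg Df).
have e3 := congr1 (fun F : C -> C => F dg) (@deriv1E C C f (g x) df1).
have e4 : derive1 f (g x) = df := etrans (derive1E f (g x)) df2.
apply: (etrans e0); apply: (etrans e2).
have e5 := congr1 ('d f (g x) : C -> C) e1.
apply: (etrans e5); apply: (etrans e3).
exact: (congr1 (fun c : C => dg * c) e4).
Qed.

Lemma is_derive_continuous (g : C -> C) (x l : C) : is_derive x (1 : C) g l ->
  {for x, continuous g}.
Proof. by move=> [dg _]; exact: differentiable_continuous ((@derivable1_diffP C C g x).1 dg). Qed.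

(** Meant for [f] the real or the imaginary part: it brings a vanishing
    complex derivative back to a real function on a ray. *)
Lemma is_derive_Re (g : C -> C) (t : C) (s : R) (f : C -> R) :
  (forall z, `|f z| <= cn z) -> (forall x y, f (x - y) = f x - f y) ->
  is_derive (s%:C%C * t : C) (1 : C) g 0 ->
  is_derive s (1 : R) (fun s : R => f (g (s%:C%C * t))) 0.
Proof.
move=> fle fB dg.
suff cv : (fun h : R => h^-1 *: (f (g ((h *: (1 : R) + s)%:C%C * t)) - f (g (s%:C%C * t)))) @ 0^' --> (0 : R).
  by apply: DeriveDef; [apply/cvg_ex; exists 0 | exact/cvg_lim].
apply/cvgrPdist_le => e e0.
have e1 : 0 < e / (cn t + 1) by rewrite divr_gt0// ltr_wpDl// cn_ge0.
have [d d0 hd] := is_derive_cn dg e1.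
have ct1 : 0 < cn t + 1 by rewrite ltr_wpDl// cn_ge0.
apply/nbhs_ballP; exists (d / (cn t + 1)); first by rewrite /= divr_gt0.
move=> h; rewrite /ball /= sub0r normrN ltr_pdivlMr// => hh h0.
rewrite sub0r normrN -fB normrM normfV.
have h0' : 0 < `|h| by rewrite normr_gt0.
have cht : cn (h%:C%C * t : C) = `|h| * cn t by rewrite cnM cn_real.
have small : cn (h%:C%C * t : C) < d.
  by rewrite cht; apply: le_lt_trans hh; rewrite ler_wpM2l// lerDl.
rewrite mulrC ler_pdivrMr//.
apply: (le_trans (fle _)).
have -> : (h *: (1 : R) + s)%:C%C * t = s%:C%C * t + h%:C%C * t :> C.
  by rewrite [h *: _]mulr1 rmorphD /= mulrDl addrC.
have := hd _ small; rewrite mulr0 subr0 => /le_trans; apply.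
have q : e / (cn t + 1) * cn t <= e.
  by rewrite mulrAC ler_pdivrMr// ler_wpM2l ?ltW// ltrDl.
have := ler_wpM2r (ltW h0') q; rewrite cht.
by rewrite -!mulrA [cn t * `|h|]mulrC.
Qed.

End ComplexDerivative.

Section RiemannSphere.
Variable R : realType.
Local Notation C := (Cplx R).
Implicit Types (p q : CP1 R) (t : C).

Definition ichart p q : C :=
  match p, q with
  | Some a, Some z => z - a
  | None, Some z => z^-1
  | _, None => 0
  end.

Lemma chartK p t : ichart p (chart p t) = t.
Proof.
case: p => [a|] /=; first by rewrite addrC addKr.
by case: eqP => [->//|_]; rewrite invrK.
Qed.

Lemma chart0 p : chart p 0 = p.
Proof. by case: p => [a|] /=; rewrite ?addr0 ?eqxx. Qed.

Lemma compact_closed_disc (M : R) : compact [set z : C | cn z <= M].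
Proof.
pose f (u : R * R) : C := (u.1 +i* u.2)%C.
have cf : continuous f.
  move=> u; apply: cvg_ReIm; [exact: cvg_fst | exact: cvg_snd].
have cK : compact (f @` (`[- M, M] `*` `[- M, M])).
  apply: continuous_compact; first exact: continuous_subspaceT.
  by apply: compact_setX; exact: segment_compact.
apply: subclosed_compact cK _.
  have -> : [set z : C | cn z <= M] = ~` [set z : C | M < cn z].
    by apply/seteqP; split=> z /=; rewrite leNgt; move/negP.
  apply: open_closedC; rewrite openE => z /= Mz; apply/(@nbhs_cnP R C).
  exists (cn z - M); first by rewrite subr_gt0.
  move=> y yz /=; have := cnD (z - y) y; rewrite subrK cnB; lra.
move=> [a b] /= zM; exists (a, b) => //; split=> /=; rewrite in_itv /= -ler_norml.
  exact: le_trans (cn_Re _) zM.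
exact: le_trans (cn_Im _) zM.
Qed.

Lemma closed_disc (M : R) : closed [set z : C | cn z <= M].
Proof. by apply: compact_closed; [exact: norm_hausdorff | exact: compact_closed_disc]. Qed.

Lemma compact_cn_bounded (W : set C) : compact W -> exists M : R, forall z, W z -> cn z <= M.
Proof.
move=> cW.
have ccn : continuous (@cn R C : C -> R).
  move=> z; apply/(@cvgrPdist_lt _ _ _ (nbhs z) (nbhs_filter z)) => e e0.
  apply/(@nbhs_cnP R C); exists e => // y yz.
  have := cnD (z - y) y; have := cnD (y - z) z; rewrite !subrK [cn (z - y)]cnB => h1 h2.
  by rewrite ltr_norml; lra.
have : compact (@cn R C @` W) by apply: continuous_compact => //; exact: continuous_subspaceT.
move=> /compact_bounded[M [_ hM]]; exists (M + 1) => z Wz.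
have M1 : M < M + 1 by rewrite ltrDl.
have := hM _ M1 (cn z) (ex_intro2 _ _ z Wz erefl).
by rewrite /= ger0_norm ?cn_ge0.
Qed.

(** At infinity, this says that compact subsets of the plane are bounded. *)
Lemma nbhs_chart p N : nbhs p N -> exists2 r : R, 0 < r & forall t, cn t < r -> N (chart p t).
Proof.
case: p => [a|].
  move=> /(@nbhs_cnP R C)[r r0 hr]; exists r => // t tr.
  by apply: hr; rewrite addrC addKr.
move=> [W [cW _] WN]; have [M hM] := compact_cn_bounded cW.
exists (`|M| + 1)^-1; first by rewrite invr_gt0 ltr_wpDl.
move=> t tr; apply: WN => /=; case: eqP => [_|/eqP t0]; first by right.
left; exists t^-1 => // /hM; rewrite cnV => h.
have t0' : 0 < cn t by rewrite cn_gt0.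
have := ltr_pM2l t0' (cn t)^-1 (`|M| + 1).
have M1 : 0 < `|M| + 1 by rewrite ltr_wpDl.
have : (`|M| + 1) < (cn t)^-1 by rewrite -[X in X < _]invrK ltf_pV2 ?posrE ?invr_gt0.
by have := ler_norm M; lra.
Qed.

Lemma chart_near p (N : CP1 R -> Prop) : (\forall q \near p, N q) ->
  \forall t \near (0 : C), N (chart p t).
Proof.
move=> /nbhs_chart[r r0 hr]; apply/(@nbhs_cnP R C); exists r => // t.
by rewrite subr0; exact: hr.
Qed.

(** At infinity, this says that closed discs are compact. *)
Lemma chart_nbhs p (r : R) : 0 < r -> \forall q \near p, exists2 t, cn t < r & q = chart p t.
Proof.
move=> r0; case: p => [a|].
  change (\forall z \near a, exists2 t, cn t < r & Some z = chart (Some a) t).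
  apply/(@nbhs_cnP R C); exists r => // z za; exists (z - a) => //=.
  by rewrite addrC subrK.
exists [set z : C | cn z <= r^-1].
  by split; [exact: compact_closed_disc | exact: closed_disc].
move=> q [[z /= /negP] |/= ->]; last by exists 0; rewrite ?cn0 //= eqxx.
rewrite -ltNge => rz <-; exists z^-1.
  by rewrite cnV -[X in _ < X]invrK ltf_pV2 ?posrE ?invr_gt0// (lt_trans _ rz)// invr_gt0.
rewrite /= invr_eq0 invrK; case: eqP => // z0.
by move: rz; rewrite z0 cn0 ltNge invr_ge0 ltW.
Qed.

Lemma chart_finite p t : t != 0 -> exists z, chart p t = Some z.
Proof.
case: p => [a|] t0; first by exists (a + t).
by exists t^-1; rewrite /= (negbTE t0).
Qed.

Lemma chart_continuous0 p : {for 0, continuous (chart p)}.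
Proof.
move=> N; rewrite chart0 => /nbhs_chart[r r0 hr].
by apply/(@nbhs_cnP R C); exists r => // t; rewrite subr0; exact: hr.
Qed.

Lemma chart_continuous p : continuous (chart p).
Proof.
move=> t; case: p => [a|].
  move=> N /= Nt.
  exact: (cvgD (cvg_cst a) (@cvg_id _ (nbhs t)) Nt).
have [->|t0] := eqVneq t 0; first exact: chart_continuous0.
move=> N; rewrite /= (negbTE t0) => Nt.
have h1 : \forall s \near t, N (Some s^-1) := inv_continuous t0 Nt.
have h2 : \forall s \near t, s != 0.
  apply/(@nbhs_cnP R C); exists (cn t).
    by rewrite cn_gt0.
  by move=> s st; apply/eqP => s0; move: st; rewrite s0 sub0r cnN ltxx.
change (\forall s \near t, N (if s == 0 then None else Some s^-1)).
by move: h1 h2; apply: filterS2 => s h /negbTE ->.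
Qed.

Lemma continuous_radius t : continuous (fun s : R => s%:C%C * t : C).
Proof.
move=> s; apply/(@cvg_cnP R C) => e e0.
have c1 : 0 < cn t + 1 by rewrite ltr_wpDl// cn_ge0.
apply/nbhs_ballP; exists (e / (cn t + 1)); first by rewrite /= divr_gt0.
move=> u; rewrite /ball /= ltr_pdivlMr// distrC => h.
rewrite -mulrBl -rmorphB cnM cn_real; apply: le_lt_trans h.
by rewrite ler_wpM2l// lerDl.
Qed.

(** Local path connectedness: the arcs are rays of a disc in the chart. *)
Lemma CP1_arcs p N : nbhs p N -> \forall q \near p, exists g : R -> CP1 R,
  [/\ continuous g, g 0 = p, g 1 = q & forall t : R, 0 <= t <= 1 -> N (g t)].
Proof.
move=> /nbhs_chart[r r0 hr]; have := chart_nbhs p r0; apply: filterS => q [t tr ->].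
exists (fun s : R => chart p (s%:C%C * t)); split.
- move=> s; apply: (@continuous_comp _ _ _ (fun s : R => s%:C%C * t : C) (chart p)).
    exact: continuous_radius.
  exact: chart_continuous.
- by rewrite /= mul0r chart0.
- by rewrite /= mul1r.
move=> s /andP[s0 s1]; apply: hr; rewrite cnM cn_real ger0_norm//.
by apply: le_lt_trans tr; rewrite ler_piMl// cn_ge0.
Qed.

(** The affine coordinate says nothing about the derivative at infinity;
    continuity in the chart is what replaces it. *)
Definition flat_near (f : CP1 R -> C) p :=
  (\forall q \near p, if q is Some z then is_derive z (1 : C) (fun z => f (Some z)) 0 else True) /\
  {for 0, continuous (f \o chart p)}.

(** Only [d = 0] is of interest, so that the factor coming from the change of
    coordinate may remain unspecified. *)
Lemma chart_derive (f : CP1 R -> C) p t z d : chart p t = Some z ->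
  is_derive z (1 : C) (fun z => f (Some z)) d ->
  t != 0 -> exists c, is_derive t (1 : C) (f \o chart p) (c * d).
Proof.
case: p => [a|] /=.
  move=> [<-] df _; exists 1.
  have da : is_derive t (1 : C) (fun t => a + t) 1.
    apply: (@quad_is_derive _ _ _ _ 0 1) => // h _.
    by rewrite mulr1 addrA [a + t + h]addrC addrK subrr cn0 mul0r.
  exact: (is_derive_chain da df).
move=> + + t0; rewrite (negbTE t0) => -[<-] df.
exists (- t ^- 2).
have dV : is_derive t (1 : C) (fun t => t^-1) (- t ^- 2).
  apply: DeriveDef; first exact: derivableV.
  by rewrite deriveV// derive_id [_ *: _]mulr1.
apply: near_eq_is_derive (is_derive_chain dV df).
apply/(@nbhs_cnP R C); exists (cn t).
  by rewrite cn_gt0.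
move=> s st /=; case: eqP => // s0.
by move: st; rewrite s0 sub0r cnN ltxx.
Qed.

(** On a ray issued from [p], the real and imaginary parts have derivative
    zero except perhaps at [p], where they are continuous: the mean value
    theorem applies on the closed ray. *)
Lemma flat_near_const f p : flat_near f p -> \forall q \near p, f q = f p.
Proof.
move=> [df cf].
have [r r0 hr] := nbhs_chart df.
have := chart_nbhs p r0; apply: filterS => q [t tr ->].
pose g := f \o chart p.
have dg (tau : C) : cn tau < r -> tau != 0 -> is_derive tau (1 : C) g 0.
  move=> h tau0; have [z ez] := chart_finite p tau0.
  have := hr _ h; rewrite ez => dz.
  by have [c] := chart_derive ez dz tau0; rewrite mulr0.
rewrite -[X in _ = f X](chart0 p) -/(g t) -[LHS]/(g t) -[RHS]/(g 0).
have [->//|t0] := eqVneq t 0.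
have st (s : R) : 0 < s <= 1 -> cn (s%:C%C * t : C) < r /\ (s%:C%C * t : C) != 0.
  move=> /andP[s0 s1]; split.
    by rewrite cnM cn_real gtr0_norm//; apply: le_lt_trans tr; rewrite ler_piMl// cn_ge0.
  by rewrite mulf_neq0// -cn_eq0 cn_real normr_eq0 gt_eqF.
have cg (s : R) : 0 <= s <= 1 -> {for s, continuous (fun s : R => g (s%:C%C * t))}.
  move=> /andP[s0 s1]; apply: (@continuous_comp _ _ _ (fun s : R => s%:C%C * t : C) g).
    exact: continuous_radius.
  move: s0; rewrite le_eqVlt => /orP[/eqP <-|s0]; first by rewrite mul0r; exact: cf.
  have [h1 h2] := st s (introT andP (conj s0 s1)).
  exact: is_derive_continuous (dg _ h1 h2).
have key (F : C -> R) : (forall z, `|F z| <= cn z) -> (forall x y, F (x - y) = F x - F y) ->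
    F (g t) = F (g 0).
  move=> fle fB.
  have dF (s : R) : s \in `]0, 1[ -> is_derive s (1 : R) (fun s : R => F (g (s%:C%C * t))) 0.
    rewrite in_itv /= => /andP[s0 s1].
    have [h1 h2] := st s (introT andP (conj s0 (ltW s1))).
    exact: (is_derive_Re fle fB (dg _ h1 h2)).
  have cF : {within `[0, 1], continuous (fun s : R => F (g (s%:C%C * t)))}.
    apply: continuous_in_subspaceT => s; rewrite inE /= in_itv /= => s01.
    have /(@cvg_cnP R C) hc := cg s s01.
    apply/cvgrPdist_lt => e e0; have := hc _ e0; apply: filterS => u hu.
    rewrite -fB; apply: (le_lt_trans (fle _)); by rewrite cnB.
  have [c _ eF] := @MVT R _ (fun=> 0) 0 1 ltr01 dF cF.
  rewrite [RHS]mul0r in eF; move: (subr0_eq eF).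
  by rewrite rmorph1 mul1r rmorph0 mul0r.
have eR := key (@complex.Re R) (@cn_Re R) (@ReB R).
have eI := key (@complex.Im R) (@cn_Im R) (@ImB R).
by move: eR eI; case: (g t) => a b; case: (g 0) => c d /= -> ->.
Qed.

End RiemannSphere.

(** * Fundamental matrices on the sphere *)

Section RegularPoints.
Variable R : realType.
Local Notation C := (Cplx R).

Lemma analytic_at0_continuous (u : C -> C) : analytic_at0 u -> {for 0, continuous u}.
Proof.
move=> /analytic_at0P[c [M [r r0 [cM hu]]]].
have r0t : 32 * (r * cn (0 : C)) <= 1 by rewrite cn0 !mulr0.
have := near_eq_is_derive _ (psum_is_derive r0 cM r0t); move=> /(_ u) h.
apply: (@is_derive_continuous _ _ _ (psum (dcoef c) 0)); apply: h.
by move: hu; apply: filterS => t ->.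
Qed.

Lemma pbound_shift (c : nat -> C) M (r : R) : pbound c M r ->
  pbound (fun k => c k.+1) (M * r) r.
Proof. by move=> h k; apply: (le_trans (h _)); rewrite exprS mulrA. Qed.

Lemma psum_shift (c : nat -> C) M (r : R) (t : C) : 0 <= r -> pbound c M r ->
  r * cn t <= 2^-1 -> psum c t = c 0%N + t * psum (fun k => c k.+1) t.
Proof.
move=> r0 cM rt; apply: psumE.
have cv := cvg_psum r0 (pbound_shift cM) rt.
have cv' : (fun k => c 0%N + t * series (pterm (fun k => c k.+1) t) k) @ \oo -->
    (c 0%N + t * psum (fun k => c k.+1) t : C).
  exact: (@cvgD C C nat \oo _ _ _ _ _ (cvg_cst (c 0%N)) (@cvgM C nat \oo _ _ _ _ _ (cvg_cst t) cv)).
apply/(@cvg_cnP R C) => e e0.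
have [N _ hN] := (@cvg_cnP R C _ _ _ _ _).1 cv' _ e0.
exists N.+1 => // -[//|k] /= Nk.
have := hN k Nk; rewrite /=.
congr (cn (_ - _) < _); rewrite /series /= big_nat_recl// /pterm expr0 mulr1.
by congr (_ + _); rewrite mulr_sumr; apply: eq_bigr => i _; rewrite exprS mulrCA.
Qed.

Lemma near_dnbhs0 (P : C -> Prop) : (\forall t \near (0 : C), P t) ->
  \forall t \near (0 : C)^', P t.
Proof. exact: cvg_within. Qed.

Lemma analytic_psum (c : nat -> C) M (r : R) : 0 < r -> pbound c M r -> analytic_at0 (psum c).
Proof.
move=> r0 cM; apply/analytic_at0P; exists c, M, r => //; split=> //; near=> t; by [].
Unshelve. all: by end_near. Qed.

Lemma analytic_at0N (u : C -> C) : analytic_at0 u -> analytic_at0 (fun t => - u t).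
Proof.
move=> au; have := analytic_at0M (analytic_at0_cst (-1 : C)) au.
by apply: analytic_at0_eq; near=> t; rewrite mulN1r.
Unshelve. all: by end_near. Qed.

(** For [t = 1 / x] the factor [jac] is [- t ^- 2].  So a pole of [f], or a
    non-zero coefficient of order 0 or 1 in its expansion, would give
    a pole of [jac * f]. *)
Lemma regular_at_infinity (f : CP1 R -> C) :
  analytic_at f None \/ pole_at f None ->
  ~ pole_at (fun q => jac None q * f q) None ->
  exists2 u : C -> C, analytic_at0 u &
    \forall t \near (0 : C), f (chart None t) = - t ^+ 2 * u t.
Proof.
have jacE (t : C) : t != 0 -> jac None (chart None t) = - t ^- 2.
  by move=> t0; rewrite /= (negbTE t0) exprVn.
have t_neq0 : \forall t \near (0 : C)^', t != 0 by exact: withinT.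
move=> [af|[k [u [au u0 hu]]]] npole; last first.
  (* A pole of order [k + 1] of [f] is one of order [k + 3] of [jac * f]. *)
  case: npole; exists k.+2, (fun t => - u t); split.
  - exact: analytic_at0N.
  - by rewrite oppr_eq0.
  move: t_neq0 hu; apply: filterS2 => t t0 hu.
  rewrite hu jacE// mulrN mulNr mulrA -invfM -exprD.
  by rewrite addnC addnS addnS addn0.
have /analytic_at0P[c [M [r r0 [cM hf]]]] : analytic_at0 (f \o chart None) := af.
have cM1 := pbound_shift cM; have cM2 := pbound_shift cM1.
have small : \forall t \near (0 : C), r * cn t <= 2^-1.
  have := near0_small (2 * r); apply: filterS => t; rewrite -mulrA; lra.
have exp1 : \forall t \near (0 : C), f (chart None t) = c 0%N + t * psum (fun k => c k.+1) t.
  move: small hf; apply: filterS2 => t st; rewrite /= => ->.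
  by rewrite (psum_shift (ltW r0) cM).
have exp2 : \forall t \near (0 : C), f (chart None t) = c 0%N + t * (c 1%N + t * psum (fun k => c k.+2) t).
  move: small exp1; apply: filterS2 => t st ->.
  by rewrite (psum_shift (ltW r0) cM1).
(* Otherwise [jac * f] has a pole of order 2, then of order 1. *)
have c00 : c 0%N = 0.
  apply/eqP/negPn/negP => c00; apply: npole; exists 1%N, (fun t => - psum c t); split.
  - by apply: analytic_at0N; exact: analytic_psum cM.
  - by rewrite psum0 oppr_eq0.
  move: t_neq0 (near_dnbhs0 hf); apply: filterS2 => t t0 hft.
  by rewrite jacE// [f _]hft mulrN mulNr.
have c10 : c 1%N = 0.
  apply/eqP/negPn/negP => c10; apply: npole; exists 0%N, (fun t => - psum (fun k => c k.+1) t); split.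
  - by apply: analytic_at0N; exact: analytic_psum cM1.
  - by rewrite psum0 oppr_eq0.
  move: t_neq0 (near_dnbhs0 exp1); apply: filterS2 => t t0 ->.
  by rewrite jacE// c00 add0r; field.
exists (fun t => - psum (fun k => c k.+2) t).
  by apply: analytic_at0N; exact: analytic_psum cM2.
move: exp2; apply: filterS => t ->.
by rewrite c00 c10 !add0r mulrNN expr2 mulrA.
Qed.

End RegularPoints.

Section LocalFundamental.
Variables (R : realType) (n : nat).
Local Notation C := (Cplx R).
Implicit Types (p q : CP1 R).
Variable A : 'M[CP1 R -> C]_n.

Definition coefs p : 'M[C]_n := \matrix_(i, j) A i j p.

(** [dt/dx] for the coordinate [t] of [chart p]. *)
Definition speed p (t : C) : C := if p is Some _ then 1 else - t ^+ 2.

(** At a non-singular point, including infinity, the system is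
    [dy/dt = B(t) y] with [B] analytic. *)
Lemma regular_coefs p : (forall i j, analytic_at (A i j) p \/ pole_at (A i j) p) ->
  ~ singular A p -> exists2 B : C -> 'M[C]_n, (forall i j, analytic_at0 (fun t => B t i j)) &
    \forall t \near (0 : C), coefs (chart p t) = speed p t *: B t.
Proof.
move=> mA reg.
have npole i j : ~ pole_at (fun q => jac p q * A i j q) p.
  by move=> h; apply: reg; exists i, j.
have /choice[u hu] : forall ij : 'I_n * 'I_n, exists u : C -> C, analytic_at0 u /\
    \forall t \near (0 : C), A ij.1 ij.2 (chart p t) = speed p t * u t.
  move=> [i j]; case: p mA npole {reg} => [a|] mA npole /=; last first.
    by have [u] := regular_at_infinity (mA i j) (npole i j); exists u.
  exists (A i j \o chart (Some a)); split.
    case: (mA i j) => // pA; case: (npole i j).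
    by move: pA; congr (pole_at _ _); apply/funext => q /=; rewrite mul1r.
  by near=> t; rewrite mul1r.
exists (fun t => \matrix_(i, j) u (i, j) t).
  by move=> i j; under eq_fun do rewrite mxE; have [] := hu (i, j).
have all_ij : \forall t \near (0 : C), forall ij : 'I_n * 'I_n,
    A ij.1 ij.2 (chart p t) = speed p t * u ij t.
  exact: (@filter_forall C _ (fun ij t => A ij.1 ij.2 (chart p t) = speed p t * u ij t)
    (nbhs (0 : C)) _ (fun ij : 'I_n * 'I_n => (hu ij).2)).
move: all_ij; apply: filterS => t ht; apply/matrixP => i j.
by rewrite !mxE (ht (i, j)).
Unshelve. all: by end_near. Qed.

Lemma ichart_derive p (z : C) : (p = None -> z != 0) ->
  is_derive z (1 : C) (fun z => ichart p (Some z)) (speed p (ichart p (Some z))).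
Proof.
case: p => [a|] /= hz.
  apply: (@quad_is_derive _ _ _ _ 0 1) => // h _.
  rewrite mulr1 (_ : z + h - a - (z - a) - h = 0) ?cn0 ?mul0r//; ring.
have z0 := hz erefl; rewrite exprVn.
by apply: DeriveDef; [exact: derivableV | rewrite deriveV// derive_id [_ *: _]mulr1].
Qed.

Lemma mderive_ichart p (z : C) (M : C -> 'M[C]_n) D : (p = None -> z != 0) ->
  mderive M (ichart p (Some z)) D ->
  mderive (fun z => M (ichart p (Some z))) z (speed p (ichart p (Some z)) *: D).
Proof.
move=> hz dM i j; rewrite mxE.
exact: (is_derive_chain (ichart_derive hz) (dM i j)).
Qed.

(** The equation [M' = A M] in the affine coordinate, which is silent at
    infinity. *)
Definition solves (M : CP1 R -> 'M[C]_n) q :=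
  if q is Some z then mderive (fun z => M (Some z)) z (coefs (Some z) *m M (Some z)) else True.

(** The equation [M' = - M A], satisfied by the inverse of a fundamental
    matrix. *)
Definition solves_dual (M : CP1 R -> 'M[C]_n) q :=
  if q is Some z then mderive (fun z => M (Some z)) z (- (M (Some z) *m coefs (Some z))) else True.

(** Away from [x = 0], where the coordinate [1 / x] used near infinity makes
    sense. *)
Lemma finite_near p : \forall q \near p, forall z, q = Some z -> (p = None -> z != 0).
Proof.
have := chart_nbhs p (@ltr01 R); apply: filterS => q [t _ ->] z ez pN.
move: ez; rewrite pN /=; case: eqP => // /eqP t0 [<-].
by rewrite invr_eq0.
Qed.

Lemma near_ichart p (P : C -> Prop) : (\forall t \near (0 : C), P t) ->
  \forall q \near p, exists2 t, q = chart p t & P t.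
Proof.
move=> /(@nbhs_cnP R C)[r r0 hr]; have := chart_nbhs p r0; apply: filterS => q [t tr ->].
by exists t => //; apply: hr; rewrite subr0.
Qed.

(** [T] is the transpose of a solution of the system of matrix [- B^T].  Solving
    the dual equation separately makes the inverse of [S] analytic without
    inverting a matrix of power series. *)
Lemma local_fundamental p : (forall i j, analytic_at (A i j) p \/ pole_at (A i j) p) ->
  ~ singular A p -> exists S T : C -> 'M[C]_n,
  [/\ forall i j, analytic_at0 (fun t => S t i j) /\ analytic_at0 (fun t => T t i j),
      S 0 = 1%:M, T 0 = 1%:M,
      \forall q \near p, solves (fun q => S (ichart p q)) q
    & \forall q \near p, solves_dual (fun q => T (ichart p q)) q].
Proof.
move=> mA reg; have [B aB hB] := regular_coefs mA reg.
have [S [aS S0 dS]] := local_solution aB.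
have aB' i j : analytic_at0 (fun t => (- (B t)^T) i j).
  by under eq_fun do rewrite !mxE; exact: analytic_at0N.
have [T' [aT T0 dT]] := local_solution aB'.
exists S, (fun t => (T' t)^T); split => //.
- by move=> i j; split=> //; under eq_fun do rewrite mxE.
- by rewrite T0 trmx1.
- have near1 : \forall t \near (0 : C), coefs (chart p t) = speed p t *: B t /\
      mderive S t (B t *m S t) by move: hB dS; apply: filterS2.
  move: (near_ichart p near1) (finite_near p); apply: filterS2 => q [t -> [hBt dSt]] fin.
  case e : (chart p t) => [z|//] /=.
  have et : ichart p (Some z) = t by rewrite -e chartK.
  have := mderive_ichart (fin _ e); rewrite et => /(_ _ _ dSt).
  by rewrite -e hBt scalemxAl.
have near1 : \forall t \near (0 : C), coefs (chart p t) = speed p t *: B t /\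
    mderive T' t (- (B t)^T *m T' t) by move: hB dT; apply: filterS2.
move: (near_ichart p near1) (finite_near p); apply: filterS2 => q [t -> [hBt dTt]] fin.
case e : (chart p t) => [z|//] /=.
have et : ichart p (Some z) = t by rewrite -e chartK.
have := mderive_ichart (fin _ e); rewrite et => /(_ _ _ (mderive_tr dTt)).
rewrite -e hBt trmx_mul linearN /= trmxK mulmxN scalerN scalemxAr.
exact.
Qed.

End LocalFundamental.

Section FundamentalMatrix.
Variables (R : realType) (n : nat).
Local Notation C := (Cplx R).
Implicit Types (p q : CP1 R).
Variable A : 'M[CP1 R -> C]_n.

Lemma solves_continuous (M : CP1 R -> 'M[C]_n) z (D : 'M[C]_n) i j :
  mderive (fun z => M (Some z)) z D ->
  {for 0, continuous ((fun q => M q i j) \o chart (Some z))}.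
Proof.
move=> dM; have cM := is_derive_continuous (dM i j).
apply: (@continuous_comp _ _ _ (fun t => z + t) (fun z => M (Some z) i j)).
  exact: (cvgD (cvg_cst z) (@cvg_id _ (nbhs (0 : C)))).
by rewrite addr0.
Qed.

Lemma continuous0_sum (I : Type) (s : seq I) (u : I -> C -> C) :
  (forall i, {for 0, continuous (u i)}) -> {for 0, continuous (fun t => \sum_(i <- s) u i t)}.
Proof.
move=> cu; elim: s => [|i s IH].
  have -> : (fun t => \sum_(i <- [::]) u i t) = fun=> 0.
    by apply/funext => t; rewrite big_nil.
  exact: (@cst_continuous C C 0 0).
have -> : (fun t => \sum_(j <- i :: s) u j t) = (fun t => u i t + \sum_(j <- s) u j t).
  by apply/funext => t; rewrite big_cons.
exact: (cvgD (cu i) IH).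
Qed.

(** The derivative of [M *m N] is [- M A N + M A N = 0]. *)
Lemma solves_flat (M N : CP1 R -> 'M[C]_n) p :
  (\forall q \near p, solves_dual A M q) -> (\forall q \near p, solves A N q) ->
  (forall i j, {for 0, continuous ((fun q => M q i j) \o chart p)}) ->
  (forall i j, {for 0, continuous ((fun q => N q i j) \o chart p)}) ->
  \forall q \near p, M q *m N q = M p *m N p.
Proof.
move=> sM sN cM cN.
have flat ij : \forall q \near p, (M q *m N q) ij.1 ij.2 = (M p *m N p) ij.1 ij.2.
  apply: (@flat_near_const _ (fun q => (M q *m N q) ij.1 ij.2)); split.
    move: sM sN; apply: filterS2 => -[z|//] dM dN.
    have := mderiveM dM dN.
    by rewrite mulNmx mulmxA addNr => /(_ ij.1 ij.2); rewrite mxE.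
  have -> : (fun q => (M q *m N q) ij.1 ij.2) \o chart p =
     (fun t => \sum_k (M (chart p t) ij.1 k * N (chart p t) k ij.2)).
    by apply/funext => t /=; rewrite mxE.
  apply: continuous0_sum => k.
  exact: (@cvgM C (C : topologicalType) (nbhs (0 : C)) _ _ _ _ _ (cM ij.1 k) (cN k ij.2)).
have all_ij := @filter_forall _ _ (fun ij q => (M q *m N q) ij.1 ij.2 = (M p *m N p) ij.1 ij.2)
  (nbhs p) _ (flat : forall ij : 'I_n * 'I_n, _).
near=> q; apply/matrixP => i j.
have h : forall ij : 'I_n * 'I_n, (M q *m N q) ij.1 ij.2 = (M p *m N p) ij.1 ij.2.
  by near: q; exact: all_ij.
exact: (h (i, j)).
Unshelve. all: by end_near. Qed.

Variable (V : set (CP1 R)).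
Hypothesis openV : open V.
Hypothesis scV : simply_connected R V.
Hypothesis meroA : forall p i j, V p -> analytic_at (A i j) p \/ pole_at (A i j) p.
Hypothesis regA : forall p, V p -> ~ singular A p.

(** The local solutions [F p], normalised at [p], form a local system: by
    [solves_flat] the product [G q *m F p] is constant near [q], where [G q] is the
    inverse of [F q], whence [F p r = F q r *m F p q].  A global frame of this local
    system is the fundamental matrix. *)
Lemma fundamental_matrix x0 : V x0 -> exists Phi Psi : CP1 R -> 'M[C]_n,
  [/\ Phi x0 = 1%:M,
      forall p, V p -> Psi p *m Phi p = 1%:M,
      forall p, V p -> forall i j,
        analytic_at (fun q => Phi q i j) p /\ analytic_at (fun q => Psi q i j) p,
      forall p, V p -> solves A Phi p & forall p, V p -> solves_dual A Psi p].
Proof.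
move=> Vx0.
have /choice[ST hST] : forall p, exists ST : (C -> 'M[C]_n) * (C -> 'M[C]_n), V p ->
  [/\ forall i j, analytic_at0 (fun t => ST.1 t i j) /\ analytic_at0 (fun t => ST.2 t i j),
      ST.1 0 = 1%:M, ST.2 0 = 1%:M,
      \forall q \near p, solves A (fun q => ST.1 (ichart p q)) q
    & \forall q \near p, solves_dual A (fun q => ST.2 (ichart p q)) q].
  move=> p; case: (pselect (V p)) => [Vp|nVp]; last by exists (fun=> 0, fun=> 0).
  have [S [T h]] := local_fundamental (fun i j => meroA i j Vp) (regA Vp).
  by exists (S, T).
pose F p q := (ST p).1 (ichart p q).
pose G p q := (ST p).2 (ichart p q).
have ichart0 p : ichart p p = 0 by rewrite -[X in ichart _ X](chart0 p) chartK.
have Fid p : V p -> F p p = 1%:M by move=> /hST[_ h _ _ _]; rewrite /F ichart0.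
have Gid p : V p -> G p p = 1%:M by move=> /hST[_ _ h _ _]; rewrite /G ichart0.
have chartE p (S : C -> 'M[C]_n) i j :
    (fun q => S (ichart p q) i j) \o chart p = fun t => S t i j.
  by apply/funext => t /=; rewrite chartK.
have cF p i j : V p -> {for 0, continuous ((fun q => F p q i j) \o chart p)}.
  move=> /hST[h _ _ _ _]; rewrite /F chartE.
  by apply: analytic_at0_continuous; have [] := h i j.
have cG p i j : V p -> {for 0, continuous ((fun q => G p q i j) \o chart p)}.
  move=> /hST[h _ _ _ _]; rewrite /G chartE.
  by apply: analytic_at0_continuous; have [] := h i j.
have sF p : V p -> \forall q \near p, solves A (F p) q by move=> /hST[_ _ _ h _].
have sG p : V p -> \forall q \near p, solves_dual A (G p) q by move=> /hST[_ _ _ _ h].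
have GF p : V p -> \forall q \near p, G p q *m F p q = 1%:M.
  move=> Vp; have := solves_flat (sG p Vp) (sF p Vp) (fun i j => cG p i j Vp) (fun i j => cF p i j Vp).
  by rewrite Fid// Gid// mulmx1.
have Funit p : V p -> \forall q \near p, F p q \in unitmx.
  by move=> /GF; apply: filterS => q /mulmx1_unit[].
have finite p : \forall q \near p, q <> p -> exists z, q = Some z.
  have := chart_nbhs p (@ltr01 R); apply: filterS => q [t _ ->] qp.
  apply: chart_finite; apply/eqP => t0; apply: qp; by rewrite t0 chart0.
have Fcomp p : V p -> \forall q \near p, \forall r \near q, F p r = F q r *m F p q.
  move=> Vp; have Vn : \forall q \near p, V q by exact: open_nbhs_nbhs.
  have sFn : \forall q \near p, \forall r \near q, solves A (F p) r.
    exact: nbhs_interior (sF p Vp).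
  move: Vn (finite p) sFn; apply: filterS3 => q Vq fin sFq.
  (* Near infinity, the equation for [F p] says something about [q] only if [q] is
     finite; the case [q = p] is immediate. *)
  case: (pselect (q = p)) => [->|qp].
    by near=> r; rewrite (Fid p Vp) mulmx1.
  have [z ez] := fin qp.
  have cFq i j : {for 0, continuous ((fun r => F p r i j) \o chart q)}.
    have := nbhs_singleton sFq; rewrite ez /= => h; exact: (solves_continuous h).
  have := solves_flat (sG q Vq) sFq (fun i j => cG q i j Vq) cFq.
  move: (GF q Vq); apply: filterS2 => r GF1.
  rewrite Gid// mul1mx => <-.
  by rewrite mulmxA (mulmx1C GF1) mul1mx.
have arcs p N : V p -> nbhs p N -> \forall q \near p, exists g : R -> CP1 R,
    [/\ continuous g, g 0 = p, g 1 = q & forall t : R, 0 <= t <= 1 -> N (g t)].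
  by move=> _; exact: CP1_arcs.
have [Phi [Phi0 uPhi locPhi]] := global_section Fid Funit Fcomp openV scV arcs Vx0.
pose Psi p := invmx (Phi p).
(* The inverse of [Phi] is locally given by the dual solutions, hence analytic. *)
have locPsi p : V p -> \forall q \near p, Psi q = Psi p *m G p q.
  move=> Vp; have Vn : \forall q \near p, V q by exact: open_nbhs_nbhs.
  move: Vn (locPhi p Vp) (GF p Vp); apply: filterS3 => q Vq eq GF1.
  have inv : Psi p *m G p q *m Phi q = 1%:M.
    by rewrite eq !mulmxA -[_ *m G p q *m _]mulmxA GF1 mulmx1 mulVmx// uPhi.
  by rewrite -[LHS]mul1mx -inv mulmxK// uPhi.
have near_Some z (P : CP1 R -> Prop) : (\forall q \near (Some z : CP1 R), P q) ->
    \forall w \near z, P (Some w) by [].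
exists Phi, Psi; split.
- exact: Phi0.
- by move=> p Vp; rewrite mulVmx// uPhi.
- move=> p Vp i j; have [aST _ _ _ _] := hST p Vp; split.
    apply: (@analytic_at0_eq _ (fun t => \sum_(k <- index_enum 'I_n) (ST p).1 t i k * Phi p k j)).
      move: (chart_near (locPhi p Vp)); apply: filterS => t /= ->.
      by rewrite /F chartK mxE.
    apply: analytic_at0_sum => k; apply: analytic_at0M; last exact: analytic_at0_cst.
    by have [] := aST i k.
  apply: (@analytic_at0_eq _ (fun t => \sum_(k <- index_enum 'I_n) Psi p i k * (ST p).2 t k j)).
    move: (chart_near (locPsi p Vp)); apply: filterS => t /= ->.
    by rewrite /G chartK mxE.
  apply: analytic_at0_sum => k; apply: analytic_at0M; first exact: analytic_at0_cst.
  by have [] := aST k j.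
- move=> [z|//] Vz /= i j.
  have := nbhs_singleton (sF _ Vz) => /= dF.
  have := mderiveM dF (mderive_cst (Phi (Some z)) z) i j.
  rewrite mulmx0 addr0 -mulmxA Fid// mul1mx.
  apply: near_eq_is_derive; move: (near_Some _ _ (locPhi _ Vz)); apply: filterS => w ->.
  by [].
- move=> [z|//] Vz /= i j.
  have := nbhs_singleton (sG _ Vz) => /= dG.
  have := mderiveM (mderive_cst (Psi (Some z)) z) dG i j.
  rewrite mul0mx add0r Gid// mul1mx mulmxN.
  apply: near_eq_is_derive; move: (near_Some _ _ (locPsi _ Vz)); apply: filterS => w ->.
  by [].
Unshelve. all: by end_near. Qed.

End FundamentalMatrix.

(** * Unconditional sums and joint power series *)

#[local] Existing Instance totally_filter.

Section Unconditional.
Variable R : realType.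
Local Notation C := (Cplx R).
Variable I : choiceType.
Implicit Types (f : I -> C) (J K : {fset I}).

Lemma partial_sumE f J : partial_sum f J = \sum_(i <- J) f i.
Proof. by rewrite /partial_sum big_seq_fsetE. Qed.

Lemma totally_cvgP f (l : C) : partial_sum f @ totally --> l <->
  forall e : R, 0 < e -> exists J0 : {fset I}, forall J, (J0 `<=` J)%fset -> cn (\sum_(i <- J) f i - l) < e.
Proof.
split=> [/(@cvg_cnP R C) h e e0|h].
  by have [J0 _ hJ0] := h _ e0; exists J0 => J JJ; have := hJ0 J JJ; rewrite /= partial_sumE.
apply/(@cvg_cnP R C) => e e0; have [J0 hJ0] := h _ e0.
by exists J0 => // J JJ /=; rewrite partial_sumE; exact: hJ0.
Qed.

Lemma sum_subset (T : nmodType) (F : I -> T) J0 J : (J0 `<=` J)%fset ->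
  \sum_(i <- J) F i = \sum_(i <- J0) F i + \sum_(i <- J | i \notin J0) F i.
Proof.
move=> J0J; rewrite (bigID (mem J0)) /=; congr (_ + _).
rewrite big_mkcond /= -(big_fset_incl _ J0J); last by move=> i _ /negbTE ->.
by rewrite -big_mkcond /= big_seq_cond [RHS]big_seq_cond; apply: eq_bigl => i; rewrite andbb andbT.
Qed.

(** Sums of terms outside a suitable finite set [J0] are bounded by 2, whatever
    the terms chosen.  Choosing those whose real (or imaginary) part has
    a given sign turns this into a bound on sums of absolute values. *)
Lemma unconditional_absolute f (l : C) : partial_sum f @ totally --> l ->
  exists S : R, forall K, \sum_(i <- K) cn (f i) <= S.
Proof.
move=> /totally_cvgP/(_ _ ltr01)[J0 hJ0].
have T2 K (P : pred I) : cn (\sum_(i <- K | (i \notin J0) && P i) f i) <= 2.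
  pose J := (J0 `|` [fset i in K | (i \notin J0) && P i])%fset.
  have J0J : (J0 `<=` J)%fset by rewrite fsubsetUl.
  have e : \sum_(i <- J | i \notin J0) f i = \sum_(i <- K | (i \notin J0) && P i) f i.
    apply: eq_fbigl_cond => i; rewrite !inE /=.
    by case: (i \in J0); rewrite //= ?andbT ?andbF //.
  have := hJ0 J J0J; have := hJ0 J0 (fsubset_refl J0); rewrite (sum_subset _ J0J) e => h1 h2.
  have -> : \sum_(i <- K | (i \notin J0) && P i) f i =
     (\sum_(i <- J0) f i + \sum_(i <- K | (i \notin J0) && P i) f i - l) - (\sum_(i <- J0) f i - l).
    by rewrite opprB addrA subrK addrAC subrr add0r.
  have := cnD (\sum_(i <- J0) f i + \sum_(i <- K | (i \notin J0) && P i) f i - l) (- (\sum_(i <- J0) f i - l)).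
  by rewrite cnN; lra.
have part (F : C -> R) K : (forall z, `|F z| <= cn z) -> (forall x y, F (x + y) = F x + F y) ->
    F 0 = 0 -> \sum_(i <- K | i \notin J0) `|F (f i)| <= 4.
  move=> fle fD f0.
  have Fsum (P : pred I) : F (\sum_(i <- K | P i) f i) = \sum_(i <- K | P i) F (f i).
    exact: (big_morph F fD f0).
  rewrite (bigID (fun i => 0 <= F (f i))) /=.
  have h1 := T2 K (fun i => 0 <= F (f i)).
  have h2 := T2 K (fun i => ~~ (0 <= F (f i))).
  have e1 : \sum_(i <- K | (i \notin J0) && (0 <= F (f i))) `|F (f i)| =
      F (\sum_(i <- K | (i \notin J0) && (0 <= F (f i))) f i).
    by rewrite Fsum; apply: eq_bigr => i /andP[_ p]; rewrite ger0_norm.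
  have e2 : \sum_(i <- K | (i \notin J0) && ~~ (0 <= F (f i))) `|F (f i)| =
      - F (\sum_(i <- K | (i \notin J0) && ~~ (0 <= F (f i))) f i).
    rewrite Fsum -sumrN; apply: eq_bigr => i /andP[_ p]; rewrite ltr0_norm//.
    by rewrite ltNge.
  rewrite e1 e2.
  have := ler_norm (F (\sum_(i <- K | (i \notin J0) && (0 <= F (f i))) f i)).
  have := ler_norm (- F (\sum_(i <- K | (i \notin J0) && ~~ (0 <= F (f i))) f i)).
  rewrite normrN.
  have := fle (\sum_(i <- K | (i \notin J0) && (0 <= F (f i))) f i).
  have := fle (\sum_(i <- K | (i \notin J0) && ~~ (0 <= F (f i))) f i).
  lra.
(* Two signs for each of the real and imaginary parts, each giving at most 2. *)
exists (\sum_(i <- J0) cn (f i) + 8) => K.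
rewrite (bigID (mem J0)) /=; apply: lerD.
  rewrite [leRHS](bigID (mem K)) /=.
  have -> : \sum_(i <- K | i \in J0) cn (f i) = \sum_(i <- J0 | i \in K) cn (f i).
    by apply: eq_fbigl_cond => i; rewrite !inE /= andbC.
  by rewrite lerDl sumr_ge0// => i _; exact: cn_ge0.
apply: (@le_trans _ _ (\sum_(i <- K | i \notin J0) (`|complex.Re (f i)| + `|complex.Im (f i)|))).
  by apply: ler_sum => i _; exact: cn_ReIm.
rewrite big_split /=.
have h1 := part (@complex.Re R) K (@cn_Re R) (@ReD R) erefl.
have h2 := part (@complex.Im R) K (@cn_Im R) (@ImD R) erefl.
lra.
Qed.

Lemma totally_cvgD f g (l m : C) : partial_sum f @ totally --> l ->
  partial_sum g @ totally --> m -> partial_sum (fun i => f i + g i) @ totally --> (l + m : C).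
Proof.
move=> /totally_cvgP hf /totally_cvgP hg; apply/totally_cvgP => e e0.
have e2 : 0 < e / 2 by lra.
have [J1 h1] := hf _ e2; have [J2 h2] := hg _ e2.
exists (J1 `|` J2)%fset => J; rewrite fsubUset => /andP[/h1 q1 /h2 q2].
rewrite big_split /= opprD addrACA; apply: (le_lt_trans (cnD _ _)).
by rewrite [e]splitr ltrD.
Qed.

Lemma totally_cvg0 : partial_sum (fun i : I => 0 : C) @ totally --> (0 : C).
Proof.
apply/totally_cvgP => e e0; exists fset0 => J _.
by rewrite big1// subrr cn0.
Qed.

End Unconditional.

Section JointNorm.
Variables (R : realType) (n : nat).
Local Notation C := (Cplx R).

Lemma cn_cV (v : 'cV[C]_n) (e : R) : 0 <= e ->
  (cn v <= e) <-> (forall j, cn (v j 0) <= e).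
Proof.
move=> e0; have e0' : 0 <= e%:C%C :> C by rewrite ler0c.
rewrite -cn_le [X in X <= _](_ : _ = mx_norm v)// mx_normE.
rewrite -[e%:C%C]/((NngNum e0')%:num) num_le; split.
  move=> /bigmax_leP[_ h] j; have := h (j, 0) isT.
  by rewrite -num_le /= -cn_le.
move=> h; apply/bigmax_leP; split; first by rewrite -num_le /=.
by move=> [j k] _; rewrite -num_le /= (ord1 k) cn_le.
Qed.

Lemma cn_tot (w : tot R n) (e : R) : 0 <= e ->
  (cn w <= e) <-> (cn w.1 <= e /\ forall j, cn (w.2 j 0) <= e).
Proof.
move=> e0; rewrite -cn_le prod_normE /= !cnE.
rewrite -(cn_cV _ e0) comparable_ge_max; last first.
  by rewrite /Order.comparable !lecR le_total.
by rewrite !lecR; split=> [/andP[]|[-> ->]].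
Qed.

Lemma cn_fst (w : tot R n) : cn w.1 <= cn w.
Proof. by have [/(_ (lexx _))[]] := cn_tot w (cn_ge0 w). Qed.

Lemma cn_snd (w : tot R n) j : cn (w.2 j 0) <= cn w.
Proof. by have [/(_ (lexx _))[]] := cn_tot w (cn_ge0 w). Qed.

End JointNorm.

Section JointSeries.
Variables (R : realType) (n : nat).
Local Notation C := (Cplx R).
Local Notation I := (nat * multinom n)%type.
Implicit Types (km : I) (b : 'cV[C]_n) (w : tot R n).

Definition tdeg km := (km.1 + mdeg km.2)%N.

(** A first order expansion with a quadratic remainder, [L] being the
    differential at [w0]; its bound expresses its continuity. *)
Definition expands (f : tot R n -> C) (w0 : tot R n) (L : tot R n -> C) :=
  (forall (a : C) u v, L (a *: u + v) = a * L u + L v) /\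
  exists K r : R, [/\ 0 < r, forall v, cn (L v) <= K * cn v &
    forall w, cn (w - w0) < r -> cn (f w - f w0 - L (w - w0)) <= K * cn (w - w0) ^+ 2].

Lemma monomial_le b km w (rho : R) : cn (w - ((0, b) : tot R n)) <= rho ->
  cn (monomial b km w) <= rho ^+ tdeg km.
Proof.
move=> h; rewrite /monomial /tdeg exprD cnM cnX mdegE.
have r0 : 0 <= rho := le_trans (cn_ge0 _) h.
have h1 : cn w.1 <= rho.
  by apply: le_trans h; have := cn_fst (w - ((0, b) : tot R n)); rewrite /= subr0.
have h2 j : cn (w.2 j 0 - b j 0) <= rho.
  by apply: le_trans h; have := cn_snd (w - ((0, b) : tot R n)) j; rewrite /= !mxE.
apply: ler_pM; rewrite ?exprn_ge0 ?cn_ge0//.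
  by rewrite lerXn2r ?nnegrE ?cn_ge0.
elim/big_rec2: _ => [|j x y _ IH]; first by rewrite expr0 cn1.
rewrite cnM exprD cnX; apply: ler_pM; rewrite ?exprn_ge0 ?cn_ge0//.
by rewrite lerXn2r ?nnegrE ?cn_ge0.
Qed.

(** At a point on the diagonal through [(0, b)], monomials of the same degree
    take the same value, of the largest possible modulus on the ball whose
    boundary contains that point. *)
Lemma monomial_diag b km (e : R) :
  monomial b km ((e%:C%C, b + const_mx e%:C%C) : tot R n) = (e%:C%C : C) ^+ tdeg km.
Proof.
rewrite /monomial /tdeg exprD mdegE; congr (_ * _).
rewrite (eq_bigr (fun j => (e%:C%C : C) ^+ km.2 j)).
  by elim/big_rec2: _ => [|j x y _ ->]; rewrite ?expr0 ?exprD.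
by move=> j _; rewrite !mxE [b j 0 + _]addrC addrK.
Qed.

Lemma monomial0 b km w : tdeg km = 0%N -> monomial b km w = 1.
Proof.
move/eqP; rewrite addn_eq0 mdeg_eq0 => /andP[/eqP k0 /eqP m0].
rewrite /monomial k0 m0 expr0 mul1r big1// => j _.
by rewrite mnm0E expr0.
Qed.

Lemma monomial1 km : tdeg km = 1%N ->
  (forall b w, monomial b km w = w.1) \/ exists j, forall b w, monomial b km w = w.2 j 0 - b j 0.
Proof.
rewrite /tdeg; case: km => -[|[|k]] m //= hm.
  right; have /eqP/mdeg1P[j /eqP mj] := hm; exists j => b w.
  rewrite /monomial /= expr0 mul1r mj (bigD1 j)//= mnm1E eqxx expr1.
  rewrite big1 ?mulr1// => k kj; by rewrite mnm1E eq_sym (negbTE kj) expr0.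
left=> b w; rewrite /monomial /= expr1.
move: hm => [/eqP]; rewrite mdeg_eq0 => /eqP ->.
by rewrite big1 ?mulr1// => j _; rewrite mnm0E expr0.
Qed.

(** The series converges absolutely at a diagonal point at distance [e] from
    [(0, b)].  At a point at distance [rho < e], a term of degree at least 2 is
    at most [(rho / e) ^ 2] times the term at the diagonal point, and the terms
    of degree at most 1 add up to an affine function. *)
Lemma joint_series_expands (f : tot R n -> C) b (c : I -> C) :
  (\forall w \near ((0, b) : tot R n),
     partial_sum (fun km => c km * monomial b km w) @ totally --> f w) ->
  exists L, expands f (0, b) L.
Proof.
move=> /(@nbhs_cnP R (tot R n))[r r0 hr].
pose e := r / 2; have e0 : 0 < e by rewrite /e; lra.
pose we : tot R n := (e%:C%C, b + const_mx e%:C%C).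
have we_r : cn (we - ((0, b) : tot R n)) < r.
  apply: (@le_lt_trans _ _ e); last by rewrite /e; lra.
  apply/cn_tot; first exact: ltW.
  split; first by rewrite /= subr0 cn_real gtr0_norm.
  by move=> j; rewrite /= !mxE [b j 0 + _]addrC addrK cn_real gtr0_norm.
have [S hS] := unconditional_absolute (hr _ we_r).
(* The exponents of degree at most 1. *)
pose low : seq I := [:: (0%N, mnm0), (1%N, mnm0) & [seq (0%N, mnm1 j) | j <- enum 'I_n]].
have lowP km : (tdeg km < 2)%N -> km \in low.
  case: km => -[|[|k]] m; rewrite /tdeg //= ?add0n ?add1n !ltnS.
    rewrite leq_eqVlt ltnS leqn0 mdeg_eq0 => /orP[/mdeg1P[j /eqP ->]|/eqP ->].
      by rewrite /low !in_cons map_f ?mem_enum ?orbT.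
    by rewrite /low in_cons eqxx.
  by rewrite leqn0 mdeg_eq0 => /eqP ->; rewrite /low !in_cons eqxx orbT.
pose J0 : {fset I} := [fset km in low | (tdeg km < 2)%N]%fset.
have J0P km : (km \in J0) = (tdeg km < 2)%N.
  rewrite /J0 inE; apply/andP/idP => [[]//|h]; split=> //; exact: lowP.
pose P w := \sum_(km <- J0) c km * monomial b km w.
have S0 : 0 <= S.
  by have := hS fset0; apply: le_trans; apply: sumr_ge0 => *; exact: cn_ge0.
have rem w (rho : R) : rho = cn (w - ((0, b) : tot R n)) -> rho < e ->
    cn (f w - P w) <= S / e ^+ 2 * rho ^+ 2.
  move=> er re; have wr : cn (w - ((0, b) : tot R n)) < r by rewrite -er /e in re *; lra.
  have rho0 : 0 <= rho by rewrite er cn_ge0.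
  have /totally_cvgP hw := hr _ wr.
  apply/ler_addgt0Pr => d d0; have [J1 hJ1] := hw _ d0.
  have := hJ1 (J0 `|` J1)%fset (fsubsetUr _ _).
  rewrite (sum_subset _ (fsubsetUl _ _)) -/(P w) => h.
  set T := \sum_(i <- _ | _) _ in h.
  have -> : f w - P w = T - (P w + T - f w) by ring.
  apply: (le_trans (cnD _ _)); rewrite cnN; apply: lerD; last exact: ltW.
  apply: (le_trans (cn_sum _ _ _)).
  apply: (@le_trans _ _ (\sum_(km <- (J0 `|` J1)%fset) (rho / e) ^+ 2 * cn (c km * monomial b km we))); last first.
    have -> : S / e ^+ 2 * rho ^+ 2 = (rho / e) ^+ 2 * S by field; rewrite gt_eqF.
    rewrite -mulr_sumr; apply: ler_wpM2l; last exact: hS.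
    by rewrite exprn_ge0// divr_ge0// ltW.
  rewrite [leRHS](bigID (mem J0)) /= ler_wpDl ?sumr_ge0//.
    by move=> i _; rewrite mulr_ge0 ?cn_ge0// exprn_ge0 ?divr_ge0// ltW.
  apply: ler_sum => km; rewrite J0P -leqNgt => deg2.
  rewrite [cn (c km * monomial b km w)]cnM [cn (c km * monomial b km we)]cnM.
  rewrite mulrCA ler_wpM2l ?cn_ge0// monomial_diag cnX cn_real gtr0_norm//.
  apply: (@le_trans _ _ (rho ^+ tdeg km)); first by apply: monomial_le; rewrite er.
  rewrite -(subnKC deg2) !exprD expr_div_n mulrA divfK; last by rewrite expf_neq0 ?gt_eqF.
  by apply: ler_wpM2l; [exact: exprn_ge0 | rewrite lerXn2r ?nnegrE// ltW].
pose L v := \sum_(km <- J0 | tdeg km == 1%N) c km * monomial 0 km v.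
have Pw0 : f (0, b) = P (0, b).
  have h := rem (0, b) 0; rewrite subrr cn0 expr0n mulr0 in h.
  apply/eqP; rewrite -subr_eq0 -cn_eq0; apply/eqP/le_anti.
  by rewrite h// cn_ge0.
have PL w : P w - P (0, b) = L (w - (0, b)).
  rewrite /P /L -sumrB big_mkcond /= [RHS]big_mkcond /= big_seq [RHS]big_seq.
  apply: eq_bigr => km; rewrite J0P ltnS leq_eqVlt ltnS leqn0 => /orP[d1|d0].
    rewrite d1 -mulrBr; congr (_ * _).
    have [h|[j h]] := monomial1 (eqP d1); rewrite !h //=.
    by rewrite subrr subr0 !mxE subr0.
  by rewrite (eqP d0) /= !monomial0 ?subrr//; exact/eqP.
exists L; split.
  move=> a u v; rewrite /L mulr_sumr -big_split /=; apply: eq_bigr => km /eqP d1.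
  have [h|[j h]] := monomial1 d1; rewrite !h.
    by rewrite -[(a *: u + v).1]/(a * u.1 + v.1); ring.
  by rewrite -[(a *: u + v).2]/(a *: u.2 + v.2) !mxE; ring.
have q0 : 0 <= S / e ^+ 2 by rewrite divr_ge0// exprn_ge0// ltW.
exists (\sum_(km <- J0 | tdeg km == 1%N) cn (c km) + S / e ^+ 2), e; split=> //.
  move=> v; rewrite mulrDl ler_wpDr//.
    by rewrite mulr_ge0 ?cn_ge0.
  rewrite /L mulr_suml; apply: (le_trans (cn_sum _ _ _)); apply: ler_sum => km /eqP d1.
  rewrite cnM ler_wpM2l ?cn_ge0//.
  have [h|[j h]] := monomial1 d1; rewrite !h; first exact: cn_fst.
  by rewrite mxE subr0; exact: cn_snd.
move=> w we'; rewrite Pw0 -PL opprB addrA subrK.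
apply: (le_trans (rem _ _ erefl we')); rewrite ler_wpM2r ?exprn_ge0 ?cn_ge0// lerDr.
by apply: sumr_ge0 => *; exact: cn_ge0.
Qed.

End JointSeries.

(** * Polynomials in y with analytic coefficients *)

Section PolynomialInY.
Variables (R : realType) (n : nat).
Local Notation C := (Cplx R).
Local Notation I := (nat * multinom n)%type.
Implicit Types (b y : 'cV[C]_n) (t : C).

Definition joint_analytic b (f : tot R n -> C) := exists c : I -> C,
  \forall w \near ((0, b) : tot R n),
    partial_sum (fun km => c km * monomial b km w) @ totally --> f w.

Lemma joint_analyticD b f g : joint_analytic b f -> joint_analytic b g ->
  joint_analytic b (fun w => f w + g w).
Proof.
move=> [c hc] [d hd]; exists (fun km => c km + d km).
move: hc hd; apply: filterS2 => w fw gw.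
have -> : (fun km => (c km + d km) * monomial b km w) =
    (fun km => c km * monomial b km w + d km * monomial b km w).
  by apply/funext => km; rewrite mulrDl.
exact: (totally_cvgD fw gw).
Qed.

Lemma joint_analytic0 b : joint_analytic b (fun=> 0).
Proof.
exists (fun=> 0); near=> w.
have -> : (fun km => 0 * monomial b km w) = (fun=> 0) by apply/funext => km; rewrite mul0r.
exact: totally_cvg0.
Unshelve. all: by end_near. Qed.

Lemma uniq_sum_le (g : nat -> R) (N : nat) (ks : seq nat) : (forall k, 0 <= g k) ->
  uniq ks -> (forall k, k \in ks -> (N <= k)%N) ->
  exists N', \sum_(k <- ks) g k <= \sum_(N <= k < N') g k.
Proof.
move=> g0 uks Nks; exists (\max_(k <- ks) k.+1)%N.
have ksN k : k \in ks -> (k < \max_(k <- ks) k.+1)%N.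
  by move=> kks; apply: (@leq_bigmax_seq _ _ xpredT (fun k => k.+1)).
have -> : \sum_(k <- ks) g k = \sum_(k <- index_iota N (\max_(k <- ks) k.+1) | k \in ks) g k.
  rewrite -[RHS]big_filter; apply: perm_big; apply: uniq_perm => //.
    by rewrite filter_uniq// iota_uniq.
  move=> k; rewrite mem_filter mem_index_iota; case kks : (k \in ks) => //=.
  by rewrite Nks// ksN.
by rewrite [leRHS](bigID (mem ks)) /= lerDl sumr_ge0.
Qed.

(** To the sum over the exponents [(k, m)] with [k < N], a larger finite set of
    exponents only adds terms of the tail of a geometric series. *)
Lemma joint_analytic_term b (u : C -> C) (m : multinom n) : analytic_at0 u ->
  joint_analytic b (fun w => u w.1 * \prod_(j < n) (w.2 j 0 - b j 0) ^+ m j).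
Proof.
move=> /analytic_at0P[a [M [r r0 [aM hu]]]].
exists (fun km => if km.2 == m then a km.1 else 0).
have M0 := pbound_ge0 aM.
have near1 : \forall t \near (0 : C), u t = psum a t /\ 2 * r * cn t <= 1.
  by move: hu (near0_small (2 * r)); apply: filterS2.
have near2 : \forall w \near ((0, b) : tot R n), u w.1 = psum a w.1 /\ 2 * r * cn w.1 <= 1.
  move: near1 => /(@nbhs_cnP R C)[d d0 hd]; apply/(@nbhs_cnP R (tot R n)); exists d => // w wd.
  by apply: hd; apply: le_lt_trans wd; have := cn_fst (w - ((0, b) : tot R n)).
move: near2; apply: filterS => -[t y] /= [-> rt].
set z : C := \prod_(j < n) (y j 0 - b j 0) ^+ m j.
have rt' : r * cn t <= 2^-1 by lra.
have ha := pterm_half (ltW r0) aM rt'.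
have cva := cvg_psum (ltW r0) aM rt'.
apply/totally_cvgP => e e0.
(* Adding 1 keeps the denominator away from 0 when [z = 0]. *)
pose e1 := e / (2 * (cn z + 1)).
have z0 := cn_ge0 z.
have e10 : 0 < e1 by rewrite divr_gt0//; lra.
have [N1 _ hN1] := (@cvg_cnP R C _ _ _ _ _).1 cva _ e10.
have cvg2 : (2 * M * (2^-1) ^+ N) @[N --> \oo] --> (0 : R).
  by apply: cvg_geometric; rewrite ger0_norm; lra.
have [N2 _ hN2] := (@cvgrPdist_lt _ _ _ _ _ _ _).1 cvg2 _ e10.
pose N := maxn N1 N2.
have q1 := hN1 N (leq_maxl _ _).
have q2 : 2 * M * (2^-1) ^+ N < e1.
  have := hN2 N (leq_maxr _ _); rewrite /= sub0r normrN; apply: le_lt_trans; exact: ler_norm.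
pose J0 : {fset I} := [fset km in [seq (k, m) | k <- iota 0 N]]%fset.
exists J0 => J J0J.
have eJ0 : \sum_(km <- J0) (if km.2 == m then a km.1 else 0) * monomial b km (t, y) =
    series (pterm a t) N * z.
  rewrite (perm_big [seq (k, m) | k <- iota 0 N]); last first.
    apply: uniq_perm; first exact: fset_uniq.
      by rewrite map_inj_uniq ?iota_uniq// => k l [].
    by move=> km; rewrite /J0 inE.
  rewrite big_map /series /= mulr_suml /index_iota subn0; apply: eq_bigr => k _.
  by rewrite /= eqxx /monomial /pterm /= mulrA.
rewrite (sum_subset _ J0J) eJ0.
set T := \sum_(km <- J | _) _.
have Tle : cn T <= 2 * M * (2^-1) ^+ N * cn z.
  (* The powers of [t] of the terms that are added; they are distinct and at
     least [N]. *)
  pose ks := [seq km.1 | km <- J & (km \notin J0) && (km.2 == m)].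
  have -> : T = \sum_(k <- ks) pterm a t k * z.
    rewrite /ks big_map big_filter /T big_mkcond [RHS]big_mkcond /=; apply: eq_bigr => km _.
    case: ifP => // _ /=; case: eqP => [e2|_]; last by rewrite mul0r.
    by rewrite /monomial /pterm /= e2 mulrA.
  have uks : uniq ks.
    rewrite map_inj_in_uniq ?filter_uniq ?fset_uniq// => -[k l] [k' l'].
    by rewrite !mem_filter /= => /andP[/andP[_ /eqP ->] _] /andP[/andP[_ /eqP ->] _] ->.
  have Nks k : k \in ks -> (N <= k)%N.
    move=> /mapP[[k' l]]; rewrite mem_filter /= => /andP[/andP[kJ0 /eqP lm] _] ->.
    rewrite leqNgt; apply: contra kJ0 => kN; rewrite /J0 inE /= lm.
    by apply/mapP; exists k' => //; rewrite mem_iota.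
  have g0 k : 0 <= M * (2^-1 : R) ^+ k by rewrite mulr_ge0// exprn_ge0.
  have [N' hN'] := uniq_sum_le g0 uks Nks.
  apply: (le_trans (cn_sum _ _ _)).
  apply: (@le_trans _ _ (\sum_(k <- ks) M * (2^-1 : R) ^+ k * cn z)).
    by apply: ler_sum => k _; rewrite cnM ler_wpM2r.
  rewrite -mulr_suml ler_wpM2r//; apply: (le_trans hN').
  have [NN'|NN'] := leqP N N'; last by rewrite big_geq ?mulr_ge0 ?exprn_ge0// ltnW.
  suff : \sum_(N <= k < N') M * (2^-1 : R) ^+ k <= 2 * M * 2^-1 ^+ N - 2 * M * 2^-1 ^+ N'.
    have p0 : 0 <= 2 * M * (2^-1 : R) ^+ N' by rewrite !mulr_ge0 ?exprn_ge0.
    by lra.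
  elim: N' NN' {hN'} => [|N' IH]; first by rewrite leqn0 => /eqP ->; rewrite big_geq// subrr.
  rewrite leq_eqVlt => /orP[/eqP <-|]; first by rewrite big_geq// subrr.
  rewrite ltnS => NN'; rewrite big_nat_recr//= exprS; have := IH NN'; lra.
have -> : series (pterm a t) N * z + T - psum a t * z =
   (series (pterm a t) N - psum a t) * z + T by ring.
apply: (le_lt_trans (cnD _ _)); rewrite cnM.
have e1z : 2 * (e1 * cn z) < e.
  have -> : 2 * (e1 * cn z) = e * (cn z / (cn z + 1)) by rewrite /e1; field; lra.
  rewrite -[X in _ < X]mulr1 ltr_pM2l// ltr_pdivrMr; lra.
have := ler_wpM2r z0 (ltW q1); have := ler_wpM2r z0 (ltW q2); lra.
Qed.

(** Finite sums of products are closed under multiplication for a purely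
    algebraic reason, whereas multiplying joint power series would require
    Cauchy products in several variables. *)
Definition polyan b (f : C -> 'cV[C]_n -> C) :=
  exists (T : finType) (u : T -> C -> C) (m : T -> multinom n),
    (forall x, analytic_at0 (u x)) /\
    forall t y, f t y = \sum_x u x t * \prod_(j < n) (y j 0 - b j 0) ^+ m x j.

Lemma polyan_joint b f : polyan b f -> joint_analytic b (fun w => f w.1 w.2).
Proof.
move=> [T [u [m [au fE]]]].
have -> : (fun w : tot R n => f w.1 w.2) =
    (fun w => \sum_x u x w.1 * \prod_(j < n) (w.2 j 0 - b j 0) ^+ m x j).
  by apply/funext => w; rewrite fE.
elim: (index_enum T) => [|x s IH].
  by under eq_fun do rewrite big_nil; exact: joint_analytic0.
have -> : (fun w : tot R n => \sum_(x <- x :: s) u x w.1 * \prod_(j < n) (w.2 j 0 - b j 0) ^+ m x j) =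
  (fun w => u x w.1 * \prod_(j < n) (w.2 j 0 - b j 0) ^+ m x j +
     \sum_(x <- s) u x w.1 * \prod_(j < n) (w.2 j 0 - b j 0) ^+ m x j).
  by apply/funext => w; rewrite big_cons.
exact: joint_analyticD (joint_analytic_term _ _ (au x)) IH.
Qed.

Lemma polyan_fun b u : analytic_at0 u -> polyan b (fun t _ => u t).
Proof.
move=> au; exists unit, (fun=> u), (fun=> mnm0); split=> // t y.
rewrite (big_pred1 tt); last by case.
rewrite big1 ?mulr1// => j _.
by rewrite mnm0E expr0.
Qed.

Lemma polyanD b f g : polyan b f -> polyan b g -> polyan b (fun t y => f t y + g t y).
Proof.
move=> [T [u [m [au fE]]]] [T' [u' [m' [au' gE]]]].
exists (T + T')%type, (fun x => match x with inl x => u x | inr x => u' x end),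
  (fun x => match x with inl x => m x | inr x => m' x end).
split; first by case.
by move=> t y; rewrite fE gE big_sumType.
Qed.

Lemma polyanM b f g : polyan b f -> polyan b g -> polyan b (fun t y => f t y * g t y).
Proof.
move=> [T [u [m [au fE]]]] [T' [u' [m' [au' gE]]]].
exists (T * T')%type, (fun x t => u x.1 t * u' x.2 t), (fun x => mnm_add (m x.1) (m' x.2)).
split; first by move=> x; exact: analytic_at0M.
move=> t y; rewrite fE gE mulr_suml -(pair_bigA _ (fun x x' => u x t * u' x' t *
  \prod_(j < n) (y j 0 - b j 0) ^+ mnm_add (m x) (m' x') j)) /=.
apply: eq_bigr => x _; rewrite mulr_sumr; apply: eq_bigr => x' _.
rewrite mulrACA -big_split /=; congr (_ * _); apply: eq_bigr => j _.
by rewrite mnmDE exprD.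
Qed.

Lemma polyan_coord b j : polyan b (fun _ y => y j 0).
Proof.
have h : polyan b (fun _ y => y j 0 - b j 0).
  exists unit, (fun=> fun=> 1), (fun=> mnm1 j); split; first by move=> _; exact: analytic_at0_cst.
  move=> t y; rewrite (big_pred1 tt); last by case.
  rewrite mul1r (bigD1 j)//= mnm1E eqxx expr1 big1 ?mulr1// => k kj.
  by rewrite mnm1E eq_sym (negbTE kj) expr0.
have := polyanD h (polyan_fun b (analytic_at0_cst (b j 0))).
by congr (polyan b _); apply/funext => t; apply/funext => y; rewrite subrK.
Qed.

Lemma polyan_sum b (J : Type) (s : seq J) (f : J -> C -> 'cV[C]_n -> C) :
  (forall i, polyan b (f i)) -> polyan b (fun t y => \sum_(i <- s) f i t y).
Proof.
move=> hf; elim: s => [|i s IH].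
  have := polyan_fun b (analytic_at0_cst (0 : C)).
  by congr (polyan b _); apply/funext => t; apply/funext => y; rewrite big_nil.
have := polyanD (hf i) IH.
by congr (polyan b _); apply/funext => t; apply/funext => y; rewrite big_cons.
Qed.

Lemma polyan_prod b (J : Type) (s : seq J) (f : J -> C -> 'cV[C]_n -> C) :
  (forall i, polyan b (f i)) -> polyan b (fun t y => \prod_(i <- s) f i t y).
Proof.
move=> hf; elim: s => [|i s IH].
  have := polyan_fun b (analytic_at0_cst (1 : C)).
  by congr (polyan b _); apply/funext => t; apply/funext => y; rewrite big_nil.
have := polyanM (hf i) IH.
by congr (polyan b _); apply/funext => t; apply/funext => y; rewrite big_cons.
Qed.

Lemma polyanX b k f : polyan b f -> polyan b (fun t y => f t y ^+ k).
Proof.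
move=> hf; elim: k => [|k IH].
  have := polyan_fun b (analytic_at0_cst (1 : C)).
  by congr (polyan b _); apply/funext => t; apply/funext => y; rewrite expr0.
have := polyanM hf IH.
by congr (polyan b _); apply/funext => t; apply/funext => y; rewrite exprS.
Qed.

Lemma polyan_meval b (P : mpoly n C) (f : 'I_n -> C -> 'cV[C]_n -> C) :
  (forall j, polyan b (f j)) -> polyan b (fun t y => meval (fun j => f j t y) P).
Proof.
move=> hf.
have hm m : polyan b (fun t y => mcoeff m P * \prod_i f i t y ^+ m i).
  apply: polyanM; first exact: (polyan_fun b (analytic_at0_cst _)).
  by apply: polyan_prod => i; exact: polyanX.
have [T [u [m [au fE]]]] := polyan_sum (msupp P) hm.
by exists T, u, m; split.
Qed.

End PolynomialInY.

(** * Polynomial vector fields *)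

Section PolynomialFields.
Variables (K : numFieldType) (n : nat).
Local Notation field := {ffun 'I_n -> mpoly n K}.
Implicit Types (P Q S : field) (F G : mpoly n K).

(** The formal partial derivatives compute the derivative at [y] along [v]. *)
Definition line_derivable F := forall (y v : 'I_n -> K),
  is_derive (0 : K) (1 : K) (fun h => meval (fun j => y j + h * v j) F)
    (\sum_j v j * meval y (mderiv j F)).

Lemma line_derivableD F G : line_derivable F -> line_derivable G -> line_derivable (F + G).
Proof.
move=> dF dG y v.
have -> : (fun h => meval (fun j => y j + h * v j) (F + G)) =
  (fun h => meval (fun j => y j + h * v j) F) + (fun h => meval (fun j => y j + h * v j) G).
  by apply/funext => h; rewrite mevalD.
have -> : \sum_j v j * meval y (mderiv j (F + G)) =
   \sum_j v j * meval y (mderiv j F) + \sum_j v j * meval y (mderiv j G).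
  by rewrite -big_split /=; apply: eq_bigr => j _; rewrite mderivD mevalD mulrDr.
exact: (is_deriveD (dF y v) (dG y v)).
Qed.

Lemma line_derivableM F G : line_derivable F -> line_derivable G -> line_derivable (F * G).
Proof.
move=> dF dG y v.
have -> : (fun h => meval (fun j => y j + h * v j) (F * G)) =
  (fun h => meval (fun j => y j + h * v j) F) \* (fun h => meval (fun j => y j + h * v j) G).
  by apply/funext => h; rewrite mevalM.
have y0 H : meval (fun j => y j + 0 * v j) H = meval y H.
  by apply: meval_eq => j; rewrite mul0r addr0.
have := is_deriveM (dF y v) (dG y v); rewrite !y0.
congr (is_derive _ _ _ _).
rewrite /GRing.scale /= !mulr_sumr -big_split /=; apply: eq_bigr => j _.
rewrite mderivM mevalD !mevalM.
move: (meval y F) (meval y G) (meval y (mderiv j F)) (meval y (mderiv j G)) (v j) => a b c d e.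
by ring.
Qed.

Lemma line_derivableC (c : K) : line_derivable (mpolyC n c).
Proof.
move=> y v; rewrite big1; last by move=> j _; rewrite mderivC meval0 mulr0.
have -> : (fun h => meval (fun j => y j + h * v j) (mpolyC n c)) = cst c.
  by apply/funext => h; rewrite mevalC.
exact: is_derive_cst.
Qed.

Lemma line_derivableX i : line_derivable (mpolyX K (mnm1 i)).
Proof.
move=> y v.
have -> : (fun h => meval (fun j => y j + h * v j) (mpolyX K (mnm1 i))) = (fun h => y i + h * v i).
  by apply/funext => h; rewrite mevalXU.
have -> : \sum_j v j * meval y (mderiv j (mpolyX K (mnm1 i))) = v i.
  rewrite (bigD1 i)//= mderivX mnm1E eqxx scale1r.
  have -> : mnm_sub (mnm1 i) (mnm1 i) = mnm0 by apply/mnmP => j; rewrite mnmBE subnn mnm0E.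
  rewrite mpolyX0 meval1 mulr1 big1 ?addr0// => j ji.
  by rewrite mderivX mnm1E eq_sym (negbTE ji) scale0r meval0 mulr0.
have := is_deriveD (is_derive_cst (y i) (0 : K) 1)
  (is_deriveM (is_derive_id (0 : K) 1) (is_derive_cst (v i) (0 : K) 1)).
by congr (is_derive _ _ _ _); rewrite scaler0 !add0r [_ *: _]mulr1.
Qed.

Lemma line_derivable_all F : line_derivable F.
Proof.
have one : line_derivable 1 by rewrite -mpolyC1; exact: line_derivableC.
have exp i k : line_derivable (mpolyX K (mnm1 i) ^+ k).
  elim: k => [|k IH]; first by rewrite expr0; exact: one.
  rewrite exprS; exact: (line_derivableM (line_derivableX i) IH).
have mono m : line_derivable (mpolyX K m).
  rewrite mpolyXE_id; elim: (index_enum 'I_n) => [|i s IH].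
    by rewrite big_nil; exact: one.
  rewrite big_cons; exact: (line_derivableM (exp i (m i)) IH).
elim/mpolyind: F => [|c m p _ _ hp]; first by rewrite -(mpolyC0 n K); exact: line_derivableC.
rewrite -mul_mpolyC.
exact: (line_derivableD (line_derivableM (line_derivableC c) (mono m)) hp).
Qed.

Lemma mnm_neq0 (m : multinom n) : m != mnm0 -> exists i, m i != 0%N.
Proof.
move=> m0; apply: contrapT => h; case/eqP: m0; apply/mnmP => i; rewrite mnm0E.
by apply/eqP/negPn/negP => mi; apply: h; exists i.
Qed.

Lemma meval_at0 F : meval (fun=> 0) F = mcoeff mnm0 F.
Proof.
elim/mpolyind: F => [|c m p _ _ hp]; first by rewrite meval0 mcoeff0.
rewrite mevalD mcoeffD hp mevalZ mcoeffZ mevalX mcoeffX; congr (_ * _ + _).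
case: eqP => [->|/eqP m0]; first by rewrite big1// => i _; rewrite mnm0E expr0.
have [i mi] := mnm_neq0 m0.
by rewrite (bigD1 i)//= expr0n (negbTE mi) mul0r.
Qed.

(** The coefficient of a monomial is, up to a non-zero integer, the constant
    term of an iterated partial derivative, and the partial derivatives of
    a polynomial function that vanishes also vanish. *)
Lemma meval_eq0 F : (forall y, meval y F = 0) -> F = 0.
Proof.
move=> hF; apply/mpolyP => m; rewrite mcoeff0.
move: {2}(mdeg m) (erefl (mdeg m)) => d.
elim: d m F hF => [|d IH] m F hF md.
  by move/eqP: md; rewrite mdeg_eq0 => /eqP ->; rewrite -meval_at0.
have [i mi] : exists i, m i != 0%N by apply: mnm_neq0; rewrite -mdeg_eq0 md.
have mE : mnm_add (mnm_sub m (mnm1 i)) (mnm1 i) = m.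
  apply/mnmP => j; rewrite mnmDE mnmBE mnm1E.
  by case: eqP => [<-|_]; rewrite ?subn0 ?addn0// subnK// lt0n.
have md' : mdeg (mnm_sub m (mnm1 i)) = d.
  by have := mdegD (mnm_sub m (mnm1 i)) (mnm1 i); rewrite mE md mdeg1 addn1 => -[].
have dF y : meval y (mderiv i F) = 0.
  have [_ d0] := line_derivable_all F y (fun j => (j == i)%:R).
  have f0 : (fun h : K => meval (fun j => y j + h * (j == i)%:R) F) = cst 0.
    by apply/funext => h; rewrite hF.
  rewrite f0 derive_cst (bigD1 i)//= eqxx mul1r big1 ?addr0 in d0; last first.
    by move=> j ji; rewrite (negbTE ji) mul0r.
  exact: esym d0.
have := IH _ _ dF md'; rewrite mcoeff_mderiv mE => /eqP.
by rewrite mulrn_eq0 /= => /eqP.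
Qed.

Lemma meval_inj F G : (forall y, meval y F = meval y G) -> F = G.
Proof.
move=> h; apply/eqP; rewrite -subr_eq0; apply/eqP/meval_eq0 => y.
by rewrite mevalB h subrr.
Qed.

(** The derivation of the polynomial ring attached to a vector field. *)
Definition pvder P F : mpoly n K := \sum_(j < n) P j * mderiv j F.

Definition fbracket P Q : field := [ffun i => pvder P (Q i) - pvder Q (P i)].

Lemma fbracketE P Q i : fbracket P Q i = pvder P (Q i) - pvder Q (P i).
Proof. exact: ffunE. Qed.

Lemma pvderB P F G : pvder P (F - G) = pvder P F - pvder P G.
Proof. by rewrite /pvder -sumrB; apply: eq_bigr => j _; rewrite mderivB mulrBr. Qed.

Lemma pvderD P F G : pvder P (F + G) = pvder P F + pvder P G.
Proof. by rewrite /pvder -big_split; apply: eq_bigr => j _; rewrite mderivD mulrDr. Qed.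

Lemma pvderZ P (a : K) F : pvder P (a *: F) = a *: pvder P F.
Proof. by rewrite /pvder scaler_sumr; apply: eq_bigr => j _; rewrite mderivZ scalerAr. Qed.

Lemma pvder_linear (a : K) P Q F : pvder (a *: P + Q) F = a *: pvder P F + pvder Q F.
Proof.
rewrite /pvder scaler_sumr -big_split; apply: eq_bigr => j _ /=.
by rewrite !ffunE mulrDl scalerAl.
Qed.

(** The second order terms cancel because partial derivatives commute. *)
Lemma pvder_comm P Q F :
  pvder P (pvder Q F) - pvder Q (pvder P F) = pvder (fbracket P Q) F.
Proof.
have E P' Q' : pvder P' (pvder Q' F) = \sum_j pvder P' (Q' j) * mderiv j F +
    \sum_j \sum_k P' k * Q' j * mderiv k (mderiv j F).
  rewrite {1}/pvder /pvder; under eq_bigr => k _ do rewrite raddf_sum mulr_sumr.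
  rewrite exchange_big -big_split; apply: eq_bigr => j _ /=.
  rewrite mulr_suml -big_split; apply: eq_bigr => k _ /=.
  by rewrite mderivM mulrDr !mulrA.
rewrite !E opprD addrACA -sumrB.
have -> : \sum_j \sum_k P k * Q j * mderiv k (mderiv j F) = \sum_j \sum_k Q k * P j * mderiv k (mderiv j F).
  rewrite exchange_big; apply: eq_bigr => j _; apply: eq_bigr => k _ /=.
  by rewrite mderiv_comm [P j * _]mulrC.
rewrite subrr addr0; apply: eq_bigr => j _.
by rewrite fbracketE mulrBl.
Qed.

(** The Jacobi identity is that of the commutators of derivations, by
    [pvder_comm]. *)
Lemma field_lie_algebra : lie_algebra [set: field] fbracket.
Proof.
split=> //.
- move=> a u v w _ _ _; apply/ffunP => i.
  by rewrite fbracketE pvder_linear !ffunE pvderD pvderZ scalerBr opprD addrACA.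
- move=> a u v w _ _ _; apply/ffunP => i.
  by rewrite fbracketE pvder_linear !ffunE pvderD pvderZ scalerBr opprD addrACA.
- by move=> u _; apply/ffunP => i; rewrite fbracketE subrr ffunE.
move=> u v w _ _ _; apply/ffunP => i.
rewrite ffunE ffunE [RHS]ffunE !fbracketE -!pvder_comm !pvderB.
by ring.
Qed.

End PolynomialFields.

Lemma pvbracketE (R : realType) (n : nat) (P Q : pvfield R n) :
  pvbracket P Q = fbracket (P : {ffun 'I_n -> mpoly n (Cplx R)}) Q.
Proof. by apply/ffunP => i; rewrite !ffunE sumrB. Qed.

Lemma pv_lie_algebra (R : realType) (n : nat) :
  lie_algebra [set: pvfield R n] (@pvbracket R n).
Proof.
have -> : @pvbracket R n = @fbracket (Cplx R) n.
  by apply/funext => P; apply/funext => Q; exact: pvbracketE.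
exact: field_lie_algebra.
Qed.

(** * First order expansions along curves *)

Section VectorFieldDerivative.
Variables (R : realType) (n : nat).
Local Notation C := (Cplx R).
Local Notation T := (tot R n).

Lemma quotient_le (h a b x : C) (e : R) : h != 0 ->
  cn (a - b - h * x) <= e * cn h -> cn (h^-1 * (a - b) - x) <= e.
Proof.
move=> h0 ab; have h0' : 0 < cn h by rewrite cn_gt0.
have -> : h^-1 * (a - b) - x = h^-1 * (a - b - h * x).
  by rewrite [RHS]mulrBr [h^-1 * (h * x)]mulrA mulVf ?mul1r.
by rewrite cnM cnV mulrC ler_pdivrMr.
Qed.

Lemma derive_tot (W : T -> T) (w v : T) (l : T) :
  is_derive (0 : C) (1 : C) (fun h => (W (h *: v + w)).1) l.1 ->
  (forall j, is_derive (0 : C) (1 : C) (fun h => (W (h *: v + w)).2 j 0) (l.2 j 0)) ->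
  'D_v W w = l.
Proof.
move=> d1 d2.
have cvl : (fun h : C => h^-1 *: (W (h *: v + w) - W w)) @ 0^' --> l.
  apply/(@cvg_cnP R T) => e e0.
  have e20 : 0 < e / 2 by lra.
  have n1 := is_derive_near d1 e20.
  have n2 : \forall h \near (0 : C), forall j : 'I_n,
      cn ((W (h *: v + w)).2 j 0 - (W (0 *: v + w)).2 j 0 - h * l.2 j 0) <= e / 2 * cn h.
    exact: (@filter_forall C _ (fun j h => cn ((W (h *: v + w)).2 j 0 - (W (0 *: v + w)).2 j 0 - h * l.2 j 0) <= e / 2 * cn h)
      (nbhs (0 : C)) _ (fun j => is_derive_near (d2 j) e20)).
  have n12 : \forall h \near (0 : C), h != 0 ->
      cn (h^-1 *: (W (h *: v + w) - W w) - l) < e.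
    move: n1 n2; apply: filterS2 => h; rewrite scale0r add0r => k1 k2 h0.
    apply: (@le_lt_trans _ _ (e / 2)); last lra.
    apply/cn_tot; first exact: ltW.
    split; first exact: (quotient_le h0 k1).
    by move=> j; have := quotient_le h0 (k2 j); rewrite /= !mxE.
  exact: n12.
exact: (cvg_lim (@norm_hausdorff C T) cvl).
Qed.

(** The error is that of the tangent of [g], to which [L] is applied, plus the
    quadratic remainder of [f]; each is kept below [e / 2 * |h|]. *)
Lemma expands_chain (f : T -> C) (w0 v : T) L (g : C -> T) : expands f w0 L ->
  g 0 = w0 ->
  is_derive (0 : C) (1 : C) (fun h => (g h).1) v.1 ->
  (forall j, is_derive (0 : C) (1 : C) (fun h => (g h).2 j 0) (v.2 j 0)) ->
  is_derive (0 : C) (1 : C) (f \o g) (L v).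
Proof.
move=> [Llin [K [r [r0 Lb hr]]]] g0 d1 d2.
have near_g (e : R) : 0 < e -> exists2 d : R, 0 < d & forall h, cn h < d ->
    cn (g h - w0 - h *: v) <= e * cn h.
  move=> e0.
  have n1 := is_derive_near d1 e0.
  have n2 : \forall h \near (0 : C), forall j : 'I_n,
      cn ((g h).2 j 0 - (g 0).2 j 0 - h * v.2 j 0) <= e * cn h.
    exact: (@filter_forall C _ (fun j h => cn ((g h).2 j 0 - (g 0).2 j 0 - h * v.2 j 0) <= e * cn h)
      (nbhs (0 : C)) _ (fun j => is_derive_near (d2 j) e0)).
  have n12 : \forall h \near (0 : C), cn (g h - w0 - h *: v) <= e * cn h.
    move: n1 n2; apply: filterS2 => h; rewrite g0 => k1 k2.
    apply/cn_tot; first by rewrite mulr_ge0 ?cn_ge0// ltW.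
    by split=> // j; rewrite /= !mxE.
  have /(@nbhs_cnP R C)[d d0 hd] := n12.
  by exists d => // h hh; apply: hd; rewrite subr0.
apply: cn_is_derive => e e0.
pose cv : R := cn v + 1; have cv0 : 0 < cv by rewrite /cv ltr_wpDl// cn_ge0.
pose K1 : R := `|K| + 1; have K10 : 0 < K1 by rewrite /K1 ltr_wpDl.
have KK1 : K <= K1 by apply: (le_trans (ler_norm K)); rewrite lerDl.
pose e1 : R := Num.min 1 (e / (2 * K1)).
have e10 : 0 < e1 by rewrite lt_min ltr01 divr_gt0// mulr_gt0.
have e1le : e1 <= 1 by rewrite ge_min lexx.
have e1le' : K1 * e1 <= e / 2.
  have : e1 <= e / (2 * K1) by rewrite ge_min lexx orbT.
  move=> /(ler_wpM2l (ltW K10)) /le_trans; apply.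
  rewrite le_eqVlt; apply/orP; left; apply/eqP; field; lra.
have [d d0 hd] := near_g e1 e10.
(* For such [h], [g h] is close to its tangent, lies in the ball where [f] is
   expanded, and makes the quadratic remainder at most [e / 2 * |h|]. *)
pose d' := Num.min d (Num.min (r / cv) (e / (2 * K1 * cv ^+ 2))).
exists d'.
  by rewrite !lt_min d0 !divr_gt0 ?mulr_gt0 ?exprn_gt0.
move=> h; rewrite !lt_min => /and3P[hd' hr' he'].
have c0 := cn_ge0 (h : C).
have gh := hd h hd'.
have gw : cn (g h - w0) <= cv * cn h.
  have -> : g h - w0 = (g h - w0 - h *: v) + h *: v by rewrite subrK.
  apply: (le_trans (cnD _ _)); rewrite cnZ /cv mulrDl mul1r [cn v * _]mulrC addrC lerD2l.
  apply: (le_trans gh); exact: ler_piMl.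
have gr : cn (g h - w0) < r by apply: (le_lt_trans gw); rewrite mulrC -ltr_pdivlMr.
have Lsub : L (g h - w0) - h * L v = L (g h - w0 - h *: v).
  have := Llin (- h) v (g h - w0); rewrite addrC scaleNr => ->.
  by rewrite mulNr addrC.
rewrite /= add0r g0.
have -> : f (g h) - f w0 - h * L v = (f (g h) - f w0 - L (g h - w0)) + L (g h - w0 - h *: v).
  by rewrite -Lsub addrA subrK.
apply: (le_trans (cnD _ _)).
have b1 : cn (L (g h - w0 - h *: v)) <= e / 2 * cn h.
  apply: (le_trans (Lb _)).
  apply: (@le_trans _ _ (K1 * (e1 * cn h))).
    by apply: (le_trans (ler_wpM2r (cn_ge0 _) KK1)); rewrite ler_wpM2l// ltW.
  by rewrite mulrA ler_wpM2r.
have b2 : cn (f (g h) - f w0 - L (g h - w0)) <= e / 2 * cn h.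
  apply: (le_trans (hr _ gr)).
  apply: (@le_trans _ _ (K1 * (cv * cn h) ^+ 2)).
    apply: (le_trans (ler_wpM2r _ KK1)); first by rewrite exprn_ge0 ?cn_ge0.
    apply: ler_wpM2l; first exact: ltW.
    by rewrite lerXn2r ?nnegrE ?cn_ge0// mulr_ge0// ltW.
  have -> : K1 * (cv * cn h) ^+ 2 = (K1 * cv ^+ 2 * cn h) * cn h by ring.
  rewrite ler_wpM2r//.
  rewrite ltr_pdivlMr in he'; last by rewrite !mulr_gt0 ?exprn_gt0.
  move: he'; move: (cv ^+ 2) (cn h) => q c he'.
  have -> : K1 * q * c = c * (2 * K1 * q) / 2 by field.
  by lra.
by rewrite [e]splitr mulrDl lerD.
Qed.

Lemma expands_continuous (f : T -> C) (w0 : T) L (g : C -> T) : expands f w0 L ->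
  g 0 = w0 -> {for 0, continuous (fun h => (g h).1)} ->
  (forall j, {for 0, continuous (fun h => (g h).2 j 0)}) ->
  {for 0, continuous (f \o g)}.
Proof.
move=> [Llin [K [r [r0 Lb hr]]]] g0 c1 c2.
apply/(@cvg_cnP R C (C : Type) (nbhs (0 : C))) => e e0.
pose K1 : R := `|K| + 1; have K10 : 0 < K1 by rewrite /K1 ltr_wpDl.
have KK1 : K <= K1 by apply: (le_trans (ler_norm K)); rewrite lerDl.
(* Below 1, squares are at most linear; then the linear part and the
   remainder are each at most [K1 * e1 <= e / 3]. *)
pose e1 : R := Num.min (Num.min 1 (r / 2)) (e / (3 * K1)).
have e10 : 0 < e1 by rewrite !lt_min ltr01 !divr_gt0// mulr_gt0.
have n1 : \forall h \near (0 : C), cn ((g h).1 - (g 0).1) < e1.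
  exact: (@cvg_cnP R C _ _ _ _ _).1 c1 _ e10.
have n2 : \forall h \near (0 : C), forall j : 'I_n, cn ((g h).2 j 0 - (g 0).2 j 0) < e1.
  exact: (@filter_forall C _ (fun j h => cn ((g h).2 j 0 - (g 0).2 j 0) < e1)
    (nbhs (0 : C)) _ (fun j => (@cvg_cnP R C _ _ _ _ _).1 (c2 j) _ e10)).
move: n1 n2; apply: filterS2 => h; rewrite g0 => k1 k2.
have gh : cn (g h - w0) <= e1.
  apply/cn_tot; first exact: ltW.
  by split; [exact: ltW | move=> j; have := ltW (k2 j); rewrite /= !mxE].
have e11 : e1 <= 1 by rewrite !ge_min lexx.
have e1r2 : e1 <= r / 2 by rewrite !ge_min lexx !orbT.
have e1r : e1 < r by lra.
have e1e : 3 * (K1 * e1) <= e.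
  have : e1 <= e / (3 * K1) by rewrite !ge_min lexx !orbT.
  by rewrite ler_pdivlMr ?mulr_gt0//; lra.
rewrite /= g0.
have -> : f (g h) - f w0 = (f (g h) - f w0 - L (g h - w0)) + L (g h - w0) by rewrite subrK.
apply: (le_lt_trans (cnD _ _)).
have b1 : cn (L (g h - w0)) <= K1 * e1.
  by apply: (le_trans (Lb _)); apply: (le_trans (ler_wpM2r (cn_ge0 _) KK1)); rewrite ler_wpM2l// ltW.
have b2 : cn (f (g h) - f w0 - L (g h - w0)) <= K1 * e1.
  apply: (le_trans (hr _ (le_lt_trans gh e1r))).
  apply: (le_trans (ler_wpM2r _ KK1)); first by rewrite exprn_ge0 ?cn_ge0.
  apply: ler_wpM2l; first exact: ltW.
  by have := ler_pM (cn_ge0 _) (cn_ge0 _) gh (le_trans gh e11); rewrite mulr1 expr2.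
have K1e : 0 < K1 * e1 by rewrite mulr_gt0.
lra.
Qed.

End VectorFieldDerivative.

(** * Transport of vector fields by the flow *)

Section LinearSubstitution.
Variables (K : numFieldType) (n : nat).
Implicit Types (F : mpoly n K) (q : 'I_n -> mpoly n K).

Definition subst_mpoly q F : mpoly n K :=
  \sum_(m <- msupp F) mcoeff m F *: \prod_(j <- index_enum 'I_n) q j ^+ m j.

Lemma meval_subst q F v : meval v (subst_mpoly q F) = meval (fun j => meval v (q j)) F.
Proof.
rewrite /subst_mpoly raddf_sum mevalE; apply: eq_bigr => m _ /=.
rewrite mevalZ rmorph_prod /=; congr (_ * _); apply: eq_bigr => j _.
by rewrite rmorphXn.
Qed.

(** The bound is uniform in [q], because the linear forms to be substituted are
    the entries of [Psi(x) y] and vary with [x]. *)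
Lemma msize_subst F : exists d, forall q, (forall j, (msize (q j) <= 2)%N) ->
  (msize (subst_mpoly q F) <= d)%N.
Proof.
have powB k : exists d, forall p : mpoly n K, (msize p <= 2)%N -> (msize (p ^+ k) <= d)%N.
  elim: k => [|k [d hd]]; first by exists 1%N => p _; rewrite expr0 msize1.
  exists (2 + d).+1 => p hp; rewrite exprS; apply: (leq_trans (msizeM_le _ _)).
  by rewrite ltnS leq_add// hd.
have prodB (m : multinom n) (s : seq 'I_n) : exists d, forall q, (forall j, (msize (q j) <= 2)%N) ->
    (msize (\prod_(j <- s) q j ^+ m j)%R <= d)%N.
  elim: s => [|i s [d hd]]; first by exists 1%N => q _; rewrite big_nil msize1.
  have [e he] := powB (m i); exists (e + d).+1 => q hq; rewrite big_cons.
  apply: (leq_trans (msizeM_le _ _)); rewrite ltnS leq_add//; [exact: he | exact: hd].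
rewrite /subst_mpoly; elim: (msupp F) => [|m s [d hd]].
  by exists 0%N => q _; rewrite big_nil mmeasure0.
have [e he] := prodB m (index_enum 'I_n).
exists (maxn e d) => q hq; rewrite big_cons; apply: (leq_trans (msizeD_le _ _)).
rewrite geq_max !leq_max hd// orbT andbT; apply/orP; left.
exact: leq_trans (msizeZ_le _ _) (he _ hq).
Qed.

(** The field [v |-> M P(N v)]. *)
Definition conj_field (M N : 'M[K]_n) (P : {ffun 'I_n -> mpoly n K}) : {ffun 'I_n -> mpoly n K} :=
  [ffun i => \sum_k M i k *:
    subst_mpoly (fun j => \sum_l N j l *: mpolyX K (mnm1 l)) (P k)].

Lemma meval_conj M N P v i : meval v (conj_field M N P i) =
  \sum_k M i k * meval (fun j => \sum_l N j l * v l) (P k).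
Proof.
rewrite ffunE raddf_sum; apply: eq_bigr => k _ /=; rewrite mevalZ meval_subst.
congr (_ * _); apply: meval_eq => j; rewrite raddf_sum; apply: eq_bigr => l _ /=.
by rewrite mevalZ mevalXU.
Qed.

Lemma msize_lin (s : seq 'I_n) (a : 'I_n -> K) :
  (msize (\sum_(l <- s) a l *: mpolyX K (mnm1 l))%R <= 2)%N.
Proof.
elim: s => [|l s IH]; first by rewrite big_nil mmeasure0.
rewrite big_cons; apply: (leq_trans (msizeD_le _ _)); rewrite geq_max IH andbT.
by apply: (leq_trans (msizeZ_le _ _)); rewrite msizeX mdeg1.
Qed.

Lemma msize_conj P : exists d, forall M N i, (msize (conj_field M N P i) <= d)%N.
Proof.
have /choice[d hd] : forall k, exists d, forall q, (forall j, (msize (q j) <= 2)%N) ->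
  (msize (subst_mpoly q (P k)) <= d)%N by move=> k; exact: msize_subst.
exists (\max_k d k)%N => M N i; rewrite ffunE.
have key (s : seq 'I_n) : (msize (\sum_(k <- s) M i k *:
    subst_mpoly (fun j => \sum_l N j l *: mpolyX K (mnm1 l)) (P k))%R <= \max_k d k)%N.
  elim: s => [|k s IH]; first by rewrite big_nil mmeasure0.
  rewrite big_cons; apply: (leq_trans (msizeD_le _ _)); rewrite geq_max IH andbT.
  apply: (leq_trans (msizeZ_le _ _)); apply: leq_trans (leq_bigmax k).
  by apply: hd => j; exact: msize_lin.
exact: key.
Qed.

End LinearSubstitution.

Section Transport.
Variables (R : realType) (n : nat).
Local Notation C := (Cplx R).
Local Notation T := (tot R n).
Implicit Types (P Q : pvfield R n) (y c : 'cV[C]_n) (p q : CP1 R) (Y Z : vfield R n).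

Definition pfun P y : 'cV[C]_n := \col_i meval (fun j => y j 0) (P i).

Lemma is_pvfieldP (F : 'cV[C]_n -> 'cV[C]_n) P : is_pvfield F P <-> F = pfun P.
Proof.
split=> [h|-> y i]; last by rewrite mxE.
by apply/funext => y; apply/matrixP => i j; rewrite (ord1 j) mxE h.
Qed.

Lemma pfun_inj P Q : pfun P = pfun Q -> P = Q.
Proof.
move=> h; apply/ffunP => i; apply: meval_inj => v.
have := congr1 (fun F : 'cV[C]_n -> 'cV[C]_n => F (\col_j v j) i 0) h.
rewrite !mxE => h'.
have e (F : mpoly n C) : meval (fun j => (\col_j v j) j 0) F = meval v F.
  by apply: meval_eq => j; rewrite mxE.
by rewrite -(e (P i)) -(e (Q i)).
Qed.

Lemma pfun_lin (a : C) P Q y : pfun (a *: P + Q) y = a *: pfun P y + pfun Q y.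
Proof.
by apply/matrixP => i j; rewrite !mxE !ffunE mevalD mevalZ.
Qed.

(** Transport of [P], a field on the fibre over [x0], to all the fibres by the
    flow.  It vanishes off [V], as fields on [V] are required to. *)
Definition push (Phi Psi : CP1 R -> 'M[C]_n) (V : set (CP1 R)) P : vfield R n :=
  fun p y => if `[< V p >] then Phi p *m pfun P (Psi p *m y) else 0.

Lemma is_derive_affine (a b : C) : is_derive (0 : C) (1 : C) (fun h : C => h * a + b) a.
Proof.
apply: (@quad_is_derive _ _ _ _ 0 1) => // h _.
have -> : (0 + h) * a + b - (0 * a + b) - h * a = 0 by ring.
by rewrite cn0 mul0r.
Qed.

Lemma is_derive_shift0 (g : C -> C) (z d : C) : is_derive z (1 : C) g d ->
  is_derive (0 : C) (1 : C) (fun h => g (z + h)) d.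
Proof.
move=> dg.
have dz : is_derive (0 : C) (1 : C) (fun h : C => h * 1 + z) 1 := is_derive_affine 1 z.
have dg' : is_derive ((fun h : C => h * 1 + z) 0) (1 : C) g d by rewrite mul0r add0r.
have := is_derive_chain dz dg'; rewrite mul1r.
congr (is_derive _ _ _ _); apply/funext => h /=.
by rewrite mulr1 addrC.
Qed.

Lemma is_derive_unshift0 (g : C -> C) (z d : C) :
  is_derive (0 : C) (1 : C) (fun h => g (z + h)) d -> is_derive z (1 : C) g d.
Proof.
move=> dg.
have dz : is_derive z (1 : C) (fun w : C => w - z) 1.
  apply: (@quad_is_derive _ _ _ _ 0 1) => // h _.
  have -> : z + h - z - (z - z) - h * 1 = 0 by ring.
  by rewrite cn0 mul0r.
have dg' : is_derive ((fun w : C => w - z) z) (1 : C) (fun h => g (z + h)) d by rewrite subrr.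
have := is_derive_chain dz dg'; rewrite mul1r.
congr (is_derive _ _ _ _); apply/funext => w /=.
by rewrite addrC subrK.
Qed.

Lemma analytic_expands (V : set (CP1 R)) Y p y : analytic_vfield V Y -> V p ->
  exists L : 'I_n -> T -> C, forall i,
    expands (fun w : T => Y (chart p w.1) w.2 i 0) (0, y) (L i).
Proof.
move=> aY Vp.
have h i : exists L, expands (fun w : T => Y (chart p w.1) w.2 i 0) (0, y) L.
  have [c hc] := aY p y i Vp; exact: (joint_series_expands hc).
by have /choice[L hL] := h; exists L.
Qed.

Lemma derive_vert_loc Y p y (L : 'I_n -> T -> C) (v : T) :
  (forall i, expands (fun w : T => Y (chart p w.1) w.2 i 0) (0, y) (L i)) ->
  'D_v (vert_loc Y p) (0, y) = (0, \col_i L i v).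
Proof.
move=> hL; apply: derive_tot => /=; first exact: is_derive_cst.
move=> i; rewrite mxE.
pose g := fun h : C => h *: v + ((0, y) : T).
have g0 : g 0 = (0, y) by rewrite /g scale0r add0r.
have g1 : is_derive (0 : C) (1 : C) (fun h => (g h).1) v.1 := is_derive_affine v.1 0.
have g2 j : is_derive (0 : C) (1 : C) (fun h => (g h).2 j 0) (v.2 j 0).
  have := is_derive_affine (v.2 j 0) (y j 0).
  by congr (is_derive _ _ _ _); apply/funext => h; rewrite /= !mxE.
exact: (expands_chain (hL i) g0 g1 g2).
Qed.

Variable A : 'M[CP1 R -> C]_n.

Lemma X_locE p (w : T) : X_loc A p w = (speed p w.1, coefs A (chart p w.1) *m w.2).
Proof. by []. Qed.

Lemma derive_X_loc p y (v : 'cV[C]_n) :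
  'D_((0, v) : T) (X_loc A p) (0, y) = (0, coefs A p *m v).
Proof.
have fst0 (h : C) : (h *: ((0, v) : T) + ((0, y) : T)).1 = 0 :> C.
  by rewrite /= scaler0 addr0.
apply: derive_tot.
  have -> : (fun h : C => (X_loc A p (h *: ((0, v) : T) + ((0, y) : T))).1) = cst (speed p 0).
    by apply/funext => h; rewrite X_locE fst0.
  exact: is_derive_cst.
move=> j; have := is_derive_affine ((coefs A p *m v) j 0) ((coefs A p *m y) j 0).
congr (is_derive _ _ _ _); apply/funext => h; rewrite X_locE fst0 chart0.
have -> : (h *: ((0, v) : T) + ((0, y) : T)).2 = h *: v + y by [].
by rewrite mulmxDr -scalemxAr !mxE.
Qed.

(** The bracket with [X] of a vertical field [Y] is [A Y] minus the derivative
    of [Y] in the direction of [X], and the latter is its differential [L] applied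
    to [X]. *)
Lemma bracket_vert_X Y p y (L : 'I_n -> T -> C) :
  (forall i, expands (fun w : T => Y (chart p w.1) w.2 i 0) (0, y) (L i)) ->
  lie_bracket (vert_loc Y p) (X_loc A p) (0, y) =
  (0, coefs A p *m Y p y - \col_i L i (speed p 0, coefs A p *m y)).
Proof.
move=> hL; rewrite /lie_bracket.
have -> : vert_loc Y p (0, y) = (0, Y p y) by rewrite /vert_loc /= chart0.
have -> : X_loc A p (0, y) = (speed p 0, coefs A p *m y).
  by rewrite X_locE chart0.
rewrite derive_X_loc (derive_vert_loc _ hL).
by congr (_, _); exact: subrr.
Qed.

(** [x |-> (x, Phi(x) c)] is an integral curve of [X], with tangent vector
    [(1, A Phi(x) c)]. *)
Lemma derive_along_flow (Phi : CP1 R -> 'M[C]_n) Y z c (L : 'I_n -> T -> C) i :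
  mderive (fun z => Phi (Some z)) z (coefs A (Some z) *m Phi (Some z)) ->
  (forall i, expands (fun w : T => Y (chart (Some z) w.1) w.2 i 0) (0, Phi (Some z) *m c) (L i)) ->
  is_derive z (1 : C) (fun z => Y (Some z) (Phi (Some z) *m c) i 0)
    (L i (1, coefs A (Some z) *m (Phi (Some z) *m c))).
Proof.
move=> dPhi hL; apply: is_derive_unshift0.
pose g := fun h : C => ((h, Phi (Some (z + h)) *m c) : T).
pose v : T := (1, coefs A (Some z) *m (Phi (Some z) *m c)).
have g0 : g 0 = (0, Phi (Some z) *m c) by rewrite /g addr0.
have g1 : is_derive (0 : C) (1 : C) (fun h => (g h).1) v.1.
  have := is_derive_affine (1 : C) 0.
  by congr (is_derive _ _ _ _); apply/funext => h /=; rewrite mulr1 addr0.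
have g2 j : is_derive (0 : C) (1 : C) (fun h => (g h).2 j 0) (v.2 j 0).
  have := mderiveM dPhi (mderive_cst c z) j 0.
  rewrite mulmx0 addr0 -mulmxA; exact: (@is_derive_shift0 (fun z => (Phi (Some z) *m c) j 0)).
exact: (expands_chain (hL i) g0 g1 g2).
Qed.

End Transport.

Section LocallyConstant.
Variables (R : realType) (X : topologicalType) (E : Type) (V : set X).

Lemma locally_constant (f : X -> E) : simply_connected R V ->
  (forall p, V p -> \forall q \near p, f q = f p) -> forall p q, V p -> V q -> f p = f q.
Proof.
move=> [_ pc _] hf p q Vp Vq.
have [g [/continuous_clamp_path cg gV g0 g1]] := pc _ _ Vp Vq.
pose k := g \o @clamp R.
have kV t : V (k t) by apply: gV; exact: clamp01.
have k0 : k 0 = p by rewrite /k /= clampE ?lexx ?ler01.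
have k1 : k 1 = q by rewrite /k /= clampE ?lexx ?ler01.
suff : f (k 0) = f (k 1) by rewrite k0 k1.
apply: (@interval_chain R (fun a b => f (k a) = f (k b))) => //.
  by move=> a b c _ _ _ _ -> ->.
move=> x _ _.
have near_x : \forall y \near x, f (k y) = f (k x) := cg x _ (hf _ (kV x)).
have /nbhs_ballP[e /= e0 he] := near_x.
exists e => // a b _ ax xb _ xea bxe.
have h y : x - e < y -> y < x + e -> f (k y) = f (k x).
  by move=> h1 h2; apply: he; rewrite /ball /= ltr_norml; lra.
by rewrite !h//; lra.
Qed.

End LocallyConstant.

(** * Polynomial vertical symmetries *)

Section Symmetries.
Variables (R : realType) (n : nat).
Local Notation C := (Cplx R).
Local Notation T := (tot R n).
Implicit Types (P Q : pvfield R n) (y c : 'cV[C]_n) (p q : CP1 R) (Y Z : vfield R n).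
Variables (A : 'M[CP1 R -> C]_n) (V : set (CP1 R)) (x0 : CP1 R).
Hypotheses (openV : open V) (scV : simply_connected R V) (Vx0 : V x0).
(* At infinity, [A] is [O(t ^ 2)] when the system is regular there. *)
Hypothesis coefs_infty : V None -> coefs A None = 0.
Variables (Phi Psi : CP1 R -> 'M[C]_n).
Hypothesis Phi0 : Phi x0 = 1%:M.
Hypothesis PsiPhi : forall p, V p -> Psi p *m Phi p = 1%:M.
Hypothesis analytic_PhiPsi : forall p, V p -> forall i j,
  analytic_at (fun q => Phi q i j) p /\ analytic_at (fun q => Psi q i j) p.
Hypothesis solPhi : forall p, V p -> solves A Phi p.
Hypothesis solPsi : forall p, V p -> solves_dual A Psi p.

Local Notation push := (push Phi Psi V).

Lemma PhiPsi p : V p -> Phi p *m Psi p = 1%:M.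
Proof. by move=> /PsiPhi; exact: mulmx1C. Qed.

Lemma Psi0 : Psi x0 = 1%:M.
Proof. by have := PsiPhi Vx0; rewrite Phi0 mulmx1. Qed.

Lemma push_in P p y : V p -> push P p y = Phi p *m pfun P (Psi p *m y).
Proof. by move=> Vp; rewrite /push asboolT. Qed.

Lemma push_flow P p c : V p -> push P p (Phi p *m c) = Phi p *m pfun P c.
Proof.
move=> Vp; have e : Psi p *m (Phi p *m c) = c.
  by rewrite (mulmxA (Psi p) (Phi p) c) (PsiPhi Vp) mul1mx.
by rewrite (push_in P _ Vp) e.
Qed.

Lemma push_out P p : ~ V p -> push P p = 0.
Proof. by move=> nVp; apply/funext => y; rewrite /push asboolF. Qed.

Lemma push_x0 P : push P x0 = pfun P.
Proof. by apply/funext => y; rewrite push_in// Phi0 Psi0 !mul1mx. Qed.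

Lemma push_lin (a : C) P Q : push (a *: P + Q) = a *: push P + push Q.
Proof.
apply/funext => p; apply/funext => y.
have -> : (a *: push P + push Q) p y = a *: push P p y + push Q p y by [].
have [Vp|nVp] := pselect (V p); first by rewrite !push_in// pfun_lin mulmxDr scalemxAr.
by rewrite !push_out//= scaler0 addr0.
Qed.

Lemma push0 : push 0 = 0.
Proof. by have := push_lin (-1) 0 0; rewrite !scaleN1r oppr0 addr0 addNr. Qed.

Lemma pushD P Q : push (P + Q) = push P + push Q.
Proof. by have := push_lin 1 P Q; rewrite !scale1r. Qed.

Lemma push_inj P Q : push P = push Q -> P = Q.
Proof. by move=> h; apply: pfun_inj; rewrite -!push_x0 h. Qed.

Lemma push_analytic P : analytic_vfield V (push P).
Proof.
move=> p b i Vp.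
pose f (t : C) y := \sum_(k <- index_enum 'I_n) Phi (chart p t) i k *
   meval (fun j => \sum_(l <- index_enum 'I_n) Psi (chart p t) j l * y l 0) (P k).
have pf : polyan b f.
  apply: polyan_sum => k; apply: polyanM.
    exact: (polyan_fun b (proj1 (analytic_PhiPsi Vp i k))).
  apply: (@polyan_meval R n b (P k) (fun j t y => \sum_(l <- index_enum 'I_n) Psi (chart p t) j l * y l 0)) => j.
  apply: polyan_sum => l; apply: polyanM; last exact: polyan_coord.
  exact: (polyan_fun b (proj2 (analytic_PhiPsi Vp j l))).
have [c hc] := polyan_joint pf; exists c.
have /nbhs_chart[r r0 hr] : nbhs p V by exact: open_nbhs_nbhs.
have nV : \forall w \near ((0, b) : T), V (chart p w.1).
  apply/(@nbhs_cnP R T); exists r => // w wr; apply: hr; apply: le_lt_trans wr.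
  by have := cn_fst (w - ((0, b) : T)); rewrite /= subr0.
move: hc nV; apply: filterS2 => w hw Vw.
suff -> : push P (chart p w.1) w.2 i 0 = f w.1 w.2 by [].
rewrite push_in// mxE; apply: eq_bigr => k _; rewrite mxE; congr (_ * _).
by apply: meval_eq => j; rewrite mxE.
Qed.

Lemma push_polynomial P : polynomial_vfield V (push P).
Proof.
have [d hd] := msize_conj (P : {ffun 'I_n -> mpoly n C}); exists d => p Vp.
exists (conj_field (Phi p) (Psi p) P); last by move=> i; exact: hd.
move=> y i; rewrite push_in// meval_conj mxE; apply: eq_bigr => k _.
by rewrite mxE; congr (_ * _); apply: meval_eq => j; rewrite mxE.
Qed.

(** Along the integral curve [x |-> (x, Phi(x) c)] the field [push P] is
    [Phi(x) P(c)], with derivative [A(x) Phi(x) P(c)]; such a curve passes through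
    each point as [Phi] is invertible. *)
Lemma push_symmetry P p y : V p -> lie_bracket (vert_loc (push P) p) (X_loc A p) (0, y) = 0.
Proof.
move=> Vp; have [L hL] := analytic_expands y (@push_analytic P) Vp.
rewrite (bracket_vert_X A hL).
suff -> : coefs A p *m push P p y = \col_i L i (speed p 0, coefs A p *m y) by rewrite subrr.
case: p Vp hL => [z|] Vp hL; last first.
  (* Over infinity, [A] and [X] are zero and [L] is linear. *)
  rewrite coefs_infty// !mul0mx; apply/matrixP => i j; rewrite !mxE.
  have [/(_ (-1) 0 0)] := hL i.
  by rewrite scaleN1r oppr0 addr0 mulN1r addNr /speed expr0n /= oppr0.
pose c := Psi (Some z) *m y.
have yE : Phi (Some z) *m c = y by rewrite mulmxA PhiPsi// mul1mx.
have dPhi := solPhi Vp.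
apply/matrixP => i j; rewrite (ord1 j) [RHS]mxE.
have hL' i' : expands (fun w : T => push P (chart (Some z) w.1) w.2 i' 0)
    (0, Phi (Some z) *m c) (L i') by rewrite yE.
have [_ d1] := derive_along_flow (c := c) i dPhi hL'.
have [_ d2] := mderiveM dPhi (mderive_cst (pfun P c) z) i 0.
rewrite mulmx0 addr0 in d2; rewrite yE in d1.
have nV : \forall w \near z, push P (Some w) (Phi (Some w) *m c) i 0 = (Phi (Some w) *m pfun P c) i 0.
  have nV : \forall w \near z, V (Some w).
    have : nbhs (Some z : CP1 R) V by exact: open_nbhs_nbhs.
    exact.
  by move: nV; apply: filterS => w Vw; rewrite (push_flow P c Vw).
have d12 := near_eq_derive (1 : C) nV; rewrite d1 d2 in d12.
have pE : push P (Some z) y = Phi (Some z) *m pfun P c by exact: push_in.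
by rewrite d12 pE (mulmxA (coefs A (Some z)) (Phi (Some z)) (pfun P c)).
Qed.

Lemma push_sym P : sym A V (push P).
Proof.
split; last exact: push_polynomial.
split; [exact: push_out | exact: push_analytic |].
by move=> p y Vp; exact: push_symmetry.
Qed.

(** By the symmetry condition, [x |-> Y(x, Phi(x) c)] satisfies the differential
    system, so its product by [Psi], a solution of the dual system, has
    derivative zero. *)
Lemma pull_constant Y c i : sym A V Y -> forall p, V p ->
  (Psi p *m Y p (Phi p *m c)) i 0 = Y x0 c i 0.
Proof.
move=> [[Yout aY sY] _] p Vp.
suff h : forall p, V p -> \forall q \near p,
    (Psi q *m Y q (Phi q *m c)) i 0 = (Psi p *m Y p (Phi p *m c)) i 0.
  rewrite (locally_constant scV h Vp Vx0).
  by rewrite Psi0 Phi0 !mul1mx.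
move=> {}p {}Vp.
apply: (@flat_near_const R (fun q => (Psi q *m Y q (Phi q *m c)) i 0)); split.
  have nV : \forall q \near p, V q by exact: open_nbhs_nbhs.
  move: nV; apply: filterS => -[z|//] Vz.
  have [L hL] := analytic_expands (Phi (Some z) *m c) aY Vz.
  have := sY _ (Phi (Some z) *m c) Vz; rewrite (bracket_vert_X A hL).
  move=> /(congr1 snd) /= /eqP; rewrite subr_eq0 => /eqP sL.
  have dY : mderive (fun z => Y (Some z) (Phi (Some z) *m c)) z
      (coefs A (Some z) *m Y (Some z) (Phi (Some z) *m c)).
    move=> k l; rewrite (ord1 l) sL mxE.
    exact: (derive_along_flow (c := c) k (solPhi Vz) hL).
  have := mderiveM (solPsi Vz) dY i 0.
  by rewrite mulNmx mulmxA addNr mxE.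
have -> : (fun q => (Psi q *m Y q (Phi q *m c)) i 0) \o chart p =
    (fun t => \sum_(k <- index_enum 'I_n) Psi (chart p t) i k * Y (chart p t) (Phi (chart p t) *m c) k 0).
  by apply/funext => t /=; rewrite mxE.
have cPhi j k : {for 0, continuous (fun t : C => Phi (chart p t) j k)}.
  exact: analytic_at0_continuous (proj1 (analytic_PhiPsi Vp j k)).
have cPsi j k : {for 0, continuous (fun t : C => Psi (chart p t) j k)}.
  exact: analytic_at0_continuous (proj2 (analytic_PhiPsi Vp j k)).
apply: continuous0_sum => k.
have [L hL] := analytic_expands (Phi p *m c) aY Vp.
pose g := fun t : C => ((t, Phi (chart p t) *m c) : T).
have g0 : g 0 = (0, Phi p *m c) by rewrite /g chart0.
have g1 : {for 0, continuous (fun t : C => (g t).1)} by exact: (@cvg_id _ (nbhs (0 : C))).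
have g2 j : {for 0, continuous (fun t : C => (g t).2 j 0)}.
  have -> : (fun t : C => (g t).2 j 0) = (fun t => \sum_(l <- index_enum 'I_n) Phi (chart p t) j l * c l 0).
    by apply/funext => t; rewrite /= mxE.
  apply: continuous0_sum => l.
  exact: (@cvgM C (C : topologicalType) (nbhs (0 : C)) _ _ _ _ _ (cPhi j l) (@cst_continuous C C (c l 0) 0)).
have cY := expands_continuous (hL k) g0 g1 g2.
exact: (@cvgM C (C : topologicalType) (nbhs (0 : C)) _ _ _ _ _ (cPsi i k) cY).
Qed.

Lemma sym_push Y P : sym A V Y -> Y x0 = pfun P -> Y = push P.
Proof.
move=> sY Y0; apply/funext => p; apply/funext => y.
have [Vp|nVp] := pselect (V p); last first.
  by have [[Yout _ _] _] := sY; rewrite Yout// push_out.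
pose c := Psi p *m y.
have yE : Phi p *m c = y by rewrite mulmxA PhiPsi// mul1mx.
have h : Psi p *m Y p y = pfun P c.
  apply/matrixP => i j; rewrite (ord1 j) -Y0 -(pull_constant c i sY Vp).
  by rewrite yE.
by rewrite push_in// -/c -h mulmxA PhiPsi// mul1mx.
Qed.

Lemma sym_range Y : sym A V Y -> exists P, Y = push P.
Proof.
move=> sY; have [_ [d hd]] := sY; have [P hP _] := hd _ Vx0.
by exists P; apply: sym_push => //; apply/is_pvfieldP.
Qed.

Lemma derive_push P p y (v : 'cV[C]_n) : V p ->
  'D_((0, v) : T) (vert_loc (push P) p) (0, y) =
  (0, Phi p *m \col_k \sum_j (Psi p *m v) j 0 * meval (fun j => (Psi p *m y) j 0) (mderiv j (P k))).
Proof.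
move=> Vp; apply: derive_tot; first exact: is_derive_cst.
pose N (h : C) : 'cV[C]_n :=
  \col_k meval (fun j => (Psi p *m y) j 0 + h * (Psi p *m v) j 0) (P k).
have dN : mderive N 0 (\col_k \sum_j (Psi p *m v) j 0 *
    meval (fun j => (Psi p *m y) j 0) (mderiv j (P k))).
  move=> k l; rewrite mxE.
  have := line_derivable_all (P k) (fun j => (Psi p *m y) j 0) (fun j => (Psi p *m v) j 0).
  by congr (is_derive _ _ _ _); apply/funext => h; rewrite mxE.
move=> i; have := mderiveM (mderive_cst (Phi p) 0) dN i 0.
rewrite mul0mx add0r; congr (is_derive _ _ _ _); apply/funext => h.
have pt0 : chart p (h *: ((0, v) : T) + ((0, y) : T)).1 = p.
  by rewrite -[RHS]chart0; congr chart; rewrite /= scaler0 addr0.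
have NE : N h = pfun P (Psi p *m (h *: v + y)).
  apply/matrixP => k l; rewrite mxE [RHS]mxE; apply: meval_eq => j.
  by rewrite mulmxDr -scalemxAr [RHS]mxE [X in _ = X + _]mxE addrC.
have -> : (vert_loc (push P) p (h *: ((0, v) : T) + ((0, y) : T))).2 =
    push P (chart p (h *: ((0, v) : T) + ((0, y) : T)).1) (h *: v + y) by [].
by rewrite pt0 (push_in P _ Vp) NE.
Qed.

(** In a fibre, [push] is the linear change of coordinates by [Phi p], and linear
    changes of coordinates commute with brackets. *)
Lemma vbracket_push P Q : vbracket (push P) (push Q) = push (pvbracket P Q).
Proof.
apply/funext => p; apply/funext => y; rewrite /vbracket /lie_bracket.
have [Vp|nVp] := pselect (V p); last first.
  have e S : vert_loc (push S) p (0, y) = 0.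
    by rewrite /vert_loc /= chart0 push_out.
  by rewrite !e !derive0 subrr push_out.
have e S : vert_loc (push S) p (0, y) = (0, push S p y).
  by rewrite /vert_loc /= chart0.
have snd_sub (a b : 'cV[C]_n) : (((0, a) : T) - ((0, b) : T)).2 = a - b by [].
rewrite !e !(derive_push _ _ _ Vp) snd_sub -mulmxBr (push_in (pvbracket P Q) y Vp).
apply: (congr1 (mulmx (Phi p))).
have PsiPush S : Psi p *m push S p y = pfun S (Psi p *m y).
  by rewrite push_in// mulmxA PsiPhi// mul1mx.
apply/matrixP => k l; rewrite !PsiPush !mxE pvbracketE fbracketE mevalB.
by congr (_ - _); rewrite /pvder raddf_sum /=; apply: eq_bigr => j _; rewrite mevalM mxE.
Qed.

(** The polynomial symmetries are exactly the [push P], and the value at [x0]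
    recovers [P] from [push P]. *)
Lemma sym_of_fundamental_matrix :
  (forall Y0 : pvfield R n,
     exists! Y : vfield R n, sym A V Y /\ is_pvfield (Y x0) Y0) /\
  lie_isomorphic (sym A V) (@vbracket R n) [set: pvfield R n] (@pvbracket R n).
Proof.
split.
  move=> P; exists (push P); split.
    by split; [exact: push_sym | apply/is_pvfieldP; exact: push_x0].
  by move=> Y [sY /is_pvfieldP Y0]; rewrite (sym_push sY Y0).
have pvLie := @pv_lie_algebra R n.
split=> //.
  split.
  - by rewrite -push0; exact: push_sym.
  - move=> a u v /sym_range[P ->] /sym_range[Q ->]; rewrite -push_lin; exact: push_sym.
  - by move=> u v /sym_range[P ->] /sym_range[Q ->]; rewrite vbracket_push; exact: push_sym.
  - move=> a u v w /sym_range[P ->] /sym_range[Q ->] /sym_range[S ->].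
    by rewrite -push_lin !vbracket_push -push_lin (lie_brl pvLie).
  - move=> a u v w /sym_range[P ->] /sym_range[Q ->] /sym_range[S ->].
    by rewrite -push_lin !vbracket_push -push_lin (lie_brr pvLie).
  - by move=> u /sym_range[P ->]; rewrite vbracket_push (lie_alt pvLie)// push0.
  - move=> u v w /sym_range[P ->] /sym_range[Q ->] /sym_range[S ->].
    rewrite !vbracket_push.
    by rewrite -!pushD (lie_jacobi pvLie)// push0.
have /choice[phi hphi] : forall Y, exists P, sym A V Y -> Y = push P.
  move=> Y; case: (pselect (sym A V Y)) => [/sym_range[P hP]|nY]; first by exists P.
  by exists 0.
have phiK P : phi (push P) = P by apply: push_inj; rewrite -hphi//; exact: push_sym.
exists phi; split.
- split.
  + by move=> Y _.
  + move=> Y Y'; rewrite !inE => sY sY' e.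
    by rewrite (hphi _ sY) (hphi _ sY') e.
  + by move=> P _; exists (push P); [exact: push_sym | exact: phiK].
- by move=> a u v /sym_range[P ->] /sym_range[Q ->]; rewrite -push_lin !phiK.
- by move=> u v /sym_range[P ->] /sym_range[Q ->]; rewrite vbracket_push !phiK.
Qed.

End Symmetries.

Theorem corollary6p2 (R : realType) (n : nat)
    (U : set (CP1 R)) (openU : open U)
    (K : set (CP1 R -> Cplx R)) (fieldK : function_field U K)
    (A : 'M[CP1 R -> Cplx R]_n) (AK : forall i j, K (A i j))
    (x0 : CP1 R) (Ux0 : U x0) (regx0 : ~ singular A x0)
    (V : set (CP1 R)) (openV : open V) (Vx0 : V x0) (VU : V `<=` U)
    (regV : forall p, V p -> ~ singular A p)
    (scV : simply_connected R V) :
  (forall Y0 : pvfield R n,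
     exists! Y : vfield R n, sym A V Y /\ is_pvfield (Y x0) Y0) /\
  lie_isomorphic (sym A V) (@vbracket R n) [set: pvfield R n] (@pvbracket R n).
Proof.
have mA p i j : V p -> analytic_at (A i j) p \/ pole_at (A i j) p.
  by move=> /VU Up; exact: (ff_mero fieldK (AK i j)).
(* At infinity, [A] has the factor [- t ^ 2]. *)
have cinf : V None -> coefs A None = 0.
  move=> Vinf; have [B _ hB] := regular_coefs (fun i j => mA None i j Vinf) (regV None Vinf).
  have := nbhs_singleton hB; rewrite chart0 => ->.
  by rewrite /speed expr0n /= oppr0 scale0r.
have [Phi [Psi [h1 h2 h3 h4 h5]]] := fundamental_matrix openV scV mA regV Vx0.
exact: (sym_of_fundamental_matrix openV scV Vx0 cinf h1 h2 h3 h4 h5).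
Qed.
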